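(* Let $C$ be a configuration in $\mathbb{Z}^2$ with $5$ or more pieces. Then the speed of $C$ is at most $2/3$.
   Context: A placement of size $p$ is a finite subset $X=\{\vec x_1,\dots,\vec x_p\}\subset\mathbb{Z}^n$ (the locations of $p\ge 1$ indistinguishable pieces). Here $n=2$. A unit vector means $\pm$ a standard basis vector. Legal moves: a piece at location $l$ may shift to $l+e$ ($e$ a unit vector) if $l+e$ is unoccupied. If $l+e$ is occupied by another piece and $l+2e$ is unoccupied, the piece may hop over the occupant of $l+e$ to land at $l+2e$. A jump is a sequence of one or more successive hops by a single piece (in possibly different directions, the moving piece being at its current position, its previous positions being vacated). One legal move is either one shift or one jump. The centroid of $X$ is $c(X)=\frac1p\sum_{u=1}^p\vec x_u$. For placements $X,Y$ of size $p$ the displacement is $d(X,Y)=\sum_{i=1}^n|c_i(X)-c_i(Y)|$. For $m\ge1$, an $m$-move trajectory is a sequence of placements $X_0,X_1,\dots,X_m$ where each $X_{u+1}$ is reachable from $X_u$ in a single legal move; its speed is $d(X_0,X_m)/m$. Placements $X,Y$ are translates if $X+\vec a=Y$ for some $\vec a\in\mathbb{Z}^n$. A configuration is a translation class of placements (translates are said to be represented by the same configuration). The speed of a configuration $C$ is the maximum speed attained by any trajectory $X_0,\dots,X_m$ ($m\ge1$) whose endpoints $X_0,X_m$ are translates represented by $C$; thus ''the speed of $C$ is at most $2/3$'' means that every such trajectory has speed at most $2/3$. *)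

(* Defs.v *)
From Stdlib Require Import Relation_Operators.
From mathcomp Require Import all_boot all_order all_algebra finmap.

Set Implicit Arguments.
Unset Strict Implicit.
Unset Printing Implicit Defensive.

Import Order.TTheory GRing.Theory Num.Theory.
Local Open Scope fset_scope.
Local Open Scope ring_scope.

Definition point (n : nat) := 'rV[int]_n.

(* The size [p >= 1] is imposed in [is_configuration]; legal moves keep it. *)
Definition placement (n : nat) := {fset 'rV[int]_n}.

Definition unit_vector (n : nat) (e : point n) : Prop :=
  exists i : 'I_n, e = delta_mx 0 i \/ e = - delta_mx 0 i.

Definition shift (n : nat) (X : placement n) (l l' : point n) : Prop :=
  exists e : point n, [/\ unit_vector e, l' = l + e & l' \notin X].

(* [B] is the set of pieces other than the hopping one, which stands at [l]. *)
Definition hop (n : nat) (B : placement n) (l l' : point n) : Prop :=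
  exists e : point n,
    [/\ unit_vector e, l + e \in B, l' = l + e *+ 2 & l' \notin B].

(* All hops are taken relative to [X `\ l], since the cells that the jumping
   piece leaves, its starting cell included, are vacated. *)
Definition jump (n : nat) (X : placement n) (l l' : point n) : Prop :=
  clos_trans (point n) (hop (X `\ l)) l l'.

Definition legal_move (n : nat) (X Y : placement n) : Prop :=
  exists l l' : point n,
    [/\ l \in X, shift X l l' \/ jump X l l' & Y = l' |` (X `\ l)].

Definition centroid (n : nat) (X : placement n) : 'rV[rat]_n :=
  (#|` X|%:R)^-1 *: \sum_(x <- X) map_mx intr x.

Definition displacement (n : nat) (X Y : placement n) : rat :=
  \sum_(i < n) `|centroid X 0 i - centroid Y 0 i|.

(* Only the values [X 0], ..., [X m] are relevant. *)
Definition trajectory (n m : nat) (X : nat -> placement n) : Prop :=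
  (0 < m)%N /\ forall u : nat, (u < m)%N -> legal_move (X u) (X u.+1).

Definition trajectory_speed (n m : nat) (X : nat -> placement n) : rat :=
  displacement (X 0%N) (X m) / m%:R.

Definition translates (n : nat) (X Y : placement n) : Prop :=
  exists a : point n, [fset x + a | x in X] = Y.

(* [C] is the translation class of a placement of size [p]. *)
Definition is_configuration (n p : nat) (C : placement n -> Prop) : Prop :=
  (0 < p)%N /\
  exists X : placement n,
    #|` X| = p /\ forall Y : placement n, C Y <-> translates X Y.

Definition speed_at_most (n : nat) (C : placement n -> Prop) (r : rat) : Prop :=
  forall (m : nat) (X : nat -> placement n),
    trajectory m X -> C (X 0%N) -> C (X m) -> trajectory_speed m X <= r.

(* Main.v *)
(** After a reflection the total displacement [a] of a period has nonnegative
coordinates. Call [u + v] the level of the cell [(u, v)]. In a period the lowest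
occupied level (the rear) and the highest one (the front) both rise by [|a|_1], and
one move raises each of them by at most 1. Give a move the weight
[4 - 3 (gain of the rear + gain of the front)]. The claim is that the weight of a
period is nonnegative, and since the trajectory can be repeated it is enough to
bound the weights of all trajectories from below.

A move has negative weight (namely -2) only if it is a back move B, raising both
ends: the only piece of the rear level then jumps just beyond the front, hopping
over one piece on every other level. The remaining moves raise the front only (F) or
the rear only (R), with weight 1, or leave both ends alone (N), with weight 4, or
have weight at least 7. Parity allows B only when front and rear differ by an odd
number, so a sequence without two consecutive B cannot have a very negative weight.

Two consecutive B determine the neighbourhood of both ends up to symmetry:
the two rear pieces are adjacent, the cells over which the next ones must travel are
known, and the two pieces brought to the front block each other's tracks. With at
least five pieces this excludes a finite list of words in the letters B, F, R, N as
consecutive moves; reversing time and space exchanges F and R and doubles the list.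
A Bellman-Ford potential on the prefixes of these words then shows that words
avoiding them have weight at least -6. *)

From Stdlib Require Import ZArith Lia List Classical Bool.

(** * Placements as predicates on pairs of integers, and words of moves *)

Section Levels.
Import ListNotations.
Local Open Scope Z_scope.

(** Over a period of m moves the weights add up to 4m - 6|a|_1, so their nonnegativity is exactly
    the bound 2/3, the centroid moving by a. A hop changes one coordinate by 2, so a jump stays in
    one class of cells modulo 2. Hence B needs odd width (front minus rear) and keeps it, F and R
    change the parity of the width, N keeps it. Two B that are not consecutive are separated by an
    N, by two of F and R, or by a move of weight at least 7, which pays for one B. Only BB is
    dangerous. The exclusions rest on one mechanism: a rising jump crosses every second level, each
    time over a piece of the level between. If that level holds a single piece, the class of the
    jump decides between the two upward directions over it, and an occupied cell before or behind
    the piece closes the passage. After BB the levels w + 1 and w + 2 are of this kind, and levels 2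
    and 3 become so in most continuations that raise the rear further. Five pieces make w at least 5
    in that case, so that the two ends do not overlap. *)

Definition config := Z -> Z -> Prop.

Definition zhop (B : config) (a b c d : Z) : Prop :=
  ~ B c d /\
  ((c = a + 2 /\ d = b /\ B (a + 1) b) \/ (c = a - 2 /\ d = b /\ B (a - 1) b) \/
   (c = a /\ d = b + 2 /\ B a (b + 1)) \/ (c = a /\ d = b - 2 /\ B a (b - 1))).

Inductive jumps (B : config) : Z -> Z -> Z -> Z -> Prop :=
| jumps_one a b c d : zhop B a b c d -> jumps B a b c d
| jumps_cons a b c d u v : zhop B a b c d -> jumps B c d u v -> jumps B a b u v.

Definition adjacent (a b c d : Z) : Prop :=
  (c = a + 1 /\ d = b) \/ (c = a - 1 /\ d = b) \/
  (c = a /\ d = b + 1) \/ (c = a /\ d = b - 1).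

Definition minus (X : config) (a b : Z) : config :=
  fun u v => X u v /\ ~ (u = a /\ v = b).

Definition moves (X Y : config) (a b c d : Z) : Prop :=
  X a b /\
  (forall u v, Y u v <-> (u = c /\ v = d) \/ (X u v /\ ~ (u = a /\ v = b))) /\
  ((adjacent a b c d /\ ~ X c d) \/ jumps (minus X a b) a b c d).

Definition spans (X : config) (r f : Z) : Prop :=
  (forall u v, X u v -> r <= u + v <= f) /\
  (exists u v, X u v /\ u + v = r) /\ (exists u v, X u v /\ u + v = f).

(** Cardinality at least five without counting: no four cells exhaust the placement. It is applied
    to the few pieces that a narrow placement could consist of. *)
Definition five_pieces (X : config) : Prop :=
  forall a1 b1 a2 b2 a3 b3 a4 b4, exists u v, X u v /\
    ~ (u = a1 /\ v = b1) /\ ~ (u = a2 /\ v = b2) /\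
    ~ (u = a3 /\ v = b3) /\ ~ (u = a4 /\ v = b4).

(* A move raises both ends (back), the front only, the rear only, or neither. *)
Inductive letter := LB | LF | LR | LN.
Definition rear_gain (x : letter) : Z := match x with LB | LR => 1 | _ => 0 end.
Definition front_gain (x : letter) : Z := match x with LB | LF => 1 | _ => 0 end.

Fixpoint path (w : list letter) (X : config) (r f : Z) : Prop :=
  spans X r f /\ five_pieces X /\
  match w with
  | [] => True
  | x :: w' => exists Y, (exists a b c d, moves X Y a b c d) /\
                 path w' Y (r + rear_gain x) (f + front_gain x)
  end.

Definition forbidden (w : list letter) : Prop :=
  forall X r f, ~ path w X r f.

(** * Jumps: parity, reversal and crossing of levels *)

Lemma zhop_target B a b c d : zhop B a b c d -> ~ B c d.
Proof. intros [H _]; exact H. Qed.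

Lemma jumps_target B a b c d : jumps B a b c d -> ~ B c d.
Proof. induction 1; auto; eapply zhop_target; eauto. Qed.

Lemma jumps_parity B a b c d :
  jumps B a b c d -> (exists i, c = a + 2 * i) /\ (exists j, d = b + 2 * j).
Proof.
induction 1 as [a b c d H|a b c d u v H J IH].
- destruct H as [_ H].
  destruct H as [H|[H|[H|H]]]; split;
    solve [exists 0; lia | exists 1; lia | exists (-1); lia].
- destruct IH as [[i Hi] [j Hj]]. destruct H as [_ H].
  destruct H as [H|[H|[H|H]]]; split;
    solve [exists i; lia | exists (i+1); lia | exists (i-1); lia
          | exists j; lia | exists (j+1); lia | exists (j-1); lia].
Qed.

Lemma jumps_first B a b c d : jumps B a b c d -> exists c' d', zhop B a b c' d'.
Proof. induction 1; eauto. Qed.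

(** Discrete connectedness: some hop leaves [S], from a cell in the class of the start modulo 2 that
    is free unless it is the start. With [S] a short list of cells this shows where a piece is
    stuck, with [S] a half plane how it crosses a level. *)
Lemma jumps_exit (S : Z -> Z -> Prop) B a b c d :
  (forall u v, S u v \/ ~ S u v) ->
  jumps B a b c d -> S a b -> ~ S c d ->
  exists u v u' v', S u v /\ ~ S u' v' /\ zhop B u v u' v' /\
    (exists i, u = a + 2 * i) /\ (exists j, v = b + 2 * j) /\
    ((u = a /\ v = b) \/ ~ B u v).
Proof.
intros dS J. induction J as [a b c d H|a b c d u v H J IH]; intros Sa Sc.
- exists a, b, c, d. split; [auto|split; [auto|split; [auto|]]].
  split; [exists 0; lia|split; [exists 0; lia|auto]].
- destruct (dS c d) as [Hcd|Hcd].
  + destruct (IH Hcd Sc) as (p & q & p' & q' & H1 & H2 & H3 & [i Hi] & [j Hj] & H5).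
    exists p, q, p', q'. split; [auto|split;[auto|split;[auto|]]].
    destruct (jumps_parity B a b c d) as [[i' Hi'] [j' Hj']]; [constructor; auto|].
    split; [exists (i'+i); lia|]. split; [exists (j'+j); lia|].
    destruct H5 as [[-> ->]|H5]; right; auto. eapply zhop_target; eauto.
  + exists a, b, c, d. split; [auto|split; [auto|split; [auto|]]].
    split; [exists 0; lia|split; [exists 0; lia|auto]].
Qed.

Lemma jumps_snoc B a b c d u v :
  jumps B a b c d -> zhop B c d u v -> jumps B a b u v.
Proof.
induction 1; intros; [eapply jumps_cons; eauto; constructor; auto|].
eapply jumps_cons; eauto.
Qed.

Lemma zhop_sym B a b c d : ~ B a b -> zhop B a b c d -> zhop B c d a b.
Proof.
intros Ha [Hc H]. split; [auto|].
destruct H as [(->&->&H)|[(->&->&H)|[(->&->&H)|(->&->&H)]]].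
- right; left. replace (a + 2 - 1) with (a + 1) by lia. split; [lia|auto].
- left. replace (a - 2 + 1) with (a - 1) by lia. split; [lia|auto].
- do 3 right. replace (b + 2 - 1) with (b + 1) by lia. split; [lia|split; [lia|auto]].
- do 2 right; left. replace (b - 2 + 1) with (b - 1) by lia. split; [lia|split; [lia|auto]].
Qed.

(** Each hop can be undone, because the cell it leaves is free. Hence [jumps_first] applied to the
    reversed jump describes the last hop. *)
Lemma jumps_sym B a b c d : ~ B a b -> jumps B a b c d -> jumps B c d a b.
Proof.
intros Ha J; induction J as [a b c d H|a b c d u v H J IH].
- constructor; apply zhop_sym; auto.
- eapply jumps_snoc; [apply IH; eapply zhop_target; eauto|apply zhop_sym; auto].
Qed.

Lemma jumps_ext B B' a b c d :
  (forall u v, B u v <-> B' u v) -> jumps B a b c d -> jumps B' a b c d.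
Proof.
intros E J; induction J as [a b c d H|a b c d u v H J IH].
- constructor. unfold zhop in *. rewrite <- !E. auto.
- eapply jumps_cons; eauto. unfold zhop in *. rewrite <- !E. auto.
Qed.

(** [jumps_exit] for the half plane up to level [k]: levels keep their parity along a jump, so the
    hop that leaves it goes from [k] to [k + 2]. Off level [a + b], [X] and [minus X a b] agree. *)
Lemma jumps_cross X a b c d k :
  jumps (minus X a b) a b c d -> a + b <= k < c + d ->
  (exists j, k = a + b + 2 * j) ->
  exists u v, u + v = k /\ (exists i, u = a + 2 * i) /\ (exists j, v = b + 2 * j) /\
    ((u = a /\ v = b) \/ ~ X u v) /\
    ((X (u + 1) v /\ ~ X (u + 2) v) \/ (X u (v + 1) /\ ~ X u (v + 2))).
Proof.
intros J Hk [j Hj].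
destruct (jumps_exit (fun u v => u + v <= k) _ _ _ _ _ ltac:(cbv beta; intros; lia) J)
  as (u & v & u' & v' & H1 & H2 & H3 & [i Hi] & [l Hl] & H5); cbv beta in *; try lia.
assert (Hn : forall p q, p + q <> a + b -> ~ minus X a b p q -> ~ X p q).
{ intros p q Hpq Hm Hx. apply Hm; split; auto. lia. }
destruct H3 as [Ht H3].
exists u, v.
assert (u + v = k) by (destruct H3 as [H3|[H3|[H3|H3]]]; lia).
split; [auto|]. split; [eauto|]. split; [eauto|]. split.
- destruct H5 as [H5|H5]; auto.
  destruct (Z.eq_dec u a); destruct (Z.eq_dec v b); auto; right; intro; apply H5; split; auto; lia.
- destruct H3 as [(->&->&H3)|[(->&->&H3)|[(->&->&H3)|(->&->&H3)]]]; try lia.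
  + left; split; [apply H3|apply Hn; auto; lia].
  + right; split; [apply H3|apply Hn; auto; lia].
Qed.

Lemma jumps_first_up X a b c d :
  jumps (minus X a b) a b c d -> (forall u v, X u v -> a + b <= u + v) ->
  (X (a + 1) b /\ ~ X (a + 2) b) \/ (X a (b + 1) /\ ~ X a (b + 2)).
Proof.
intros J Hm. destruct (jumps_first _ _ _ _ _ J) as (u & v & Ht & H).
assert (Hn : forall p q, p + q <> a + b -> ~ minus X a b p q -> ~ X p q).
{ intros p q Hpq Hn Hx. apply Hn; split; auto. lia. }
destruct H as [(->&->&H)|[(->&->&H)|[(->&->&H)|(->&->&H)]]].
- left; split; [apply H|apply Hn; auto; lia].
- destruct H as [H _]; apply Hm in H; lia.
- right; split; [apply H|apply Hn; auto; lia].
- destruct H as [H _]; apply Hm in H; lia.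
Qed.

(** The exception is a jump returning to its starting cell, a legal move that changes nothing. *)
Lemma moves_target X Y a b c d : moves X Y a b c d -> X c d -> c = a /\ d = b.
Proof.
intros (H1 & H2 & [[_ H3]|H3]) Hx; [contradiction|].
apply jumps_target in H3. apply NNPP; intro; apply H3; split; auto.
Qed.

Lemma moves_five_pieces X Y a b c d : moves X Y a b c d -> five_pieces X -> five_pieces Y.
Proof.
intros M Hb a1 b1 a2 b2 a3 b3 a4 b4.
pose proof (moves_target _ _ _ _ _ _ M) as Ht. destruct M as (Ha & HY & _).
destruct (classic ((c = a1 /\ d = b1) \/ (c = a2 /\ d = b2) \/
   (c = a3 /\ d = b3) \/ (c = a4 /\ d = b4))) as [H|H].
- assert (exists p1 q1 p2 q2 p3 q3 , forall u v,
    ~ (u = p1 /\ v = q1) -> ~ (u = p2 /\ v = q2) -> ~ (u = p3 /\ v = q3) -> ~ (u = c /\ v = d) ->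
     ~ (u = a1 /\ v = b1) /\ ~ (u = a2 /\ v = b2) /\
    ~ (u = a3 /\ v = b3) /\ ~ (u = a4 /\ v = b4)) as (p1&q1&p2&q2&p3&q3&Hp).
  { destruct H as [H|[H|[H|H]]].
    - exists a2,b2,a3,b3,a4,b4; intros; lia.
    - exists a1,b1,a3,b3,a4,b4; intros; lia.
    - exists a2,b2,a1,b1,a4,b4; intros; lia.
    - exists a2,b2,a3,b3,a1,b1; intros; lia. }
  (* One of the four cells is the landing cell; its place in the query is taken by the starting
     cell. *)
  destruct (Hb a b p1 q1 p2 q2 p3 q3) as (u & v & Hx & H0 & H1 & H2 & H3).
  exists u, v. split; [apply HY; auto|].
  apply Hp; auto. intros [-> ->]. apply H0; apply Ht; auto.
- exists c, d. split; [apply HY; auto|]. tauto.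
Qed.

Lemma path_spans w X r f : path w X r f -> spans X r f.
Proof. destruct w; intros (H & _); exact H. Qed.
Lemma path_five_pieces w X r f : path w X r f -> five_pieces X.
Proof. destruct w; intros (_ & H & _); exact H. Qed.

(** * Moves that raise an end *)

Definition unique (X : config) (k a b : Z) : Prop :=
  forall u v, X u v -> u + v = k -> u = a /\ v = b.

(** A shift raising both ends would need front and rear on one level, with the mover as the only
    piece; so the move is a jump. *)
Lemma back_inv X Y r f a b c d :
  five_pieces X -> spans X r f -> spans Y (r + 1) (f + 1) -> moves X Y a b c d ->
  a + b = r /\ unique X r a b /\ c + d = f + 1 /\
  jumps (minus X a b) a b c d.
Proof.
intros Hb (X1 & (xr & yr & X2 & X2') & _) (Y1 & _ & (xf & yf & Y3 & Y3')) (Ha & HY & HM).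
assert (Hr : unique X r a b).
{ intros u v Hx Hl. apply NNPP; intro Hn.
  assert (Hy : Y u v) by (apply HY; auto). apply Y1 in Hy; lia. }
destruct (Hr xr yr X2 X2') as [-> ->].
assert (Hcd : c + d = f + 1).
{ apply HY in Y3; destruct Y3 as [[-> ->]|[Y3 _]]; [auto|apply X1 in Y3; lia]. }
repeat split; auto.
- apply (Hr u v); auto.
- apply (Hr u v); auto.
- destruct HM as [[HM _]|HM]; auto.
  exfalso. destruct (Hb a b a b a b a b) as (u & v & Hx & Hn & _).
  apply Hn, Hr; auto. pose proof (X1 _ _ Hx). pose proof (X1 _ _ X2).
  unfold adjacent in HM. lia.
Qed.

(** Only a piece of the front level can shift beyond it; a jump starts, by parity, at an odd
    distance below the front. *)
Lemma front_inv X Y r f a b c d :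
  spans X r f -> spans Y r (f + 1) -> moves X Y a b c d ->
  c + d = f + 1 /\ ~ X c d /\ r <= a + b /\
  ((a + b = f /\ ((c = a + 1 /\ d = b) \/ (c = a /\ d = b + 1))) \/
   (a + b <= f - 1 /\ (exists j, f + 1 = a + b + 2 * j) /\ jumps (minus X a b) a b c d)).
Proof.
intros (X1 & _) (Y1 & _ & (xf & yf & Y3 & Y3')) (Ha & HY & HM).
assert (Hcd : c + d = f + 1).
{ apply HY in Y3; destruct Y3 as [[-> ->]|[Y3 _]]; [auto|apply X1 in Y3; lia]. }
pose proof (X1 _ _ Ha).
split; [auto|]. split; [intro Hx; apply X1 in Hx; lia|]. split; [lia|].
destruct HM as [[HM _]|HM].
- left; unfold adjacent in HM; lia.
- right. destruct (jumps_parity _ _ _ _ _ HM) as [[i Hi] [j Hj]].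
  split; [lia|]. split; [exists (i + j); lia|auto].
Qed.

Lemma rear_inv X Y r f a b c d :
  spans X r f -> spans Y (r + 1) f -> moves X Y a b c d ->
  a + b = r /\ unique X r a b /\ r + 1 <= c + d <= f /\ ~ X c d /\
  ((c + d = r + 1 /\ ((c = a + 1 /\ d = b) \/ (c = a /\ d = b + 1))) \/
   ((exists i, c = a + 2 * i) /\ (exists j, d = b + 2 * j) /\
    r + 2 <= c + d /\ jumps (minus X a b) a b c d)).
Proof.
intros (X1 & (xr & yr & X2 & X2') & _) (Y1 & _ & (xf & yf & Y3 & Y3')) M.
pose proof (moves_target _ _ _ _ _ _ M) as Ht.
destruct M as (Ha & HY & HM).
assert (Hr : unique X r a b).
{ intros u v Hx Hl. apply NNPP; intro Hn.
  assert (Hy : Y u v) by (apply HY; auto). apply Y1 in Hy; lia. }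
destruct (Hr xr yr X2 X2') as [-> ->].
assert (Hc : Y c d) by (apply HY; auto). apply Y1 in Hc.
split; [auto|]. split; [auto|]. split; [lia|].
split; [intro Hx; apply Ht in Hx; lia|].
destruct HM as [[HM _]|HM].
- left; unfold adjacent in HM; lia.
- right. destruct (jumps_parity _ _ _ _ _ HM) as [[i Hi] [j Hj]].
  split; [eauto|]. split; [eauto|]. split; [lia|auto].
Qed.

(** * Symmetries of moves and words *)

Definition opposite (X : config) : config := fun u v => X (- u) (- v).
Definition translate (p q : Z) (X : config) : config := fun u v => X (u + p) (v + q).
Definition transpose (X : config) : config := fun u v => X v u.

(** Reversing time alone would make rising ends fall; the point reflection restores them. The other
    pieces stand still, so the reversed jump meets the same obstacles. *)
Lemma moves_opposite X Y a b c d :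
  moves X Y a b c d -> moves (opposite Y) (opposite X) (- c) (- d) (- a) (- b).
Proof.
intros M. pose proof (moves_target _ _ _ _ _ _ M) as Ht.
destruct M as (Ha & HY & HM). unfold opposite.
assert (HX : forall u v, X u v <-> (u = a /\ v = b) \/ (Y u v /\ ~ (u = c /\ v = d))).
{ intros u v. rewrite HY. split.
  - intros Hx. destruct (classic (u = a /\ v = b)) as [E|E]; [auto|right].
    split; [auto|]. intros [-> ->]. apply E, Ht, Hx.
  - intros [[-> ->]|[[E|[E _]] E']]; auto; contradiction. }
split; [rewrite !Z.opp_involutive; apply HY; auto|].
split.
{ intros u v. rewrite HX. intuition lia. }
destruct HM as [[HM Hc]|HM].
- left; rewrite !Z.opp_involutive. split; [unfold adjacent in *; lia|].
  rewrite HY. intros [[-> ->]|[_ []]]; auto.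
- right.
  assert (J : jumps (minus X a b) c d a b).
  { apply jumps_sym; auto. intros [_ []]; auto. }
  assert (Hj : forall p q p' q', jumps (minus X a b) p q p' q' ->
     jumps (fun u v => minus X a b (- u) (- v)) (- p) (- q) (- p') (- q')).
  { clear. intros p q p' q' J.
    assert (Hh : forall a0 b0 c d, zhop (minus X a b) a0 b0 c d ->
       zhop (fun u v => minus X a b (- u) (- v)) (- a0) (- b0) (- c) (- d)).
    { intros p0 q0 c d [Ht H]. split; [rewrite !Z.opp_involutive; auto|].
      destruct H as [(->&->&H)|[(->&->&H)|[(->&->&H)|(->&->&H)]]].
      - right; left. split; [lia|split; [lia|]].
        replace (- (- p0 - 1)) with (p0 + 1) by lia. rewrite Z.opp_involutive; auto.
      - left. split; [lia|split; [lia|]].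
        replace (- (- p0 + 1)) with (p0 - 1) by lia. rewrite Z.opp_involutive; auto.
      - do 3 right. split; [lia|split; [lia|]].
        replace (- (- q0 - 1)) with (q0 + 1) by lia. rewrite Z.opp_involutive; auto.
      - do 2 right; left. split; [lia|split; [lia|]].
        replace (- (- q0 + 1)) with (q0 - 1) by lia. rewrite Z.opp_involutive; auto. }
    induction J; [constructor; auto|eapply jumps_cons; eauto]. }
  apply Hj in J. eapply jumps_ext; [|exact J].
  intros u v. unfold minus. rewrite HY. split.
  + intros [H1 H2]. split; [right; split; [auto|lia]|].
    intros E. assert (Hc : X c d)
      by (replace c with (- u) by lia; replace d with (- v) by lia; auto).
    apply Ht in Hc. lia.
  + intros [[H1|[H1 H2]] H3]; [lia|]. split; [auto|lia].
Qed.

Lemma spans_opposite X r f : spans X r f -> spans (opposite X) (- f) (- r).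
Proof.
intros (H1 & (a & b & H2 & H2') & (c & d & H3 & H3')). unfold opposite. split; [|split].
- intros u v Hx; apply H1 in Hx; lia.
- exists (- c), (- d); rewrite !Z.opp_involutive; split; [auto|lia].
- exists (- a), (- b); rewrite !Z.opp_involutive; split; [auto|lia].
Qed.

Lemma five_pieces_opposite X : five_pieces X -> five_pieces (opposite X).
Proof.
intros H a1 b1 a2 b2 a3 b3 a4 b4.
destruct (H (-a1) (-b1) (-a2) (-b2) (-a3) (-b3) (-a4) (-b4)) as (u & v & Hx & Hn).
exists (- u), (- v). unfold opposite. rewrite !Z.opp_involutive. split; [auto|lia].
Qed.

Definition flip (x : letter) : letter :=
  match x with LF => LR | LR => LF | _ => x end.

(** [w2] accumulates the letters already reversed. Front and rear exchange roles, whence [flip]. *)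
Lemma path_opposite w : forall X r f w2,
  path w X r f -> path w2 (opposite X) (- f) (- r) ->
  exists Y r' f', path (rev (map flip w) ++ w2) Y r' f'.
Proof.
induction w as [|x w IH]; intros X r f w2 H H2; [cbn; eauto|].
destruct H as (HX & HbX & Y & (a & b & c & d & M) & H).
cbn. rewrite <- app_assoc. apply (IH _ _ _ _ H).
pose proof (path_spans _ _ _ _ H) as HY. pose proof (path_five_pieces _ _ _ _ H) as HbY.
split; [apply spans_opposite; auto|]. split; [apply five_pieces_opposite; auto|].
exists (opposite X). split.
- exists (- c), (- d), (- a), (- b); apply moves_opposite; auto.
- replace (- (f + front_gain x) + rear_gain (flip x)) with (- f) by (destruct x; cbn; lia).
  replace (- (r + rear_gain x) + front_gain (flip x)) with (- r) by (destruct x; cbn; lia).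
  exact H2.
Qed.

Lemma forbidden_mirror w : forbidden w -> forbidden (rev (map flip w)).
Proof.
intros Hw X r f H.
destruct (path_opposite (rev (map flip w)) X r f [] H) as (Y & r' & f' & H').
- cbn. split; [apply spans_opposite, (path_spans _ _ _ _ H)|].
  split; [apply five_pieces_opposite, (path_five_pieces _ _ _ _ H)|auto].
- apply (Hw Y r' f'). rewrite app_nil_r, map_rev, rev_involutive, map_map in H'.
  replace (map (fun x => flip (flip x)) w) with w in H'; auto.
  clear; induction w as [|[] w IH]; cbn; congruence.
Qed.

Lemma zhop_transpose B a b c d : zhop B a b c d -> zhop (transpose B) b a d c.
Proof. unfold zhop, transpose; tauto. Qed.

Lemma moves_transpose X Y a b c d : moves X Y a b c d ->
  moves (transpose X) (transpose Y) b a d c.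
Proof.
intros (Ha & HY & HM). unfold transpose. split; [auto|]. split; [|].
- intros u v; rewrite HY; tauto.
- destruct HM as [[HM Hc]|HM]; [left; split; [unfold adjacent in *; lia|auto]|right].
  apply (jumps_ext (transpose (minus X a b))); [unfold transpose, minus; tauto|].
  revert HM; generalize (minus X a b) as B; clear; intros B HM. induction HM; [constructor; apply zhop_transpose; auto|].
  eapply jumps_cons; [apply zhop_transpose; eauto|auto].
Qed.

Lemma zhop_translate B p q a b c d :
  zhop B a b c d -> zhop (translate p q B) (a - p) (b - q) (c - p) (d - q).
Proof.
unfold zhop, translate. rewrite !Z.sub_add. intros [Ht H]. split; [auto|].
replace (a - p + 1 + p) with (a + 1) by lia. replace (a - p - 1 + p) with (a - 1) by lia.
replace (b - q + 1 + q) with (b + 1) by lia. replace (b - q - 1 + q) with (b - 1) by lia.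
intuition lia.
Qed.

Lemma moves_translate p q X Y a b c d : moves X Y a b c d ->
  moves (translate p q X) (translate p q Y) (a - p) (b - q) (c - p) (d - q).
Proof.
intros (Ha & HY & HM). unfold moves, translate. rewrite !Z.sub_add. split; [auto|]. split; [|].
- intros u v; rewrite HY; intuition lia.
- destruct HM as [[HM Hc]|HM]; [left; split; [unfold adjacent in *; lia|auto]|right].
  apply (jumps_ext (translate p q (minus X a b))); [unfold translate, minus; intuition lia|].
  revert HM; generalize (minus X a b) as B; clear; intros B HM. induction HM; [constructor; apply zhop_translate; auto|].
  eapply jumps_cons; [apply zhop_translate; eauto|auto].
Qed.

Lemma path_transpose w : forall X r f, path w X r f -> path w (transpose X) r f.
Proof.
induction w as [|x w IH]; intros X r f (HX & Hb & H).
all: assert (spans (transpose X) r f /\ five_pieces (transpose X)) as [HX' Hb'].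
1, 3: split;
 [destruct HX as (H1 & (a & b & H2 & H2') & (c & d & H3 & H3')); unfold transpose; split; [|split];
   [intros u v Hx; apply H1 in Hx; lia | exists b, a; split; [auto|lia] | exists d, c; split; [auto|lia]]
 |intros a1 b1 a2 b2 a3 b3 a4 b4; destruct (Hb b1 a1 b2 a2 b3 a3 b4 a4) as (u & v & Hx & Hn);
  exists v, u; split; [exact Hx|tauto]].
- split; auto.
- destruct H as (Y & (a & b & c & d & M) & H). split; [auto|split; [auto|]].
  exists (transpose Y). split; [exists b, a, d, c; apply moves_transpose; auto|auto].
Qed.

Lemma path_translate w p q : forall X r f,
  path w X r f -> path w (translate p q X) (r - p - q) (f - p - q).
Proof.
induction w as [|x w IH]; intros X r f (HX & Hb & H).
all: assert (spans (translate p q X) (r - p - q) (f - p - q) /\ five_pieces (translate p q X)) as [HX' Hb'].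
1, 3: split;
 [destruct HX as (H1 & (a & b & H2 & H2') & (c & d & H3 & H3')); unfold translate; split; [|split];
   [intros u v Hx; apply H1 in Hx; lia
   | exists (a - p), (b - q); rewrite !Z.sub_add; split; [auto|lia]
   | exists (c - p), (d - q); rewrite !Z.sub_add; split; [auto|lia]]
 |intros a1 b1 a2 b2 a3 b3 a4 b4;
  destruct (Hb (a1 + p) (b1 + q) (a2 + p) (b2 + q) (a3 + p) (b3 + q) (a4 + p) (b4 + q))
     as (u & v & Hx & Hn);
  exists (u - p), (v - q); unfold translate; rewrite !Z.sub_add; split; [exact Hx|lia]].
- split; auto.
- destruct H as (Y & (a & b & c & d & M) & H). split; [auto|split; [auto|]].
  exists (translate p q Y). split.
  + exists (a - p), (b - q), (c - p), (d - q); apply moves_translate; auto.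
  + replace (r - p - q + rear_gain x) with (r + rear_gain x - p - q) by lia.
    replace (f - p - q + front_gain x) with (f + front_gain x - p - q) by lia. auto.
Qed.

(* The two back moves brought the pieces of (0,0) and (1,0) to (al, be) and
   (al + 1, be); the front was at level [w] before them. [bb_s] and [bb_K] come from
   the first cells that these two pieces had to reach. *)
Record after_BB (Y : config) (w al be : Z) : Prop := After_BB {
  bb_odd : exists j, w = 2 * j + 1;
  bb_w : 3 <= w;
  bb_11 : Y 1 1;
  bb_20 : ~ Y 2 0;
  bb_12 : ~ Y 1 2;
  bb_T : Y al be;
  bb_T1 : Y (al + 1) be;
  bb_lev : al + be = w + 1;
  bb_al : exists i, al = 2 * i;
  bb_be : exists j, be = 2 * j;
  bb_uT : unique Y (w + 1) al be;
  bb_uT1 : unique Y (w + 2) (al + 1) be;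
  bb_left : Y al (be - 1);
  bb_down : ~ Y (al - 1) be;
  bb_s : Y 3 0 \/ (Y 2 1 /\ (5 <= w -> ~ Y 2 2));
  bb_K : 5 <= w -> unique Y 2 1 1 -> unique Y 3 2 1 ->
         Y 1 3 /\ ~ Y 1 4 /\ (Y 2 3 \/ Y 3 2)
}.

(** * Both ends after two or three back moves *)

(** (0, 0) and (1, 0) are alone on their levels, so (0, 0) first hops to (2, 0). That cell is
    therefore empty, and (1, 0) has to start over (1, 1) to (1, 2). The last hops are read off from
    the reversed jumps. *)
Lemma path_BB w' X f :
  path (LB :: LB :: w') X 0 f -> X 0 0 -> X 1 0 ->
  exists Y al be, after_BB Y f al be /\ path w' Y 2 (f + 2).
Proof.
intros (SX & bX & X1 & (a & b & al & be & M0) & H) X00 X10.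
destruct H as (S1 & b1 & Y & (a' & b' & c' & d' & M1) & H).
pose proof (path_spans _ _ _ _ H) as SY. cbn -[Z.add] in *.
replace (f + 1 + 1) with (f + 2) in * by lia. replace (0 + 1 + 1) with 2 in * by lia.
destruct (back_inv X X1 0 f a b al be bX SX S1 M0) as (Eab & U0 & E1 & J0).
destruct (U0 0 0 X00 eq_refl) as [<- <-]. clear Eab.
destruct (back_inv X1 Y 1 (f + 1) a' b' c' d' b1 S1 ltac:(replace (f + 1 + 1) with (f + 2) by lia; exact SY) M1) as (_ & U1 & E2 & J1).
destruct (jumps_parity _ _ _ _ _ J0) as [[i Hi] [j Hj]].
pose proof M0 as (_ & H1 & _). pose proof M1 as (_ & HY & _).
destruct SX as (LX & _). pose proof (LX _ _ X10) as L10.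
assert (X110 : X1 1 0) by (apply H1; right; split; [auto|lia]).
destruct (U1 1 0 X110 ltac:(lia)) as [<- <-].
destruct (jumps_parity _ _ _ _ _ J1) as [[i' Hi'] [j' Hj']].
assert (U1X : unique X 1 1 0).
{ intros u v Hx Hl. apply U1; [apply H1; right; split; [auto|lia]|lia]. }
(* [f] is odd by parity, and [f = 1] would leave only the pieces (0, 0) and (1, 0). *)
assert (Hw : 3 <= f).
{ destruct (Z_lt_le_dec f 3); [exfalso|auto]. assert (f = 1) as -> by lia.
  destruct (bX 0 0 1 0 0 0 1 0) as (u & v & Hx & N0 & N1 & _).
  pose proof (LX _ _ Hx).
  destruct (Z.eq_dec (u + v) 0); [apply N0, U0; auto; lia|apply N1, U1X; auto; lia]. }
assert (XY : forall u v, 2 <= u + v <= f -> (X u v <-> Y u v)).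
{ intros u v Huv. rewrite HY, H1. intuition lia. }
assert (X1X : forall u v, 1 <= u + v <= f -> (X1 u v <-> X u v)).
{ intros u v Huv. rewrite H1. intuition lia. }
pose proof (jumps_first_up _ _ _ _ _ J0 ltac:(intros u v Hx; apply LX in Hx; lia)) as F0.
assert (N20 : ~ X 2 0).
{ destruct F0 as [[_ F0]|[F0 _]]; [auto|]. apply U1X in F0; lia. }
pose proof (jumps_first_up _ _ _ _ _ J1 ltac:(intros u v Hx; apply S1 in Hx; lia)) as F1.
cbn -[Z.add] in F1. rewrite !X1X in F1 by lia.
assert (X11 : X 1 1 /\ ~ X 1 2).
{ destruct F1 as [[F1 _]|F1]; [|exact F1]. contradiction. }
destruct X11 as [X11 N12].
assert (TX : forall u v, X1 u v -> u + v = f + 1 -> u = al /\ v = be).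
{ intros u v Hx Hl. apply H1 in Hx. destruct Hx as [Hx|[Hx _]]; [auto|apply LX in Hx; lia]. }
assert (R0 := jumps_sym (minus X 0 0) 0 0 al be (fun H => proj2 H (conj eq_refl eq_refl)) J0).
assert (R1 := jumps_sym (minus X1 1 0) 1 0 c' d' (fun H => proj2 H (conj eq_refl eq_refl)) J1).
(* The last hop of the second piece passes over (al, be), alone on level f + 1; the class of (1, 0)
   makes it go from (al - 1, be) to (al + 1, be). *)
assert (HT1 : c' = al + 1 /\ d' = be /\ ~ X (al - 1) be).
{ destruct (jumps_first _ _ _ _ _ R1) as (p & q & Ht & Hq).
  destruct Hq as [(->&->&[Hq _])|[(->&->&[Hq _])|[(->&->&[Hq _])|(->&->&[Hq _])]]];
    try (apply S1 in Hq; lia).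
  - apply TX in Hq; [|lia]. split; [lia|split; [lia|]]. intros Hx. apply Ht.
    replace (c' - 2) with (al - 1) by lia. replace d' with be by lia.
    split; [apply H1; right; split; [auto|lia]|lia].
  - apply TX in Hq; [|lia]. lia. }
destruct HT1 as (-> & -> & Ndown).
(* The last hop of the first piece passes over (al, be - 1), since (al - 1, be) is empty. *)
assert (Left : X al (be - 1)).
{ destruct (jumps_first _ _ _ _ _ R0) as (p & q & Ht & Hq).
  destruct Hq as [(->&->&[Hq _])|[(->&->&[Hq _])|[(->&->&[Hq _])|(->&->&[Hq _])]]];
    try (apply LX in Hq; lia); auto; contradiction. }
exists Y, al, be. split; [|exact H].
assert (YT1 : Y (al + 1) be) by (apply HY; left; lia).
assert (YT : Y al be) by (apply HY; right; split; [apply H1; auto|lia]).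
(* From (2, 0) the first piece goes on over (3, 0) or (2, 1): on level 1 there is only (1, 0), which
   leads back to (0, 0). *)
assert (Hs : (X 3 0 /\ ~ X 4 0) \/ (X 2 1 /\ ~ X 2 2)).
{ destruct (jumps_exit (fun u v => (u = 0 /\ v = 0) \/ (u = 2 /\ v = 0))
    _ _ _ _ _ ltac:(cbv beta; intros; lia) J0) as (u & v & u' & v' & P1 & P2 & P3 & _);
    cbv beta in *; try lia.
  destruct P3 as [Pt P3]. unfold minus in P3, Pt.
  destruct P3 as [(->&->&P3 & _)|[(->&->&P3&_)|[(->&->&P3&_)|(->&->&P3&_)]]];
  destruct P1 as [[-> ->]|[-> ->]]; cbn in P3, P2, Pt;
    try (pose proof (LX _ _ P3); lia); try (apply U1X in P3; lia); try lia.
  - left; split; [auto|]. intros Hx; apply Pt; split; [auto|lia].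
  - right; split; [auto|]. intros Hx; apply Pt; split; [auto|lia]. }
constructor; auto; try lia.
- exists (i + j - 1). lia.
- apply XY; [lia|auto].
- rewrite <- XY; [auto|lia].
- rewrite <- XY; [auto|lia].
- exists i; lia.
- exists j; lia.
- intros u v Hy Hl. apply HY in Hy. destruct Hy as [Hy|[Hy _]]; [lia|apply TX; auto].
- intros u v Hy Hl. apply HY in Hy. destruct Hy as [Hy|[Hy _]]; [lia|apply S1 in Hy; lia].
- apply XY; [lia|auto].
- rewrite <- XY; [auto|lia].
- rewrite <- !XY by lia. destruct Hs as [[Hs _]|[Hs Hs']]; [auto|right].
  split; [auto|]. intros Hf. rewrite <- XY by lia. auto.
(* With single pieces on levels 2 and 3, the first piece is forced along (0, 0), (2, 0), (2, 2) and
   the second along (1, 0), (1, 2), (1, 4); the claims are the next obstacles. *)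
- intros Hf U2 U3. rewrite <- !XY by lia.
  assert (U2X : unique X 2 1 1) by (intros u v Hx Hl; apply U2; auto; apply XY; [lia|auto]).
  assert (U3X : unique X 3 2 1) by (intros u v Hx Hl; apply U3; auto; apply XY; [lia|auto]).
  assert (Hs' : X 2 1 /\ ~ X 2 2).
  { destruct Hs as [[Hs _]|Hs]; auto. apply U3X in Hs; lia. }
  destruct Hs' as [X21 N22].
  split; [|split].
  + apply NNPP. intros N13.
    destruct (jumps_exit (fun u v => (u = 1 /\ v = 0) \/ (u = 1 /\ v = 2))
      _ _ _ _ _ ltac:(cbv beta; intros; lia) J1) as (u & v & u' & v' & P1 & P2 & P3 & _);
      cbv beta in *; try lia.
    destruct P3 as [Pt P3]. unfold minus in P3, Pt.
    destruct P3 as [(->&->&P3 & _)|[(->&->&P3&_)|[(->&->&P3&_)|(->&->&P3&_)]]];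
    destruct P1 as [[-> ->]|[-> ->]]; cbn in P3, P2, Pt;
    try (pose proof (proj1 S1 _ _ P3); lia); rewrite X1X in P3 by lia;
      try (apply U2X in P3; lia); try lia; try contradiction.
  + destruct (jumps_exit (fun u v => (u = 1 /\ v = 0) \/ (u = 1 /\ v = 2))
      _ _ _ _ _ ltac:(cbv beta; intros; lia) J1) as (u & v & u' & v' & P1 & P2 & P3 & _);
      cbv beta in *; try lia.
    destruct P3 as [Pt P3]. unfold minus in P3, Pt.
    destruct P3 as [(->&->&P3 & _)|[(->&->&P3&_)|[(->&->&P3&_)|(->&->&P3&_)]]];
    destruct P1 as [[-> ->]|[-> ->]]; cbn in P3, P2, Pt;
    try (pose proof (proj1 S1 _ _ P3); lia); rewrite X1X in P3 by lia;
      try (apply U2X in P3; lia); try lia; try contradiction.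
    rewrite X1X in Pt by lia. intro; apply Pt; split; [auto|lia].
  + destruct (jumps_exit (fun u v => (u = 0 /\ v = 0) \/ (u = 2 /\ v = 0) \/ (u = 2 /\ v = 2))
      _ _ _ _ _ ltac:(cbv beta; intros; lia) J0) as (u & v & u' & v' & P1 & P2 & P3 & _);
      cbv beta in *; try lia.
    destruct P3 as [Pt P3]. unfold minus in P3, Pt.
    destruct P3 as [(->&->&P3 & _)|[(->&->&P3&_)|[(->&->&P3&_)|(->&->&P3&_)]]];
    destruct P1 as [[-> ->]|[[-> ->]|[-> ->]]]; cbn in P3, P2, Pt;
    try (pose proof (LX _ _ P3); lia); auto;
      try (apply U3X in P3; lia); try (apply U2X in P3; lia); try (apply U1X in P3; lia); try lia.
Qed.

(** A translation puts the rear piece at the origin, and a transposition makes its first hop pass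
    over (1, 0). *)
Lemma forbidden_BB w' :
  (forall Y w al be, after_BB Y w al be -> path w' Y 2 (w + 2) -> False) ->
  forbidden (LB :: LB :: w').
Proof.
intros Hw.
assert (H0 : forall X f, X 0 0 -> X 1 0 -> ~ path (LB :: LB :: w') X 0 f).
{ intros X f H0 H1 H. destruct (path_BB w' X f H H0 H1) as (Y & al & be & C & P).
  exact (Hw _ _ _ _ C P). }
intros X r f H.
pose proof H as (SX & bX & X1 & (a & b & c & d & M0) & H').
pose proof (path_spans _ _ _ _ H') as S1.
destruct (back_inv X X1 r f a b c d bX SX S1 M0) as (Er & _ & _ & J).
apply (path_translate _ a b) in H. replace (r - a - b) with 0 in H by lia.
assert (Xab : translate a b X 0 0) by apply M0.
assert (F := jumps_first_up _ _ _ _ _ J ltac:(intros u v Hx; apply SX in Hx; lia)).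
destruct F as [[F _]|[F _]].
- apply (H0 _ _ Xab) in H; [auto|]. unfold translate. rewrite Z.add_comm. exact F.
- apply path_transpose in H. refine (H0 _ _ _ _ H); [exact Xab|].
  unfold transpose, translate. rewrite (Z.add_comm 1). exact F.
Qed.

(* As in [after_BB], the third back move having brought the piece of (1,1) to
   (al + 1, be + 1). *)
Record after_BBB (X : config) (w al be : Z) : Prop := After_BBB {
  bbb_odd : exists j, w = 2 * j + 1;
  bbb_w : 3 <= w;
  bbb_lev : al + be = w + 1;
  bbb_al : exists i, al = 2 * i;
  bbb_be : exists j, be = 2 * j;
  bbb_T : X al be;
  bbb_T1 : X (al + 1) be;
  bbb_T2 : X (al + 1) (be + 1);
  bbb_uT : unique X (w + 1) al be;
  bbb_uT1 : unique X (w + 2) (al + 1) be;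
  bbb_uT2 : unique X (w + 3) (al + 1) (be + 1);
  bbb_left : X al (be - 1);
  bbb_down : ~ X (al - 1) be;
  bbb_21 : X 2 1;
  bbb_12 : ~ X 1 2;
  bbb_31 : ~ X 3 1;
  bbb_K : 5 <= w -> unique X 3 2 1 ->
         ~ X 2 2 /\ X 1 3 /\ ~ X 1 4 /\ (X 2 3 \/ X 3 2) /\ (X 4 1 \/ X 3 2)
}.

(** As (1, 2) is empty, (1, 1) starts over (2, 1) to (3, 1). Its last hop passes over (al + 1, be),
    alone on level w + 2, and its class makes that hop vertical. *)
Lemma path_BBB w' Y w al be :
  after_BB Y w al be -> path (LB :: w') Y 2 (w + 2) ->
  exists Z, after_BBB Z w al be /\ path w' Z 3 (w + 3).
Proof.
intros C (SY & bY & Z & (a & b & c & d & M) & H).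
pose proof (path_spans _ _ _ _ H) as SZ. cbn -[Z.add] in *.
replace (w + 2 + 1) with (w + 3) in * by lia. replace (2 + 1) with 3 in * by lia.
destruct (back_inv Y Z 2 (w + 2) a b c d bY SY ltac:(replace (w + 2 + 1) with (w + 3) by lia; exact SZ) M) as (_ & U & E & J).
destruct (U 1 1 (bb_11 _ _ _ _ C) eq_refl) as [<- <-].
destruct (jumps_parity _ _ _ _ _ J) as [[i Hi] [j Hj]].
pose proof M as (_ & HZ & _).
assert (F := jumps_first_up _ _ _ _ _ J ltac:(intros u v Hx; apply SY in Hx; lia)).
cbn -[Z.add] in F.
destruct F as [[Y21 N31]|[F _]]; [|destruct (bb_12 _ _ _ _ C F)].
change (1 + 1) with 2 in *. change (1 + 2) with 3 in *.
assert (R := jumps_sym (minus Y 1 1) 1 1 c d (fun H => proj2 H (conj eq_refl eq_refl)) J).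
destruct (bb_al _ _ _ _ C) as [i' Ha]. destruct (bb_be _ _ _ _ C) as [j' Hb].
pose proof (bb_lev _ _ _ _ C) as HL. pose proof (bb_w _ _ _ _ C) as Hw.
assert (Hcd : c = al + 1 /\ d = be + 1).
{ destruct (jumps_first _ _ _ _ _ R) as (p & q & Ht & Hq).
  destruct Hq as [(->&->&[Hq _])|[(->&->&[Hq _])|[(->&->&[Hq _])|(->&->&[Hq _])]]];
    try (apply SY in Hq; lia); apply (bb_uT1 _ _ _ _ C) in Hq; lia. }
destruct Hcd as [-> ->].
assert (YZ : forall u v, 3 <= u + v <= w + 2 -> (Z u v <-> Y u v)).
{ intros u v Huv. rewrite HZ. intuition lia. }
exists Z. split; [|exact H].
constructor; try (apply C).
- apply YZ; [lia|apply C].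
- apply YZ; [lia|apply C].
- apply HZ; auto.
- intros u v Hz Hl. apply YZ in Hz; [apply C; auto|lia].
- intros u v Hz Hl. apply YZ in Hz; [apply C; auto|lia].
- intros u v Hz Hl. apply HZ in Hz. destruct Hz as [Hz|[Hz _]]; [auto|apply SY in Hz; lia].
- apply YZ; [lia|apply C].
- rewrite YZ by lia. apply C.
- apply YZ; [lia|auto].
- rewrite YZ by lia. apply C.
- rewrite YZ by lia. auto.
- intros Hf U3.
  assert (U3Y : unique Y 3 2 1) by (intros u v Hx Hl; apply U3; auto; apply YZ; [lia|auto]).
  rewrite !YZ by lia.
  destruct (bb_K _ _ _ _ C Hf U U3Y) as (K1 & K2 & K3).
  split; [|split; [auto|split; [auto|split; [auto|]]]].
  + destruct (bb_s _ _ _ _ C) as [Hs|[_ Hs]]; [apply U3Y in Hs; lia|auto].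
  + destruct (jumps_exit (fun u v => (u = 1 /\ v = 1) \/ (u = 3 /\ v = 1))
      _ _ _ _ _ ltac:(cbv beta; intros; lia) J) as (u & v & u' & v' & P1 & P2 & P3 & _);
      cbv beta in *; try lia.
    destruct P3 as [Pt P3]. unfold minus in P3, Pt.
    destruct P3 as [(->&->&P3 & _)|[(->&->&P3&_)|[(->&->&P3&_)|(->&->&P3&_)]]];
    destruct P1 as [[-> ->]|[-> ->]]; cbn in P3, P2, Pt; auto;
    try (pose proof (proj1 SY _ _ P3); lia); try (apply U3Y in P3; lia); try lia.
Qed.

Lemma forbidden_BBB w' :
  (forall X w al be, after_BBB X w al be -> path w' X 3 (w + 3) -> False) ->
  forbidden (LB :: LB :: LB :: w').
Proof.
intros Hw. apply forbidden_BB. intros Y w al be C H.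
destruct (path_BBB _ _ _ _ _ C H) as (X & C3 & H3). exact (Hw _ _ _ _ C3 H3).
Qed.

(** * Reading off the first letter of a word *)

Definition moved (X Y : config) (a b c d : Z) : Prop :=
  forall u v, Y u v <-> (u = c /\ v = d) \/ (X u v /\ ~ (u = a /\ v = b)).

Lemma path_B w X r f : path (LB :: w) X r f ->
  exists Y a b c d, path w Y (r + 1) (f + 1) /\ moved X Y a b c d /\ X a b /\
    a + b = r /\ unique X r a b /\ c + d = f + 1 /\ jumps (minus X a b) a b c d.
Proof.
intros (S & Hb & Y & (a & b & c & d & M) & H).
exists Y, a, b, c, d. pose proof (path_spans _ _ _ _ H) as SY.
destruct (back_inv _ _ _ _ _ _ _ _ Hb S SY M) as (H1 & H2 & H3 & H4).
destruct M as (M1 & M2 & _). auto 10.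
Qed.

Lemma path_F w X r f : path (LF :: w) X r f ->
  exists Y a b c d, path w Y r (f + 1) /\ moved X Y a b c d /\ X a b /\
    r <= a + b /\ c + d = f + 1 /\
    ((a + b = f /\ ((c = a + 1 /\ d = b) \/ (c = a /\ d = b + 1))) \/
     (a + b <= f - 1 /\ (exists j, f + 1 = a + b + 2 * j) /\ jumps (minus X a b) a b c d)).
Proof.
intros (S & Hb & Y & (a & b & c & d & M) & H). cbn -[Z.add] in H.
replace (r + 0) with r in H by lia.
exists Y, a, b, c, d. pose proof (path_spans _ _ _ _ H) as SY.
destruct (front_inv _ _ _ _ _ _ _ _ S SY M) as (H1 & H2 & H3 & H4).
destruct M as (M1 & M2 & _). auto 10.
Qed.

Lemma path_R w X r f : path (LR :: w) X r f ->
  exists Y a b c d, path w Y (r + 1) f /\ moved X Y a b c d /\ X a b /\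
    a + b = r /\ unique X r a b /\ r + 1 <= c + d <= f /\ ~ X c d /\
  ((c + d = r + 1 /\ ((c = a + 1 /\ d = b) \/ (c = a /\ d = b + 1))) \/
   ((exists i, c = a + 2 * i) /\ (exists j, d = b + 2 * j) /\
    r + 2 <= c + d /\ jumps (minus X a b) a b c d)).
Proof.
intros (S & Hb & Y & (a & b & c & d & M) & H). cbn -[Z.add] in H.
replace (f + 0) with f in H by lia.
exists Y, a, b, c, d. pose proof (path_spans _ _ _ _ H) as SY.
destruct (rear_inv _ _ _ _ _ _ _ _ S SY M) as (H1 & H2 & H3 & H4 & H5).
destruct M as (M1 & M2 & _). auto 10.
Qed.

Lemma path_N w X r f : path (LN :: w) X r f ->
  exists Y a b c d, path w Y r f /\ moved X Y a b c d /\ X a b /\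
    (X c d -> c = a /\ d = b) /\
    (adjacent a b c d \/
     ((exists i, c = a + 2 * i) /\ (exists j, d = b + 2 * j) /\ jumps (minus X a b) a b c d)).
Proof.
intros (S & Hb & Y & (a & b & c & d & M) & H). cbn -[Z.add] in H.
replace (f + 0) with f in H by lia. replace (r + 0) with r in H by lia.
exists Y, a, b, c, d. pose proof (moves_target _ _ _ _ _ _ M) as Ht.
destruct M as (M1 & M2 & [[M3 _]|M3]); [auto 10|].
destruct (jumps_parity _ _ _ _ _ M3). auto 12.
Qed.

Lemma path_range w X r f : path w X r f -> forall u v, X u v -> r <= u + v <= f.
Proof. intros H; apply (path_spans _ _ _ _ H). Qed.

Lemma path_unique x w X r f : path (x :: w) X r f -> x = LB \/ x = LR ->
  exists a b, X a b /\ a + b = r /\ unique X r a b.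
Proof.
intros H [-> | ->].
- apply path_B in H. destruct H as (Y & a & b & c & d & _ & _ & H1 & H2 & H3 & _). eauto.
- apply path_R in H. destruct H as (Y & a & b & c & d & _ & _ & H1 & H2 & H3 & _). eauto.
Qed.

Ltac bbb_levels C :=
  destruct (bbb_odd _ _ _ _ C) as [? ?]; pose proof (bbb_w _ _ _ _ C);
  destruct (bbb_al _ _ _ _ C) as [? ?]; destruct (bbb_be _ _ _ _ C) as [? ?];
  pose proof (bbb_lev _ _ _ _ C).
Ltac bb_levels C :=
  destruct (bb_odd _ _ _ _ C) as [? ?]; pose proof (bb_w _ _ _ _ C);
  destruct (bb_al _ _ _ _ C) as [? ?]; destruct (bb_be _ _ _ _ C) as [? ?];
  pose proof (bb_lev _ _ _ _ C).

(** Otherwise w = 3 and each of the levels 3 to 6 holds a single piece, four pieces in all. *)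
Lemma after_BBB_wide w' X w al be : after_BBB X w al be -> path w' X 3 (w + 3) ->
  unique X 3 2 1 -> 5 <= w.
Proof.
intros C H U. bbb_levels C. destruct (Z_lt_le_dec w 5) as [Hlt|]; [exfalso|auto].
destruct (path_five_pieces _ _ _ _ H 2 1 al be (al + 1) be (al + 1) (be + 1)) as (u & v & Hx & N1 & N2 & N3 & N4).
pose proof (path_range _ _ _ _ H _ _ Hx).
destruct (Z.eq_dec (u + v) 3); [apply N1, U; auto; lia|].
destruct (Z.eq_dec (u + v) 4); [apply N2, (bbb_uT _ _ _ _ C); auto; lia|].
destruct (Z.eq_dec (u + v) 5); [apply N3, (bbb_uT1 _ _ _ _ C); auto; lia|].
apply N4, (bbb_uT2 _ _ _ _ C); auto; lia.
Qed.

Lemma after_BB_wide w' Y w al be : after_BB Y w al be -> path w' Y 2 (w + 2) ->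
  unique Y 2 1 1 -> unique Y 3 2 1 -> 5 <= w.
Proof.
intros C H U2 U3. bb_levels C. destruct (Z_lt_le_dec w 5) as [Hlt|]; [exfalso|auto].
destruct (path_five_pieces _ _ _ _ H 1 1 2 1 al be (al + 1) be) as (u & v & Hx & N1 & N2 & N3 & N4).
pose proof (path_range _ _ _ _ H _ _ Hx).
destruct (Z.eq_dec (u + v) 2); [apply N1, U2; auto; lia|].
destruct (Z.eq_dec (u + v) 3); [apply N2, U3; auto; lia|].
destruct (Z.eq_dec (u + v) 4); [apply N3, (bb_uT _ _ _ _ C); auto; lia|].
apply N4, (bb_uT1 _ _ _ _ C); auto; lia.
Qed.

(** (2, 1) would be alone on level 3; then (2, 2) is empty as well as (3, 1), and it has nothing to
    hop over. *)
Lemma forbidden_BBBB : forbidden [LB; LB; LB; LB].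
Proof.
apply forbidden_BBB. intros X w al be C H. pose proof H as H0.
apply path_B in H. destruct H as (Y & a & b & c & d & H & M & Xa & L & U & E & J).
destruct (U _ _ (bbb_21 _ _ _ _ C) eq_refl) as [<- <-].
pose proof (after_BBB_wide _ _ _ _ _ C H0 U) as Hw.
destruct (bbb_K _ _ _ _ C Hw U) as (K & _).
destruct (jumps_first_up _ _ _ _ _ J) as [[F _]|[F _]].
- intros u v Hx. apply (path_range _ _ _ _ H0) in Hx; lia.
- exact (bbb_31 _ _ _ _ C F).
- exact (K F).
Qed.

(** * Words in which two back moves are followed by rear moves *)

(** The situation in which [bb_K] applies. Most words below lead to it by raising the rear twice
    more. *)
Record solo (Y : config) (w al be : Z) : Prop := Solo {
  so_bb : after_BB Y w al be;
  so_w : 5 <= w;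
  so_U2 : unique Y 2 1 1;
  so_U3 : unique Y 3 2 1;
  so_21 : Y 2 1;
  so_22 : ~ Y 2 2;
  so_13 : Y 1 3;
  so_14 : ~ Y 1 4;
  so_L5 : Y 2 3 \/ Y 3 2
}.

Lemma solo_intro w' Y w al be : after_BB Y w al be -> path w' Y 2 (w + 2) ->
  unique Y 2 1 1 -> unique Y 3 2 1 -> solo Y w al be.
Proof.
intros C H U2 U3. pose proof (after_BB_wide _ _ _ _ _ C H U2 U3) as Hw.
destruct (bb_K _ _ _ _ C Hw U2 U3) as (K1 & K2 & K3).
destruct (bb_s _ _ _ _ C) as [Hs|[Hs Hs']]; [apply U3 in Hs; lia|].
constructor; auto.
Qed.

(* Two pieces of level 2 cannot both hop over the only piece of level 3. *)
Lemma solo_rear Y w al be p q a b a' b' :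
  after_BB Y w al be -> unique Y 3 p q ->
  Y a b -> a + b = 2 -> Y (a + 1) b \/ Y a (b + 1) ->
  (Y a' b' -> a' + b' = 2 -> Y (a' + 1) b' \/ Y a' (b' + 1)) ->
  ~ (a' = a /\ b' = b) ->
  (forall u v, Y u v -> u + v = 2 -> (u = a /\ v = b) \/ (u = a' /\ v = b')) ->
  a = 1 /\ b = 1 /\ p = 2 /\ q = 1 /\ unique Y 2 1 1.
Proof.
intros C U3 Ya La Ha Ha' Hn U2.
assert (P : forall u v, u + v = 2 -> Y (u + 1) v \/ Y u (v + 1) ->
   (u + 1 = p /\ v = q) \/ (u = p /\ v + 1 = q)).
{ intros u v Hl [Hx|Hx]; apply U3 in Hx; lia. }
pose proof (P _ _ La Ha) as Pa.
destruct (classic (Y a' b' /\ a' + b' = 2)) as [[Yb Lb]|Nb].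
- exfalso. pose proof (P _ _ Lb (Ha' Yb Lb)) as Pb.
  assert (E : (p = 2 /\ q = 1) \/ (p = 1 /\ q = 2)).
  { destruct (U2 _ _ (bb_11 _ _ _ _ C) eq_refl); lia. }
  destruct E as [[-> ->]|[-> ->]].
  + assert (Y 2 0) by (destruct Pa as [Pa|Pa]; destruct Pb as [Pb|Pb]; try lia;
      [replace 2 with a' by lia; replace 0 with b' by lia
      |replace 2 with a by lia; replace 0 with b by lia]; auto).
    apply (bb_20 _ _ _ _ C); auto.
  + apply (bb_12 _ _ _ _ C).
    destruct Ha as [Ha|Ha]; pose proof (U3 _ _ Ha ltac:(lia)) as [E1 E2];
     rewrite E1, E2 in Ha; auto.
- assert (V : unique Y 2 1 1 /\ a = 1 /\ b = 1).
  { assert (W : unique Y 2 a b).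
    { intros u v Hy Hl. destruct (U2 u v Hy Hl) as [|[-> ->]]; tauto. }
    destruct (W _ _ (bb_11 _ _ _ _ C) eq_refl) as [<- <-]. auto. }
  destruct V as (V & -> & ->).
  destruct Ha as [Ha|Ha]; [|destruct (bb_12 _ _ _ _ C Ha)].
  destruct (U3 _ _ Ha ltac:(lia)). split; [auto|split; [auto|split; [lia|split; [lia|auto]]]].
Qed.

(** [back] follows a piece through the moves to earlier placements, with one case for each moved
    piece; [fwd] carries an occupied cell to later placements. *)
Ltac back H := repeat match type of H with ?V ?u ?v =>
  match goal with M : moved _ V _ _ _ _ |- _ =>
    apply M in H; destruct H as [H|[H ?]] end end.
Ltac fwd := repeat first [assumption | match goal with M : moved _ ?V _ _ _ _ |- ?V _ _ =>
    apply M; first [left; lia | right; split; [|lia]] end]; auto.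

Lemma after_BB_level3 Y w al be : after_BB Y w al be -> exists p q, Y p q /\ p + q = 3.
Proof.
intros C. destruct (bb_s _ _ _ _ C) as [Hs|[Hs _]]; [exists 3, 0|exists 2, 1]; auto.
Qed.

(** Had (1, 1) shifted to level 3, it would stand beside a piece already there ([after_BB_level3]).
    So it jumps, starting over (2, 1), and lands on an even level: level 3 was a single piece before
    the move. *)
Lemma R_solo w' Y w al be Y1 c d p q :
  after_BB Y w al be -> path w' Y 2 (w + 2) -> moved Y Y1 1 1 c d ->
  unique Y 2 1 1 -> ~ Y c d ->
  ((c + d = 3 /\ ((c = 1 + 1 /\ d = 1) \/ (c = 1 /\ d = 1 + 1))) \/
   ((exists i, c = 1 + 2 * i) /\ (exists j, d = 1 + 2 * j) /\
    2 + 2 <= c + d /\ jumps (minus Y 1 1) 1 1 c d)) ->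
  unique Y1 3 p q ->
  solo Y w al be /\ ~ Y 3 1 /\ (exists i, c = 1 + 2 * i) /\ (exists j, d = 1 + 2 * j) /\
  4 <= c + d /\ jumps (minus Y 1 1) 1 1 c d /\ p = 2 /\ q = 1.
Proof.
intros C H M U2 Nc HM U3.
destruct HM as [[L _]|(P1 & P2 & L & J)].
{ exfalso. destruct (after_BB_level3 _ _ _ _ C) as (s & t & Ys & Ls).
  assert (Y1c : Y1 c d) by fwd. assert (Y1s : Y1 s t) by fwd.
  destruct (U3 _ _ Y1c L), (U3 _ _ Y1s Ls). subst. auto. }
destruct (jumps_first_up _ _ _ _ _ J) as [[F1 F2]|[F _]].
{ intros u v Hx; apply (path_range _ _ _ _ H) in Hx; lia. }
2: destruct (bb_12 _ _ _ _ C F).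
assert (Y121 : Y1 2 1) by fwd.
destruct (U3 _ _ Y121 eq_refl) as [<- <-].
assert (U3Y : unique Y 3 2 1).
{ intros u v Hy Hl. apply U3; [fwd|auto]. }
split; [eapply solo_intro; eauto|]. repeat split; auto; lia.
Qed.

(* [V] is the placement before the last back move, whichever of the front move
   and the rear move comes first. *)
Lemma no_back_after_R V Y w al be m n c d :
  solo Y w al be -> (V 3 1 -> m = 3 /\ n = 1) ->
  (exists i, m = 1 + 2 * i) -> (exists j, n = 1 + 2 * j) ->
  (forall u v, V u v -> 3 <= u + v) ->
  (forall u v, V u v -> u + v <= w + 2 -> Y u v \/ (u = m /\ v = n)) ->
  (forall u v, Y u v -> u + v = w -> V u v) ->
  jumps (minus V 2 1) 2 1 c d -> c + d = w + 4 -> False.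
Proof.
intros [C Hw _ _ Y21 N22 Y13 N14 HL5] N31 [i Hi] [j Hj] V3 Vup Vlo J E. bb_levels C.
(* (2, 2) is empty, so (2, 1) starts over (3, 1), where only the piece of the rear move can
   stand. *)
assert (Em : m = 3 /\ n = 1).
{ destruct (jumps_first_up _ _ _ _ _ J) as [[F _]|[F _]].
  - intros u v Hv; apply V3 in Hv; lia.
  - auto.
  - destruct (Vup _ _ F ltac:(lia)); [contradiction|lia]. }
destruct Em as [-> ->].
(* The only obstacle on level w + 1 is (al, be). The class of (2, 1) allows hopping over it only
   from (al, be - 1), which is occupied by [bb_left]. *)
destruct (jumps_cross _ _ _ _ _ w J) as (u & v & Hl & [k Hk] & [l Hl'] & Hn & HF);
  [lia|exists (x - 1); lia|].
destruct HF as [[F1 F2]|[F1 F2]].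
- pose proof F1 as F1'. apply Vup in F1; [|lia]. destruct F1 as [F1|F1]; [|lia].
  apply (bb_uT _ _ _ _ C) in F1; lia.
- pose proof F1 as F1'. apply Vup in F1; [|lia]. destruct F1 as [F1|F1]; [|lia].
  destruct (bb_uT _ _ _ _ C _ _ F1 ltac:(lia)) as [-> E2].
  replace v with (be - 1) in * by lia.
  destruct Hn as [Hn|Hn]; [lia|]. apply Hn, Vlo; [apply C|lia].
Qed.

Lemma forbidden_BBRFB : forbidden [LB; LB; LR; LF; LB].
Proof.
apply forbidden_BB. intros Y w al be C H0. pose proof H0 as H.
apply path_R in H. destruct H as (Y1 & a & b & m & n & H1 & M1 & Ya & L & U2 & Lm & Nm & HM).
destruct (U2 _ _ (bb_11 _ _ _ _ C) eq_refl) as [<- <-].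
pose proof H1 as H. apply path_F in H.
destruct H as (V & z & z' & t & t' & H2 & M2 & Yz & Lz & Lt & HF).
pose proof H2 as H. apply path_B in H.
destruct H as (V' & g & g' & h & h' & _ & _ & Vg & Lg & U3 & Lh & J).
bb_levels C.
(* The front piece comes from level w + 2 or, by parity, from an even level, so level 3 loses
   nothing to it. *)
assert (U3' : unique Y1 3 g g').
{ intros u v Hu Hl. apply U3; [|lia].
  destruct HF as [[HF _]|(HF & [j HF'] & _)]; fwd. }
destruct (R_solo _ _ _ _ _ _ _ _ _ _ C H0 M1 U2 Nm HM U3') as (S & N31 & Pm & Pn & L4 & J1 & -> & ->).
pose proof (so_w _ _ _ _ S).
eapply (no_back_after_R V Y w al be m n); eauto.
- intros Hv. back Hv; try lia; contradiction.
- intros u v Hv. apply (path_range _ _ _ _ H2) in Hv; lia.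
- intros u v Hv Hl. back Hv; auto; lia.
- intros u v Hv Hl. destruct HF as [[HF _]|(HF & [j HF'] & _)]; fwd.
- lia.
Qed.

(** The front move may have taken one of two pieces off level 2; [solo_rear] excludes this. The rest
    is as in [R_solo]. *)
Lemma FR_solo w' w'' Y w al be Y1 Y2 z z' t t' a b c d p q :
  after_BB Y w al be -> path w' Y 2 (w + 2) -> path w'' Y1 2 (w + 3) ->
  moved Y Y1 z z' t t' -> Y z z' -> t + t' = w + 2 + 1 ->
    ((z + z' = w + 2 /\ ((t = z + 1 /\ t' = z') \/ (t = z /\ t' = z' + 1))) \/
     (z + z' <= w + 2 - 1 /\ (exists j, w + 2 + 1 = z + z' + 2 * j) /\ jumps (minus Y z z') z z' t t')) ->
  moved Y1 Y2 a b c d -> Y1 a b -> a + b = 2 ->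
  unique Y1 2 a b -> ~ Y1 c d ->
  ((c + d = 3 /\ ((c = a + 1 /\ d = b) \/ (c = a /\ d = b + 1))) \/
   ((exists i, c = a + 2 * i) /\ (exists j, d = b + 2 * j) /\
    2 + 2 <= c + d /\ jumps (minus Y1 a b) a b c d)) ->
  unique Y2 3 p q ->
  solo Y w al be /\ ~ Y1 3 1 /\ a = 1 /\ b = 1 /\ z + z' <> 2 /\
  (exists i, c = 1 + 2 * i) /\ (exists j, d = 1 + 2 * j) /\
  4 <= c + d /\ jumps (minus Y1 1 1) 1 1 c d /\ p = 2 /\ q = 1.
Proof.
intros C H H1 M1 Yz Lt HF M2 Y1a La U2 Nc HM U3. bb_levels C.
assert (Pz : z + z' <> 3).
{ destruct HF as [[HF _]|(HF & [j HF'] & _)]; lia. }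
assert (Y13 : forall u v, u + v = 3 -> (Y1 u v <-> Y u v)).
{ intros u v Hl. split; intros Hu; [back Hu; auto; lia|fwd]. }
destruct HM as [[L _]|(P1 & P2 & L & J)].
{ exfalso. destruct (after_BB_level3 _ _ _ _ C) as (s & s' & Ys & Ls).
  assert (Y1s : Y1 s s') by (apply Y13; auto).
  assert (Y2c : Y2 c d) by fwd. assert (Y2s : Y2 s s') by fwd.
  destruct (U3 _ _ Y2c L), (U3 _ _ Y2s Ls). subst. auto. }
assert (U3Y : unique Y 3 p q).
{ intros u v Hu Hl. apply U3; auto. apply M2. right. split; [apply Y13; auto|lia]. }
assert (Fa := jumps_first_up _ _ _ _ _ J
   ltac:(intros u v Hx; apply (path_range _ _ _ _ H1) in Hx; lia)).
assert (Ya : Y a b) by (back Y1a; auto; lia).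
destruct (solo_rear Y w al be p q a b z z' C U3Y Ya La) as (-> & -> & -> & -> & V).
- rewrite <- !Y13 by lia. tauto.
- intros _ Lz. destruct HF as [[HF _]|(HF & [j HF'] & J')]; [lia|].
  assert (Fz := jumps_first_up _ _ _ _ _ J'
   ltac:(intros u v Hx; apply (path_range _ _ _ _ H) in Hx; lia)). tauto.
- intros [-> ->]. back Y1a; tauto || lia.
- intros u v Hu Hl. destruct (classic (u = z /\ v = z')) as [|N]; [auto|left].
  apply U2; auto. fwd.
- assert (S : solo Y w al be) by (eapply solo_intro; eauto).
  pose proof (so_w _ _ _ _ S).
  split; [auto|]. split.
  { change (1 + 1) with 2 in Fa. change (1 + 2) with 3 in Fa.
    destruct Fa as [[_ Fa]|[Fa _]]; [auto|]. apply Y13 in Fa; [|lia].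
    destruct (bb_12 _ _ _ _ C Fa). }
  do 2 (split; [auto|]). split; [|auto 10].
  intros Lz. destruct (V _ _ Yz Lz) as [-> ->]. back Y1a; tauto || lia.
Qed.

Lemma forbidden_BBFRB : forbidden [LB; LB; LF; LR; LB].
Proof.
apply forbidden_BB. intros Y w al be C H0. pose proof H0 as H.
apply path_F in H. destruct H as (Y1 & z & z' & t & t' & H1 & M1 & Yz & Lz & Lt & HF).
replace (w + 2 + 1) with (w + 3) in H1 by lia.
pose proof H1 as H. apply path_R in H.
destruct H as (V & a & b & m & n & H2 & M2 & Y1a & L & U2 & Lm & Nm & HM).
pose proof H2 as H. apply path_B in H.
destruct H as (V' & g & g' & h & h' & _ & _ & Vg & Lg & U3 & Lh & J).
bb_levels C.
destruct (FR_solo _ _ _ _ _ _ _ _ _ _ _ _ _ _ _ _ _ _ C H0 H1 M1 Yz Lt HF M2 Y1a L U2 Nm HM U3)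
  as (S & N31 & -> & -> & Nz & Pm & Pn & L4 & J1 & -> & ->).
pose proof (so_w _ _ _ _ S).
eapply (no_back_after_R V Y w al be m n); eauto.
- intros Hv. apply M2 in Hv. destruct Hv as [Hv|[Hv _]]; [lia|contradiction].
- intros u v Hv. apply (path_range _ _ _ _ H2) in Hv; lia.
- intros u v Hv Hl. back Hv; auto; lia.
- intros u v Hv Hl. destruct HF as [[HF _]|(HF & [j HF'] & _)]; fwd.
- lia.
Qed.

(** (1, 3) has to be alone on level 4 after both rear moves. But (2, 1) either shifts to level 4
    itself or starts over (3, 1), where the first rear piece then remains. *)
Lemma forbidden_BBRR x : x = LB \/ x = LR -> forbidden [LB; LB; LR; LR; x].
Proof.
intros Hx. apply forbidden_BB. intros Y w al be C H0. pose proof H0 as H.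
apply path_R in H. destruct H as (Y1 & a & b & m & n & H1 & M1 & Ya & L & U2 & Lm & Nm & HM).
destruct (U2 _ _ (bb_11 _ _ _ _ C) eq_refl) as [<- <-].
pose proof H1 as H. apply path_R in H.
destruct H as (Y2 & g & g' & s & s' & H2 & M2 & Y1g & Lg & U3 & Ls & Ns & HS).
destruct (path_unique _ _ _ _ _ H2 Hx) as (p & q & Y2p & Lp & U4).
bb_levels C.
destruct (R_solo _ _ _ _ _ _ _ _ _ _ C H0 M1 U2 Nm HM U3) as (S & N31 & [i Pm] & [j Pn] & L4 & J1 & -> & ->).
pose proof (so_w _ _ _ _ S). pose proof (so_13 _ _ _ _ S) as Y13.
assert (Y213 : Y2 1 3) by fwd.
destruct (U4 _ _ Y213 ltac:(lia)) as [<- <-].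
destruct HS as [[_ HS]|(_ & _ & _ & J2)].
- assert (Y2s : Y2 s s') by fwd. apply U4 in Y2s; lia.
- destruct (jumps_first_up _ _ _ _ _ J2) as [[F _]|[F _]].
  + intros u v Hu; apply (path_range _ _ _ _ H1) in Hu; lia.
  + back F; [|contradiction]. assert (Y2m : Y2 m n) by fwd. apply U4 in Y2m; lia.
  + back F; [lia|]. destruct (so_22 _ _ _ _ S F).
Qed.

(* [U1], [U2], [V] are the placements before the first, second and third rear
   move, [UF] the one before the front move, in whichever order they come. *)
Lemma no_back_after_three_R Y w al be U1 U2 UF V V' m n s s' z z' t t' g g' h h' p q :
  solo Y w al be -> (forall u v, Y u v -> 2 <= u + v) ->
  (forall u v, U1 u v -> u + v <= w + 2 -> Y u v) ->
  (forall u v, U1 u v -> 2 <= u + v) ->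
  (exists i, m = 1 + 2 * i) -> (exists j, n = 1 + 2 * j) -> 4 <= m + n ->
  jumps (minus U1 1 1) 1 1 m n ->
  ~ Y 2 2 -> (U2 3 1 -> m = 3 /\ n = 1) ->
  (forall u v, U2 u v -> u + v <= w + 2 -> Y u v \/ (u = m /\ v = n)) ->
  (forall u v, U2 u v -> 3 <= u + v) -> ~ U2 s s' ->
  ((s + s' = 4 /\ ((s = 2 + 1 /\ s' = 1) \/ (s = 2 /\ s' = 1 + 1))) \/
   ((exists i, s = 2 + 2 * i) /\ (exists j, s' = 1 + 2 * j) /\
    5 <= s + s' /\ jumps (minus U2 2 1) 2 1 s s')) ->
  (forall u v, UF u v -> u + v <= w + 2 -> Y u v \/ (u = m /\ v = n) \/ (u = s /\ v = s')) ->
  t + t' = w + 3 ->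
  (z + z' = w + 2 \/ ((exists j, z + z' = 2 * j) /\ jumps (minus UF z z') z z' t t')) ->
  (forall u v, V u v -> u + v <= w + 2 -> Y u v \/ (u = m /\ v = n) \/ (u = s /\ v = s')) ->
  (forall u v, Y u v -> 4 <= u + v -> V u v \/ (u = z /\ v = z')) ->
  (V m n \/ (z = m /\ z' = n)) -> (V s s' \/ (z = s /\ z' = s')) ->
  (U2 m n \/ (V s s' /\ z = m /\ z' = n)) ->
  V g g' -> g + g' = 4 -> unique V 4 g g' -> ~ V h h' ->
  ((h + h' = 5) \/ (6 <= h + h' /\ jumps (minus V g g') g g' h h')) ->
  moved V V' g g' h h' -> unique V' 5 p q -> False.
Proof.
intros S Ylo U1up U1lo Pm Pn Lm J1 N22 N31 U2up U2lo Ns HS UFup Lt HF Vup Vlo Vm Vs Hord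
  Vg Lg U4 Nh HR M U5.
pose proof (so_bb _ _ _ _ S) as C. bb_levels C. pose proof (so_w _ _ _ _ S) as Hw.
pose proof (so_U3 _ _ _ _ S) as U3. pose proof (so_13 _ _ _ _ S) as Y13.
pose proof (so_14 _ _ _ _ S) as N14.
destruct Pm as [im Pm]. destruct Pn as [jn Pn].
assert (Pz : forall u v, Y u v -> u + v = 5 -> V u v).
{ intros u v Hu Hl. destruct (Vlo _ _ Hu ltac:(lia)) as [|E]; [auto|].
  destruct HF as [HF|[[j HF] _]]; lia. }
assert (Vs5 : s + s' = 5 -> V s s').
{ intros Es. destruct Vs as [|E]; [auto|]. destruct HF as [HF|[[j HF] _]]; lia. }
(* The last back move needs a single piece on level 5 after the third rear move. *)
assert (V'5 : forall u v, V u v -> u + v = 5 -> u = p /\ v = q).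
{ intros u v Hu Hl. apply U5; [|auto]. apply M. right. split; [auto|lia]. }
destruct HR as [HR|[Lh JR]].
{ assert (V'h : V' h h') by (apply M; auto).
  destruct (U5 _ _ V'h HR) as [-> ->].
  destruct (so_L5 _ _ _ _ S) as [Y5|Y5]; apply Pz in Y5; try lia;
   destruct (V'5 _ _ Y5 ltac:(lia)) as [<- <-]; auto. }
(* whichever of the two moves takes (a,b) away from level 4, it is a jump *)
assert (Leave : forall a b, a + b = 4 -> (z = a /\ z' = b) \/ (g = a /\ g' = b) ->
  exists U k k', (forall u v, U u v -> u + v <= w + 2 -> Y u v \/ (u = m /\ v = n) \/ (u = s /\ v = s'))
    /\ jumps (minus U a b) a b k k' /\ 6 <= k + k').
{ intros a b Lab [[-> ->]|[-> ->]].
  - destruct HF as [HF|[_ HF]]; [lia|]. exists UF, t, t'. split; [auto|split; [auto|lia]].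
  - exists V, h, h'. auto. }
(* The third rear move needs a single piece on level 4, so of two pieces there one goes with the
   front move and the other with that rear move. *)
assert (L4 : forall a b a' b', a + b = 4 -> a' + b' = 4 -> ~ (a = a' /\ b = b') ->
   (V a b \/ (z = a /\ z' = b)) -> (V a' b' \/ (z = a' /\ z' = b')) ->
   ((z = a /\ z' = b) \/ (g = a /\ g' = b)) /\ ((z = a' /\ z' = b') \/ (g = a' /\ g' = b'))).
{ intros a b a' b' E1 E2 E3 [E4|E4] [E5|E5].
  - destruct (U4 _ _ E4 E1), (U4 _ _ E5 E2). lia.
  - destruct (U4 _ _ E4 E1). lia.
  - destruct (U4 _ _ E5 E2). lia.
  - lia. }
assert (V13 : V 1 3 \/ (z = 1 /\ z' = 3)) by (destruct (Vlo _ _ Y13); [lia|auto|right; lia]).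
(* If (2, 1) jumps, it starts over (3, 1), where the first rear piece must have stopped. *)
assert (HS' : (s + s' = 4 /\ ((s = 3 /\ s' = 1) \/ (s = 2 /\ s' = 2))) \/
   ((exists i, s = 2 + 2 * i) /\ (exists j, s' = 1 + 2 * j) /\ 5 <= s + s' /\ m = 3 /\ n = 1)).
{ destruct HS as [HS|(E1 & E2 & E3 & J2)]; [left; lia|right].
  split; [auto|split; [auto|split; [auto|]]].
  destruct (jumps_first_up _ _ _ _ _ J2) as [[F _]|[F _]].
  - intros u v Hu; apply U2lo in Hu; lia.
  - auto.
  - destruct (U2up _ _ F ltac:(lia)); [contradiction|lia]. }
(* in both cases (1,3) jumps, necessarily over (2,3) *)
assert (Y23 : Y 2 3).
{ assert (L13 : (z = 1 /\ z' = 3) \/ (g = 1 /\ g' = 3)).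
  { destruct HS' as [[E1 E2]|(_ & _ & _ & -> & ->)].
    - apply (L4 1 3 s s'); auto; lia.
    - apply (L4 1 3 3 1); auto; lia. }
  destruct (Leave 1 3 eq_refl L13) as (U & k & k' & Uup & J & Lk).
  destruct (jumps_first _ _ _ _ _ J) as (u & v & Ht & Hh).
  destruct Hh as [(->&->&[Hh _])|[(->&->&[Hh _])|[(->&->&[Hh _])|(->&->&[Hh _])]]];
  cbn in Hh; destruct (Uup _ _ Hh ltac:(lia)) as [Hy|[Hy|Hy]]; try lia; auto.
  - destruct HS' as [HS'|([i E1] & [j E2] & E3 & _ & _)]; [lia|].
    assert (Vs' : V s s') by (apply Vs5; lia).
    destruct (V'5 _ _ Vs' ltac:(lia)).
    destruct (so_L5 _ _ _ _ S) as [Y5|Y5]; [auto|].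
    apply Pz in Y5; [|lia]. destruct (V'5 _ _ Y5 ltac:(lia)). lia.
  - apply U3 in Hy; lia.
  - contradiction.
  - destruct HS' as [HS'|([i E1] & [j E2] & E3 & _ & _)]; lia.
  - apply U3 in Hy; lia. }
assert (E5 : p = 2 /\ q = 3) by (destruct (V'5 _ _ (Pz _ _ Y23 eq_refl) eq_refl); auto).
destruct E5 as [-> ->].
assert (Y5 : forall u v, Y u v -> u + v = 5 -> u = 2 /\ v = 3) by auto.
(* To go beyond (3, 1) the first rear piece would need an obstacle at (4, 1) or (3, 2), but on level
   5 there is only (2, 3). *)
assert (E : m = 3 /\ n = 1).
{ apply NNPP; intros N.
  destruct (jumps_exit (fun u v => (u = 1 /\ v = 1) \/ (u = 3 /\ v = 1))
      _ _ _ _ _ ltac:(cbv beta; intros; lia) J1) as (u & v & u' & v' & P1 & P2 & P3 & _);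
      cbv beta in *; try lia.
  destruct P3 as [Pt P3]. unfold minus in P3.
  destruct P3 as [(->&->&P3 & _)|[(->&->&P3&_)|[(->&->&P3&_)|(->&->&P3&_)]]];
  destruct P1 as [[-> ->]|[-> ->]]; cbn in P3, P2;
    try (apply U1lo in P3; lia); apply U1up in P3; try lia;
    try (apply U3 in P3; lia); try (apply Y5 in P3; lia). }
destruct E as [-> ->].
assert (L31 : ((z = 3 /\ z' = 1) \/ (g = 3 /\ g' = 1)) /\ ((z = 1 /\ z' = 3) \/ (g = 1 /\ g' = 3)) /\ 5 <= s + s').
{ destruct HS' as [[E1 E2]|(_ & _ & E3 & _ & _)].
  - exfalso. destruct E2 as [[-> ->]|[-> ->]].
    + destruct Hord as [Hord|(Hord & E1' & E2')]; [auto|].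
      destruct V13 as [V13|V13]; [|lia].
      destruct (U4 _ _ V13 eq_refl), (U4 _ _ Hord eq_refl). lia.
    + destruct (L4 1 3 2 2), (L4 1 3 3 1), (L4 2 2 3 1); auto; lia.
  - destruct (L4 1 3 3 1); auto; lia. }
destruct L31 as (L31 & L13 & Ls5).
destruct HS' as [HS'|([i Pi] & [j Pj] & _)]; [lia|].
(* The piece at (3, 1) now has to jump upwards and is stuck for want of the same obstacles. *)
destruct (Leave 3 1 eq_refl L31) as (U & k & k' & Uup & J & Lk).
assert (Ulow : forall u v, U u v -> u + v <= 3 -> u = 2 /\ v = 1 \/ u + v = 2).
{ intros u v Hu Hl. destruct (Uup _ _ Hu ltac:(lia)) as [Hy|[Hy|Hy]]; try lia.
  destruct (Z.eq_dec (u + v) 3); [left; apply U3; auto|].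
  apply Ylo in Hy. lia. }
destruct (jumps_exit (fun u v => (u = 1 /\ v = 1) \/ (u = 3 /\ v = 1))
      _ _ _ _ _ ltac:(cbv beta; intros; lia) J) as (u & v & u' & v' & P1 & P2 & P3 & _);
      cbv beta in *; try lia.
destruct P3 as [Pt P3]. unfold minus in P3.
assert (N5 : forall u v, U u v -> u + v = 5 -> u = 2 /\ v = 3).
{ intros a b Ha El. destruct (Uup _ _ Ha ltac:(lia)) as [Hy|[Hy|Hy]]; [auto|lia|].
  destruct Hy as [-> ->]. auto. }
destruct P3 as [(->&->&P3 & _)|[(->&->&P3&_)|[(->&->&P3&_)|(->&->&P3&_)]]];
  destruct P1 as [[-> ->]|[-> ->]]; cbn in P3, P2;
  try (apply N5 in P3; lia); apply Ulow in P3; lia.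
Qed.

Lemma forbidden_BBRRFRB : forbidden [LB; LB; LR; LR; LF; LR; LB].
Proof.
apply forbidden_BB. intros Y w al be C H0. pose proof H0 as H.
apply path_R in H. destruct H as (Y1 & a & b & m & n & H1 & M1 & Ya & L & U2 & Lm & Nm & HM).
destruct (U2 _ _ (bb_11 _ _ _ _ C) eq_refl) as [<- <-].
pose proof H1 as H. apply path_R in H.
destruct H as (Y2 & a & b & s & s' & H2 & M2 & Y1g & Lg & U3 & Ls & Ns & HS).
pose proof H2 as H. apply path_F in H.
destruct H as (Y3 & z & z' & t & t' & H3 & M3 & Yz & Lz & Lt & HF).
pose proof H3 as H. apply path_R in H.
destruct H as (Y4 & g & g' & h & h' & H4 & M4 & Yg & Lg' & U4 & Lh & Nh & HR).
destruct (path_unique LB _ _ _ _ H4 (or_introl eq_refl)) as (p & q & Y4p & Lp & U5).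
bb_levels C.
destruct (R_solo _ _ _ _ _ _ _ _ _ _ C H0 M1 U2 Nm HM U3) as (S & N31 & Pm & Pn & L4 & J1 & -> & ->).
pose proof (so_w _ _ _ _ S).
refine (no_back_after_three_R Y w al be Y Y1 Y2 Y3 Y4 m n s s' z z' t t' g g' h h' p q
  S _ _ _ Pm Pn L4 J1 (so_22 _ _ _ _ S) _ _ _ Ns _ _ _ _ _ _ _ _ _ Yg _ _ Nh _ M4 _).
- intros u v Hu; apply (path_range _ _ _ _ H0) in Hu; lia.
- auto.
- intros u v Hu; apply (path_range _ _ _ _ H0) in Hu; lia.
- intros Hu. back Hu; [lia|contradiction].
- intros u v Hu Hl. back Hu; auto.
- intros u v Hu; apply (path_range _ _ _ _ H1) in Hu; lia.
- destruct HS as [HS|(? & ? & ? & ?)]; [left; lia|right; repeat split; auto; lia].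
- intros u v Hu Hl. back Hu; auto.
- lia.
- destruct HF as [[HF _]|(_ & [j HF] & J)]; [left; lia|right; split; [exists (x - j + 2); lia|auto]].
- intros u v Hu Hl. back Hu; auto; lia.
- intros u v Hu Hl. destruct (classic (u = z /\ v = z')) as [|N]; [auto|left; fwd].
- destruct (classic (m = z /\ n = z')) as [E|N]; [right; lia|left].
  destruct Pm, Pn. fwd.
- destruct (classic (s = z /\ s' = z')) as [E|N]; [right; lia|left; fwd].
- left. destruct Pm, Pn. fwd.
- lia.
- replace 4 with (2 + 1 + 1) by lia. auto.
- destruct HR as [[HR _]|(_ & _ & ? & ?)]; [left; lia|right; split; [lia|auto]].
- replace 5 with (2 + 1 + 1 + 1) by lia. auto.
Qed.

Lemma forbidden_BBRFRRB : forbidden [LB; LB; LR; LF; LR; LR; LB].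
Proof.
apply forbidden_BB. intros Y w al be C H0. pose proof H0 as H.
apply path_R in H. destruct H as (Y1 & a & b & m & n & H1 & M1 & Ya & L & U2 & Lm & Nm & HM).
destruct (U2 _ _ (bb_11 _ _ _ _ C) eq_refl) as [<- <-].
pose proof H1 as H. apply path_F in H.
destruct H as (Y2 & z & z' & t & t' & H2 & M2 & Yz & Lz & Lt & HF).
pose proof H2 as H. apply path_R in H.
destruct H as (Y3 & a & b & s & s' & H3 & M3 & Y2g & Lg & U3 & Ls & Ns & HS).
pose proof H3 as H. apply path_R in H.
destruct H as (Y4 & g & g' & h & h' & H4 & M4 & Yg & Lg' & U4 & Lh & Nh & HR).
destruct (path_unique LB _ _ _ _ H4 (or_introl eq_refl)) as (p & q & Y4p & Lp & U5).
bb_levels C.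
assert (U3' : unique Y1 3 a b).
{ intros u v Hu Hl. apply U3; [|lia].
  destruct HF as [[HF _]|(HF & [j HF'] & _)]; fwd. }
destruct (R_solo _ _ _ _ _ _ _ _ _ _ C H0 M1 U2 Nm HM U3') as (S & N31 & Pm & Pn & L4 & J1 & -> & ->).
pose proof (so_w _ _ _ _ S).
refine (no_back_after_three_R Y w al be Y Y2 Y1 Y3 Y4 m n s s' z z' t t' g g' h h' p q
  S _ _ _ Pm Pn L4 J1 (so_22 _ _ _ _ S) _ _ _ Ns _ _ _ _ _ _ _ _ _ Yg _ _ Nh _ M4 _).
- intros u v Hu; apply (path_range _ _ _ _ H0) in Hu; lia.
- auto.
- intros u v Hu; apply (path_range _ _ _ _ H0) in Hu; lia.
- intros Hu. back Hu; [lia|lia|contradiction].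
- intros u v Hu Hl. back Hu; auto; lia.
- intros u v Hu; apply (path_range _ _ _ _ H2) in Hu; lia.
- destruct HS as [HS|(? & ? & ? & ?)]; [left; lia|right; repeat split; auto; lia].
- intros u v Hu Hl. back Hu; auto.
- lia.
- destruct HF as [[HF _]|(_ & [j HF] & J)]; [left; lia|right; split; [exists (x - j + 2); lia|auto]].
- intros u v Hu Hl. back Hu; auto; lia.
- intros u v Hu Hl. destruct (classic (u = z /\ v = z')) as [|N]; [auto|left; fwd].
- destruct (classic (m = z /\ n = z')) as [E|N]; [right; lia|left].
  destruct Pm, Pn. fwd.
- left; fwd.
- destruct (classic (m = z /\ n = z')) as [E|N]; [right|left; fwd].
  split; [fwd|lia].
- lia.
- replace 4 with (2 + 1 + 1) by lia. auto.
- destruct HR as [[HR _]|(_ & _ & ? & ?)]; [left; lia|right; split; [lia|auto]].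
- replace 5 with (2 + 1 + 1 + 1) by lia. auto.
Qed.

Lemma forbidden_BBFRRRB : forbidden [LB; LB; LF; LR; LR; LR; LB].
Proof.
apply forbidden_BB. intros Y w al be C H0. pose proof H0 as H.
apply path_F in H. destruct H as (Y1 & z & z' & t & t' & H1 & M1 & Yz & Lz & Lt & HF).
replace (w + 2 + 1) with (w + 3) in H1 by lia.
pose proof H1 as H. apply path_R in H.
destruct H as (Y2 & a & b & m & n & H2 & M2 & Y1a & L & U2 & Lm & Nm & HM).
pose proof H2 as H. apply path_R in H.
destruct H as (Y3 & a' & b' & s & s' & H3 & M3 & Y2g & Lg & U3 & Ls & Ns & HS).
pose proof H3 as H. apply path_R in H.
destruct H as (Y4 & g & g' & h & h' & H4 & M4 & Yg & Lg' & U4 & Lh & Nh & HR).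
destruct (path_unique LB _ _ _ _ H4 (or_introl eq_refl)) as (p & q & Y4p & Lp & U5).
bb_levels C.
destruct (FR_solo _ _ _ _ _ _ _ _ _ _ _ _ _ _ _ _ _ _ C H0 H1 M1 Yz Lt HF M2 Y1a L U2 Nm HM U3)
  as (S & N31 & -> & -> & Nz & Pm & Pn & L4 & J1 & -> & ->).
pose proof (so_w _ _ _ _ S).
refine (no_back_after_three_R Y w al be Y1 Y2 Y Y3 Y4 m n s s' z z' t t' g g' h h' p q
  S _ _ _ Pm Pn L4 J1 (so_22 _ _ _ _ S) _ _ _ Ns _ _ _ _ _ _ _ _ _ Yg _ _ Nh _ M4 _).
- intros u v Hu; apply (path_range _ _ _ _ H0) in Hu; lia.
- intros u v Hu Hl. back Hu; auto; lia.
- intros u v Hu; apply (path_range _ _ _ _ H1) in Hu; lia.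
- intros Hu. apply M2 in Hu. destruct Hu as [Hu|[Hu _]]; [lia|contradiction].
- intros u v Hu Hl. back Hu; auto; lia.
- intros u v Hu; apply (path_range _ _ _ _ H2) in Hu; lia.
- destruct HS as [HS|(? & ? & ? & ?)]; [left; lia|right; repeat split; auto; lia].
- auto.
- lia.
- destruct HF as [[HF _]|(_ & [j HF] & J)]; [left; lia|right; split; [exists (x - j + 2); lia|auto]].
- intros u v Hu Hl. back Hu; auto; lia.
- intros u v Hu Hl. destruct (classic (u = z /\ v = z')) as [|N]; [auto|left; fwd].
- left. destruct Pm, Pn. fwd.
- left; fwd.
- left. fwd.
- lia.
- replace 4 with (2 + 1 + 1) by lia. auto.
- destruct HR as [[HR _]|(_ & _ & ? & ?)]; [left; lia|right; split; [lia|auto]].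
- replace 5 with (2 + 1 + 1 + 1) by lia. auto.
Qed.

(* Two front moves and then a back move: the second front move only shifts
   the piece brought to the front by the first one, which leaves level [w + 3] empty. *)
Record stretched (Y U D : config) (w al be z z' t t' e e' b b' g g' : Z) : Prop := Stretched {
  st_z : Y z z';
  st_zlev : exists j, z + z' = 2 * j;
  st_zw : z + z' <= w + 1;
  st_J : jumps (minus Y z z') z z' t t';
  st_t : t + t' = w + 3;
  st_tT : (z = al /\ z' = be) \/ (t = al + 1 /\ t' = be + 1);
  st_e : (e = t + 1 /\ e' = t') \/ (e = t /\ e' = t' + 1);
  st_U : forall u v, U u v <-> (u = e /\ v = e') \/ (Y u v /\ ~ (u = z /\ v = z'));
  st_b : U b b';
  st_b2 : b + b' = 2;
  st_bU : unique U 2 b b';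
  st_bJ : jumps (minus U b b') b b' g g';
  st_g : g + g' = w + 5;
  st_Z : moved U D b b' g g'
}.

(** * Words starting with BBFFB *)

(** The back move crosses level w + 2 over (al + 1, be), so that piece has stayed and the first
    front move is a jump. A second front move by another piece would cross level w + 1 over (al,
    be), hence (al, be) did not go with the first one, which then landed on (al + 1, be + 1), and
    the second one started from (al, be - 1). But then both passages of the back move over (al + 1,
    be) are closed, by (al, be) and by (al + 1, be + 1). *)
Lemma path_FFB w' Y w al be :
  after_BB Y w al be -> path (LF :: LF :: LB :: w') Y 2 (w + 2) ->
  exists U D z z' t t' e e' b b' g g',
    stretched Y U D w al be z z' t t' e e' b b' g g' /\ path w' D 3 (w + 5).
Proof.
intros C H0. pose proof H0 as H.
apply path_F in H. destruct H as (Y1 & z & z' & t & t' & H1 & M1 & Yz & Lz & Lt & HF1).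
pose proof H1 as H. apply path_F in H.
destruct H as (U & y & y' & e & e' & H2 & M2 & Yy & Ly & Le & HF2).
pose proof H2 as H. apply path_B in H.
destruct H as (D & b & b' & g & g' & H3 & M3 & Ub & Lb & Ub2 & Lg & J).
replace (2 + 1) with 3 in H3 by lia. replace (w + 2 + 1 + 1 + 1) with (w + 5) in H3 by lia.
bb_levels C.
destruct (jumps_cross _ _ _ _ _ (w + 1) J) as (u & v & Hl & _ & _ & Hn & HX);
  [lia|exists x; lia|].
destruct Hn as [Hn|Hn]; [lia|].
assert (HX' : U (al + 1) be /\ ((u = al /\ v = be /\ ~ U (al + 2) be) \/
  (u = al + 1 /\ v = be - 1 /\ ~ U (al + 1) (be + 1)))).
{ destruct HX as [[F1 F2]|[F1 F2]]; pose proof F1 as F1'; back F1; try lia;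
   destruct (bb_uT1 _ _ _ _ C _ _ F1 ltac:(lia)) as [E1 E2].
  - rewrite E1, E2 in F1'. split; [auto|left].
    replace u with al in * by lia. replace v with be in * by lia. auto.
  - rewrite E1, E2 in F1'. split; [auto|right].
    replace u with (al + 1) in * by lia. replace v with (be - 1) in * by lia.
    replace (be - 1 + 2) with (be + 1) in * by lia. auto. }
destruct HX' as [UT1 HX'].
assert (NT1 : ~ (z = al + 1 /\ z' = be) /\ ~ (y = al + 1 /\ y' = be)).
{ split; intros [-> ->]; back UT1; lia. }
destruct NT1 as [NzT1 NyT1].
destruct HF1 as [[L1 _]|(L1 & [j1 P1] & J1)].
{ destruct (bb_uT1 _ _ _ _ C _ _ Yz L1). lia. }
assert (Pz : exists j, z + z' = 2 * j) by (exists (x + 2 - j1); lia).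
assert (Tt : ~ (z = al /\ z' = be) -> t = al + 1 /\ t' = be + 1).
{ intros NT. assert (R := jumps_sym (minus Y z z') z z' t t'
    (fun H => proj2 H (conj eq_refl eq_refl)) J1).
  destruct (jumps_first _ _ _ _ _ R) as (p & q & Ht & Hq).
  destruct Hq as [(->&->&[Hq _])|[(->&->&[Hq _])|[(->&->&[Hq _])|(->&->&[Hq _])]]];
    try (apply (path_range _ _ _ _ H0) in Hq; lia);
    destruct (bb_uT1 _ _ _ _ C _ _ Hq ltac:(lia)) as [E1 E2]; [|lia].
  exfalso. apply Ht. replace (t - 2) with al by lia. replace t' with be by lia.
  split; [apply C|lia]. }
assert (Ey : (y = t /\ y' = t') /\ ((e = t + 1 /\ e' = t') \/ (e = t /\ e' = t' + 1))).
{ destruct HF2 as [[L2 HF2']|(L2 & [j2 P2] & J2)].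
  - back Yy; [destruct Yy as [-> ->]; destruct HF2' as [[-> ->]|[-> ->]]; auto|].
    pose proof (path_range _ _ _ _ H0 _ _ Yy) as P. clear -P L2. lia.
  - exfalso.
    destruct (Z.eq_dec (y + y') (w + 2)) as [Ew|Nw].
    { back Yy; [lia|]. destruct (bb_uT1 _ _ _ _ C _ _ Yy ltac:(lia)). lia. }
    destruct Pz as [jz Pz].
    assert (Hy : z <> al \/ z' <> be -> y = al /\ y' = be - 1 ).
    { intros NT. destruct (jumps_cross _ _ _ _ _ w J2) as (p & q & Hpq & _ & _ & Hn2 & HX2);
        [lia|exists (j2 - 2); lia|].
      destruct HX2 as [[F1 F2]|[F1 F2]]; back F1; try lia;
      destruct (bb_uT _ _ _ _ C _ _ F1 ltac:(lia)) as [E1 E2].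
      - exfalso. apply F2. replace (p + 2) with (al + 1) by lia. replace q with be by lia.
        pose proof (bb_T1 _ _ _ _ C). fwd.
      - replace p with al in * by lia. replace q with (be - 1) in * by lia.
        destruct Hn2 as [Hn2|Hn2]; [lia|]. exfalso. apply Hn2.
        pose proof (bb_left _ _ _ _ C). fwd. }
    destruct (classic (z = al /\ z' = be)) as [[-> ->]|NT].
    + destruct (jumps_cross _ _ _ _ _ w J2) as (p & q & Hpq & _ & _ & Hn2 & HX2);
        [lia|exists (j2 - 2); lia|].
      destruct HX2 as [[F1 F2]|[F1 F2]]; back F1; try lia;
      destruct (bb_uT _ _ _ _ C _ _ F1 ltac:(lia)) as [E1 E2]; lia.
    + destruct (Tt NT) as [-> ->]. destruct (Hy ltac:(lia)) as [-> ->].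
      destruct HX' as [(-> & -> & _)|(-> & -> & HX')].
      * apply Hn. pose proof (bb_T _ _ _ _ C). fwd.
      * apply HX'. fwd. }
destruct Ey as [[-> ->] Ee].
exists U, D, z, z', t, t', e, e', b, b', g, g'. split; [|exact H3].
assert (TT : (z = al /\ z' = be) \/ (t = al + 1 /\ t' = be + 1)).
{ destruct (classic (z = al /\ z' = be)); [left; auto|right; apply Tt; auto]. }
clear Tt HX HX' Hn.
constructor; auto; try (clear TT; lia).
intros p q. rewrite (M2 p q), (M1 p q). split; [tauto|].
intros [E|[Hp Np]]; [auto|right]. split; [auto|]. intros [-> ->].
apply (path_range _ _ _ _ H0) in Hp. lia.
Qed.

Lemma stretched_up Y U D w al be z z' t t' e e' b b' g g' :
  stretched Y U D w al be z z' t t' e e' b b' g g' ->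
  forall u v, D u v -> (u = g /\ v = g') \/ (u = e /\ v = e') \/
    (Y u v /\ ~ (u = z /\ v = z') /\ ~ (u = b /\ v = b')).
Proof.
intros S u v Hd. apply (st_Z _ _ _ _ _ _ _ _ _ _ _ _ _ _ _ _ S) in Hd.
destruct Hd as [Hd|[Hd Nb]]; [auto|].
apply (st_U _ _ _ _ _ _ _ _ _ _ _ _ _ _ _ _ S) in Hd. tauto.
Qed.

Lemma stretched_lo Y U D w al be z z' t t' e e' b b' g g' :
  stretched Y U D w al be z z' t t' e e' b b' g g' ->
  forall u v, Y u v -> 3 <= u + v -> ~ (u = z /\ v = z') -> D u v.
Proof.
intros S u v Hy Hl Nz. apply (st_Z _ _ _ _ _ _ _ _ _ _ _ _ _ _ _ _ S).
right. split; [|pose proof (st_b2 _ _ _ _ _ _ _ _ _ _ _ _ _ _ _ _ S); lia].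
apply (st_U _ _ _ _ _ _ _ _ _ _ _ _ _ _ _ _ S). auto.
Qed.

Lemma stretched_hole w' Y U D w al be z z' t t' e e' b b' g g' :
  path w' Y 2 (w + 2) ->
  stretched Y U D w al be z z' t t' e e' b b' g g' ->
  forall u v, D u v -> u + v <> w + 3.
Proof.
intros H S u v Hd. pose proof (st_g _ _ _ _ _ _ _ _ _ _ _ _ _ _ _ _ S).
pose proof (st_e _ _ _ _ _ _ _ _ _ _ _ _ _ _ _ _ S).
pose proof (st_t _ _ _ _ _ _ _ _ _ _ _ _ _ _ _ _ S).
destruct (stretched_up _ _ _ _ _ _ _ _ _ _ _ _ _ _ _ _ S _ _ Hd) as [E|[E|[E _]]]; try lia.
apply (path_range _ _ _ _ H) in E. lia.
Qed.

Lemma hole_block V a b c d k :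
  (forall u v, V u v -> u + v <> k + 1) -> jumps (minus V a b) a b c d ->
  a + b <= k < c + d -> (exists j, k = a + b + 2 * j) -> False.
Proof.
intros N J Hk Hj. destruct (jumps_cross _ _ _ _ _ _ J Hk Hj) as (u & v & Hl & _ & _ & _ & HX).
destruct HX as [[HX _]|[HX _]]; apply N in HX; lia.
Qed.

Ltac st_levels S := let P := fresh "Ph" in
  pose proof (st_g _ _ _ _ _ _ _ _ _ _ _ _ _ _ _ _ S);
  pose proof (st_e _ _ _ _ _ _ _ _ _ _ _ _ _ _ _ _ S);
  pose proof (st_t _ _ _ _ _ _ _ _ _ _ _ _ _ _ _ _ S);
  pose proof (st_b2 _ _ _ _ _ _ _ _ _ _ _ _ _ _ _ _ S);
  pose proof (st_zw _ _ _ _ _ _ _ _ _ _ _ _ _ _ _ _ S);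
  destruct (st_zlev _ _ _ _ _ _ _ _ _ _ _ _ _ _ _ _ S) as [? P].

(** The last two front pieces land above level w + 3, which stays empty, and the last back piece,
    coming from the odd level 3, would have to hop over a piece there. *)
Lemma forbidden_BBFFBFFB : forbidden [LB; LB; LF; LF; LB; LF; LF; LB].
Proof.
apply forbidden_BB. intros Y w al be C H0. pose proof H0 as H.
destruct (path_FFB _ _ _ _ _ C H) as (U & D & z & z' & t & t' & e & e' & b & b' & g & g' & S & H1).
pose proof (stretched_hole _ _ _ _ _ _ _ _ _ _ _ _ _ _ _ _ _ H0 S) as Hole.
clear H. pose proof H1 as H. apply path_F in H.
destruct H as (D1 & y & y' & k & k' & H2 & M1 & _ & _ & L1 & _).
pose proof H2 as H. apply path_F in H.
destruct H as (D2 & i & i' & l & l' & H3 & M2 & _ & _ & L2 & _).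
apply path_B in H3.
destruct H3 as (D3 & p & p' & q & q' & _ & _ & _ & Lp & _ & Lq & J).
bb_levels C. apply (hole_block D2 p p' q q' (w + 2)); [|auto|lia|exists (x); lia].
intros u v Hu. back Hu; try lia. apply Hole in Hu. lia.
Qed.

Lemma stretched_solo w' Y U D w al be z z' t t' e e' b b' g g' p q :
  after_BB Y w al be -> path w' Y 2 (w + 2) ->
  stretched Y U D w al be z z' t t' e e' b b' g g' -> unique D 3 p q ->
  solo Y w al be /\ p = 2 /\ q = 1 /\ b = 1 /\ b' = 1 /\ ~ D 3 1 /\ ~ D 2 2.
Proof.
intros C H S U3. pose proof S as [Yz _ _ Jz _ _ _ HU Ub _ Ub2 Jb _ M].
st_levels S. bb_levels C.
assert (Ulo : forall u v, U u v -> 2 <= u + v).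
{ intros u v Hu. apply HU in Hu. destruct Hu as [Hu|[Hu _]]; [lia|].
  apply (path_range _ _ _ _ H) in Hu; lia. }
assert (U3Y : unique Y 3 p q).
{ intros u v Hu Hl. apply U3; [|auto]. apply (stretched_lo _ _ _ _ _ _ _ _ _ _ _ _ _ _ _ _ S); auto; lia. }
assert (UY : forall u v, U u v -> u + v <= w + 2 -> Y u v).
{ intros u v Hu Hl. apply HU in Hu. destruct Hu as [Hu|[Hu _]]; [lia|auto]. }
assert (Fb := jumps_first_up _ _ _ _ _ Jb ltac:(intros u v Hx; apply Ulo in Hx; lia)).
destruct (solo_rear Y w al be p q b b' z z' C U3Y) as (-> & -> & -> & -> & V).
- apply UY; [auto|lia].
- auto.
- destruct Fb as [[Fb _]|[Fb _]]; [left|right]; (apply UY; [auto|lia]).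
- intros _ Lz.
  assert (Fz := jumps_first_up _ _ _ _ _ Jz
     ltac:(intros u v Hx; apply (path_range _ _ _ _ H) in Hx; lia)). tauto.
- intros [-> ->]. apply HU in Ub. destruct Ub as [Ub|[_ Ub]]; [lia|auto].
- intros u v Hu Hl. destruct (classic (u = z /\ v = z')) as [|N]; [auto|left].
  apply Ub2; auto. apply HU; auto.
- assert (So : solo Y w al be) by (eapply solo_intro; eauto).
  pose proof (so_w _ _ _ _ So).
  split; [auto|]. do 4 (split; [auto|]). split.
  + intros D31. destruct Fb as [[_ Fb]|[Fb _]].
    * back D31; [lia|]. exact (Fb D31).
    * apply UY in Fb; [|lia]. destruct (bb_12 _ _ _ _ C Fb).
  + intros D22.
    destruct (stretched_up _ _ _ _ _ _ _ _ _ _ _ _ _ _ _ _ S _ _ D22) as [E|[E|[E _]]];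
      try lia. destruct (so_22 _ _ _ _ So E).
Qed.

Ltac st_split S H := destruct (stretched_up _ _ _ _ _ _ _ _ _ _ _ _ _ _ _ _ S _ _ H)
  as [?|[?|[HD [? ?]]]]; try lia.

(** The neutral move must fill level w + 3. Its piece comes from an even level or from next to the
    gap, never from level 3, which is thus (2, 1) alone; with (3, 1) and (2, 2) empty that piece
    cannot hop. *)
Lemma forbidden_BBFFBNB : forbidden [LB; LB; LF; LF; LB; LN; LB].
Proof.
apply forbidden_BB. intros Y w al be C H0. pose proof H0 as H.
destruct (path_FFB _ _ _ _ _ C H) as (U & D & z & z' & t & t' & e & e' & b & b' & g & g' & S & H1).
pose proof (stretched_hole _ _ _ _ _ _ _ _ _ _ _ _ _ _ _ _ _ H0 S) as Hole.
clear H. pose proof H1 as H. apply path_N in H.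
destruct H as (V & n & n' & k & k' & H2 & M1 & Dn & _ & HM).
pose proof H2 as H. apply path_B in H.
destruct H as (_ & p & p' & q & q' & _ & _ & Vp & Lp & U3 & Lq & J).
bb_levels C.
assert (Lk : k + k' = w + 3).
{ apply NNPP; intros N. apply (hole_block V p p' q q' (w + 2)); [|auto|lia|exists x; lia].
  intros u v Hu. back Hu; [lia|]. apply Hole in Hu. lia. }
assert (Ln : n + n' <> 3).
{ unfold adjacent in HM. destruct HM as [HM|([i Hi] & [j Hj] & _)]; lia. }
assert (U3D : unique D 3 p p').
{ intros u v Hu Hl. apply U3; [fwd|auto]. }
destruct (stretched_solo _ _ _ _ _ _ _ _ _ _ _ _ _ _ _ _ _ _ _ C H0 S U3D)
  as (So & -> & -> & _ & _ & N31 & N22).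
pose proof (so_w _ _ _ _ So).
destruct (jumps_first_up _ _ _ _ _ J) as [[F _]|[F _]].
- intros u v Hu; apply (path_range _ _ _ _ H2) in Hu; lia.
- back F; [lia|contradiction].
- back F; [lia|contradiction].
Qed.

(* The rear piece can only shift, so level 4 stays crowded unless the piece at
   (1,3) was the one sent to the front; it then left over (2,3). *)
Lemma stretched_R w' Y U D V W w al be z z' t t' e e' b b' g g' p q m n :
  after_BB Y w al be -> path w' Y 2 (w + 2) ->
  stretched Y U D w al be z z' t t' e e' b b' g g' ->
  (forall u v, V u v -> 3 <= u + v) ->
  (forall u v, u + v <= w + 3 -> (V u v <-> D u v)) ->
  V p q -> p + q = 3 -> unique V 3 p q ->
  moved V W p q m n -> ~ V m n ->
  ((m + n = 4 /\ ((m = p + 1 /\ n = q) \/ (m = p /\ n = q + 1))) \/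
   jumps (minus V p q) p q m n) ->
  solo Y w al be /\ m + n = 4 /\ ~ (m = 1 /\ n = 3) /\
  (forall W', (exists i j, unique W' 4 i j) -> (forall u v, u + v = 4 -> W u v -> W' u v) ->
   z = 1 /\ z' = 3 /\ ((m = 3 /\ n = 1) \/ (m = 2 /\ n = 2)) /\
   D 2 3 /\ (D 4 1 \/ D 3 2)).
Proof.
intros C H S Vlo VD Vp Lp U3 M Nm HM. bb_levels C. st_levels S.
assert (U3D : unique D 3 p q).
{ intros u v Hu Hl. apply U3; [apply VD; [lia|auto]|auto]. }
destruct (stretched_solo _ _ _ _ _ _ _ _ _ _ _ _ _ _ _ _ _ _ _ C H S U3D)
  as (So & -> & -> & -> & -> & N31 & N22).
pose proof (so_w _ _ _ _ So).
assert (Em : m + n = 4 /\ ((m = 3 /\ n = 1) \/ (m = 2 /\ n = 2))).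
{ destruct HM as [HM|J]; [lia|exfalso].
  destruct (jumps_first_up _ _ _ _ _ J) as [[F _]|[F _]].
  - intros u v Hu; apply Vlo in Hu; lia.
  - apply VD in F; [contradiction|lia].
  - apply VD in F; [contradiction|lia]. }
destruct Em as [L4 Em].
split; [auto|split; [auto|split; [lia|]]].
intros W' (i & j & U4) HW.
assert (Ez : z = 1 /\ z' = 3).
{ apply NNPP; intros N. pose proof (so_13 _ _ _ _ So) as Y13.
  assert (D13 : D 1 3) by
    (apply (stretched_lo _ _ _ _ _ _ _ _ _ _ _ _ _ _ _ _ S); auto; lia).
  assert (W13 : W 1 3) by (apply M; right; split; [apply VD; [lia|auto]|lia]).
  assert (Wm : W m n) by (apply M; auto).
  apply HW in W13; [|lia]. apply HW in Wm; [|lia].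
  destruct (U4 _ _ W13 eq_refl), (U4 _ _ Wm L4). lia. }
destruct Ez as [-> ->]. do 3 (split; [auto|]).
pose proof (so_U3 _ _ _ _ So) as U3Y.
assert (DY : forall u v, Y u v -> u + v = 5 -> D u v).
{ intros u v Hu Hl. apply (stretched_lo _ _ _ _ _ _ _ _ _ _ _ _ _ _ _ _ S); auto; lia. }
split.
- apply DY; [|lia].
  destruct (jumps_first _ _ _ _ _ (st_J _ _ _ _ _ _ _ _ _ _ _ _ _ _ _ _ S)) as (u & v & Ht & Hh).
  destruct Hh as [(->&->&[Hh _])|[(->&->&[Hh _])|[(->&->&[Hh _])|(->&->&[Hh _])]]];
  cbn in Hh; try (apply U3Y in Hh; lia); auto.
  destruct (so_14 _ _ _ _ So Hh).
- assert (UY : forall u v, U u v -> u + v <= w + 2 -> Y u v).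
  { intros u v Hu Hl. apply (st_U _ _ _ _ _ _ _ _ _ _ _ _ _ _ _ _ S) in Hu.
    destruct Hu as [Hu|[Hu _]]; [lia|auto]. }
  destruct (jumps_exit (fun u v => (u = 1 /\ v = 1) \/ (u = 3 /\ v = 1))
      _ _ _ _ _ ltac:(cbv beta; intros; lia) (st_bJ _ _ _ _ _ _ _ _ _ _ _ _ _ _ _ _ S))
      as (u & v & u' & v' & P1 & P2 & P3 & _);
      cbv beta in *; try lia.
  destruct P3 as [Pt P3]. unfold minus in P3.
  destruct P3 as [(->&->&P3 & _)|[(->&->&P3&_)|[(->&->&P3&_)|(->&->&P3&_)]]];
  destruct P1 as [[-> ->]|[-> ->]]; cbn in P3, P2; try lia;
    apply UY in P3; try lia; auto;
    try (pose proof (path_range _ _ _ _ H _ _ P3); lia);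
    try (apply U3Y in P3; lia).
Qed.

(** Level w + 6 is odd, and a jump to it from below the gap at w + 3 would need an obstacle in the
    gap. *)
Lemma stretched_F (V : config) (w y y' k k' x : Z) :
  (forall u v, V u v -> u + v <> w + 3) -> w = 2 * x + 1 -> k + k' = w + 5 + 1 ->
  ((y + y' = w + 5 /\ ((k = y + 1 /\ k' = y') \/ (k = y /\ k' = y' + 1))) \/
   (y + y' <= w + 5 - 1 /\ (exists j, w + 5 + 1 = y + y' + 2 * j) /\
     jumps (minus V y y') y y' k k')) ->
  w + 4 <= y + y'.
Proof.
intros Hole Hx Lk [[HF _]|(HF & [j Hj] & J)]; [lia|].
destruct (Z_le_gt_dec (w + 4) (y + y')) as [|G]; [auto|exfalso].
apply (hole_block V y y' k k' (w + 2)); [|auto|lia|exists (j - 2); lia].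
intros u v Hu. apply Hole in Hu. lia.
Qed.

(** Two pieces hold the rear at level 5, and the gap at w + 3 prevents a front move from taking one
    of them. *)
Definition crowded (w : Z) (V : config) : Prop :=
  5 <= w /\ (exists x, w = 2 * x + 1) /\
  (forall u v, V u v -> u + v <> w + 3) /\ V 2 3 /\ (V 4 1 \/ V 3 2).

Lemma crowded_unique (V : config) p q : V 2 3 /\ (V 4 1 \/ V 3 2) -> ~ unique V 5 p q.
Proof.
intros (H1 & H2) U. destruct (U _ _ H1 eq_refl) as [<- <-].
destruct H2 as [H2|H2]; apply U in H2; lia.
Qed.

Lemma path_crowded x w' w V f : crowded w V -> x = LB \/ x = LR -> ~ path (x :: w') V 5 f.
Proof.
intros (_ & _ & _ & Hc) Hx H. destruct (path_unique _ _ _ _ _ H Hx) as (a & b & _ & _ & U).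
exact (crowded_unique V a b Hc U).
Qed.

Lemma path_F_crowded w' w V f : crowded w V -> w + 5 <= f -> path (LF :: w') V 5 f ->
  exists V', crowded w V' /\ path w' V' 5 (f + 1).
Proof.
intros (Hw & [x Hx] & Hole & H1 & H2) Hf H. apply path_F in H.
destruct H as (V' & y & y' & k & k' & H & M & Vy & Ly & Lk & HF).
exists V'. split; [|auto].
assert (Ny : y + y' <> 5).
{ destruct HF as [[HF _]|(HF & [j Hj] & J)]; [lia|]. intros E.
  apply (hole_block V y y' k k' (w + 2)); [|auto|lia|exists (x - 1); lia].
  intros u v Hu. apply Hole in Hu. lia. }
split; [auto|split; [eauto|split; [|split]]].
- intros u v Hu. back Hu; [lia|auto].
- fwd.
- destruct H2 as [H2|H2]; [left|right]; fwd.
Qed.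

(** In both orders the rear move is the shift of [stretched_R], and the front piece starts above the
    gap. The next back move needs level 4 thinned out, which is the last hypothesis of
    [stretched_R]. *)
Lemma path_FFB_crowded x y w' Y w al be :
  (x = LF /\ y = LR) \/ (x = LR /\ y = LF) ->
  after_BB Y w al be -> path (LF :: LF :: LB :: x :: y :: LB :: w') Y 2 (w + 2) ->
  exists V, crowded w V /\ path w' V 5 (w + 7).
Proof.
intros Hxy C H0. pose proof H0 as H.
destruct (path_FFB _ _ _ _ _ C H) as (U & D & z & z' & t & t' & e & e' & b & b' & g & g' & S & H1).
pose proof (stretched_hole _ _ _ _ _ _ _ _ _ _ _ _ _ _ _ _ _ H0 S) as Hole.
clear H. destruct Hxy as [[-> ->]|[-> ->]].
- pose proof H1 as H. apply path_F in H.
  destruct H as (D1 & y & y' & k & k' & H2 & M1 & Dy & _ & Lk & HF).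
  pose proof H2 as H. apply path_R in H.
  destruct H as (D2 & p & q & m & n & H3 & M2 & Dp & Lp & U3 & Lm & Nm & HM).
  pose proof H3 as H. apply path_B in H.
  destruct H as (D3 & i & i' & l & l' & H4 & M3 & D2i & Li & U4 & Ll & J).
  bb_levels C. pose proof (stretched_F _ _ _ _ _ _ _ Hole ltac:(eassumption) Lk HF) as Ly.
  destruct (stretched_R _ Y U D D1 D2 w al be z z' t t' e e' b b' g g' p q m n C H0 S)
    as (So & L4 & Nm' & HW); auto.
  + intros u v Hu. apply (path_range _ _ _ _ H2) in Hu. lia.
  + intros u v Hl. split; intros Hu; [back Hu; auto; lia|fwd].
  + destruct HM as [HM|(_ & _ & _ & HM)]; [left; lia|auto].
  + destruct (HW D2) as (-> & -> & Em & D23 & D5); [eauto|auto|].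
    pose proof (so_w _ _ _ _ So).
    exists D3. split; [|replace (w + 7) with (w + 5 + 1 + 1) by lia; replace 5 with (3 + 1 + 1) by lia; auto].
    split; [auto|split; [eauto|split; [|split]]].
    * intros u v Hu. back Hu; try lia. auto.
    * fwd.
    * destruct D5 as [D5|D5]; [left|right]; fwd.
- pose proof H1 as H. apply path_R in H.
  destruct H as (D1 & p & q & m & n & H2 & M1 & Dp & Lp & U3 & Lm & Nm & HM).
  pose proof H2 as H. apply path_F in H.
  destruct H as (D2 & y & y' & k & k' & H3 & M2 & Dy & _ & Lk & HF).
  pose proof H3 as H. apply path_B in H.
  destruct H as (D3 & i & i' & l & l' & H4 & M3 & D2i & Li & U4 & Ll & J).
  bb_levels C.
  destruct (stretched_R _ Y U D D D1 w al be z z' t t' e e' b b' g g' p q m n C H0 S)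
    as (So & L4 & Nm' & HW); auto.
  + intros u v Hu. apply (path_range _ _ _ _ H1) in Hu. lia.
  + tauto.
  + destruct HM as [HM|(_ & _ & _ & HM)]; [left; lia|auto].
  + pose proof (so_w _ _ _ _ So).
    assert (Hole1 : forall u v, D1 u v -> u + v <> w + 3).
    { intros u v Hu. back Hu; [lia|auto]. }
    pose proof (stretched_F _ _ _ _ _ _ _ Hole1 ltac:(eassumption) Lk HF) as Ly.
    destruct (HW D2) as (-> & -> & Em & D23 & D5).
    { exists i, i'; auto. }
    { intros u v Hl Hu. fwd. }
    exists D3. split; [|replace (w + 7) with (w + 5 + 1 + 1) by lia; replace 5 with (3 + 1 + 1) by lia; auto].
    split; [auto|split; [eauto|split; [|split]]].
    * intros u v Hu. back Hu; try lia. auto.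
    * fwd.
    * destruct D5 as [D5|D5]; [left|right]; fwd.
Qed.

Lemma forbidden_crowded x y w :
  (x = LF /\ y = LR) \/ (x = LR /\ y = LF) ->
  In w [[LR]; [LF; LR]; [LF; LF; LB]; [LN; LB]] ->
  forbidden (LB :: LB :: LF :: LF :: LB :: x :: y :: LB :: w).
Proof.
intros Hxy Hw. apply forbidden_BB. intros Y w0 al be C H0.
destruct (path_FFB_crowded _ _ _ _ _ _ _ Hxy C H0) as (V & HV & H).
assert (G : 5 <= w0) by apply HV.
destruct Hw as [<-|[<-|[<-|[<-|[]]]]].
- exact (path_crowded LR _ _ _ _ HV (or_intror eq_refl) H).
- apply (path_F_crowded _ w0) in H; [|auto|lia]. destruct H as (V1 & HV1 & H).
  exact (path_crowded LR _ _ _ _ HV1 (or_intror eq_refl) H).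
- apply (path_F_crowded _ w0) in H; [|auto|lia]. destruct H as (V1 & HV1 & H).
  apply (path_F_crowded _ w0) in H; [|auto|lia]. destruct H as (V2 & HV2 & H).
  exact (path_crowded LB _ _ _ _ HV2 (or_introl eq_refl) H).
- destruct HV as (_ & [j Hj] & Hole & V23 & V5).
  apply path_N in H. destruct H as (V1 & n & n' & k & k' & H & M & Vn & _ & HM).
  apply path_B in H. destruct H as (V2 & p & p' & q & q' & _ & _ & Vp & Lp & U & Lq & J).
  (* The neutral move has to fill the gap; its piece is from an even level or from next to the gap,
     so level 5 stays crowded. *)
  assert (Lk : k + k' = w0 + 3).
  { apply NNPP; intros N.
    apply (hole_block V1 p p' q q' (w0 + 2)); [|auto|lia|exists (j - 1); lia].
    intros u v Hu. back Hu; [lia|]. apply Hole in Hu. lia. }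
  assert (Ln : n + n' <> 5).
  { unfold adjacent in HM. destruct HM as [HM|([i Hi] & [i' Hj'] & _)]; lia. }
  apply (crowded_unique V1 p p'); [|auto]. split; [fwd|].
  destruct V5; [left|right]; fwd.
Qed.

(** The second rear move already needs level 4 to be a single piece, so level 5 is crowded when [x]
    has to raise the rear. *)
Lemma forbidden_BBFFBRR x : x = LB \/ x = LR ->
  forbidden [LB; LB; LF; LF; LB; LR; LR; x].
Proof.
intros Hx. apply forbidden_BB. intros Y w al be C H0. pose proof H0 as H.
destruct (path_FFB _ _ _ _ _ C H) as (U & D & z & z' & t & t' & e & e' & b & b' & g & g' & S & H1).
clear H. pose proof H1 as H. apply path_R in H.
destruct H as (D1 & p & q & m & n & H2 & M1 & Dp & Lp & U3 & Lm & Nm & HM).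
pose proof H2 as H. apply path_R in H.
destruct H as (D2 & i & i' & l & l' & H3 & M2 & D2i & Li & U4 & Ll & _ & J).
destruct (path_unique _ _ _ _ _ H3 Hx) as (j & j' & _ & _ & U5).
destruct (stretched_R _ Y U D D D1 w al be z z' t t' e e' b b' g g' p q m n C H0 S)
    as (So & L4 & Nm' & HW); auto.
- intros u v Hu. apply (path_range _ _ _ _ H1) in Hu. lia.
- tauto.
- destruct HM as [HM|(_ & _ & _ & HM)]; [left; lia|auto].
- destruct (HW D1) as (-> & -> & Em & D23 & D5); [eauto|auto|].
  apply (crowded_unique D2 j j'); [|auto]. split; [fwd|].
  destruct D5; [left|right]; fwd.
Qed.

Lemma forbidden_BBFFBFRRR : forbidden [LB; LB; LF; LF; LB; LF; LR; LR; LR].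
Proof.
apply forbidden_BB. intros Y w al be C H0. pose proof H0 as H.
destruct (path_FFB _ _ _ _ _ C H) as (U & D & z & z' & t & t' & e & e' & b & b' & g & g' & S & H1).
pose proof (stretched_hole _ _ _ _ _ _ _ _ _ _ _ _ _ _ _ _ _ H0 S) as Hole.
clear H. pose proof H1 as H. apply path_F in H.
destruct H as (D1 & y & y' & k & k' & H2 & M1 & Dy & _ & Lk & HF).
pose proof H2 as H. apply path_R in H.
destruct H as (D2 & p & q & m & n & H3 & M2 & Dp & Lp & U3 & Lm & Nm & HM).
pose proof H3 as H. apply path_R in H.
destruct H as (D3 & i & i' & l & l' & H4 & M3 & D2i & Li & U4 & Ll & _ & J).
destruct (path_unique LR _ _ _ _ H4 (or_intror eq_refl)) as (j & j' & _ & _ & U5).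
bb_levels C. pose proof (stretched_F _ _ _ _ _ _ _ Hole ltac:(eassumption) Lk HF) as Ly.
destruct (stretched_R _ Y U D D1 D2 w al be z z' t t' e e' b b' g g' p q m n C H0 S)
    as (So & L4 & Nm' & HW); auto.
- intros u v Hu. apply (path_range _ _ _ _ H2) in Hu. lia.
- intros u v Hl. split; intros Hu; [back Hu; auto; lia|fwd].
- destruct HM as [HM|(_ & _ & _ & HM)]; [left; lia|auto].
- destruct (HW D2) as (-> & -> & Em & D23 & D5); [eauto|auto|].
  pose proof (so_w _ _ _ _ So).
  apply (crowded_unique D3 j j'); [|auto]. split; [fwd|].
  destruct D5; [left|right]; fwd.
Qed.

Lemma forbidden_BBFFBRFRR : forbidden [LB; LB; LF; LF; LB; LR; LF; LR; LR].
Proof.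
apply forbidden_BB. intros Y w al be C H0. pose proof H0 as H.
destruct (path_FFB _ _ _ _ _ C H) as (U & D & z & z' & t & t' & e & e' & b & b' & g & g' & S & H1).
pose proof (stretched_hole _ _ _ _ _ _ _ _ _ _ _ _ _ _ _ _ _ H0 S) as Hole.
clear H. pose proof H1 as H. apply path_R in H.
destruct H as (D1 & p & q & m & n & H2 & M1 & Dp & Lp & U3 & Lm & Nm & HM).
pose proof H2 as H. apply path_F in H.
destruct H as (D2 & y & y' & k & k' & H3 & M2 & Dy & _ & Lk & HF).
pose proof H3 as H. apply path_R in H.
destruct H as (D3 & i & i' & l & l' & H4 & M3 & D2i & Li & U4 & Ll & _ & J).
destruct (path_unique LR _ _ _ _ H4 (or_intror eq_refl)) as (j & j' & _ & _ & U5).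
bb_levels C.
destruct (stretched_R _ Y U D D D1 w al be z z' t t' e e' b b' g g' p q m n C H0 S)
    as (So & L4 & Nm' & HW); auto.
- intros u v Hu. apply (path_range _ _ _ _ H1) in Hu. lia.
- tauto.
- destruct HM as [HM|(_ & _ & _ & HM)]; [left; lia|auto].
- pose proof (so_w _ _ _ _ So).
  assert (Hole1 : forall u v, D1 u v -> u + v <> w + 3).
  { intros u v Hu. back Hu; [lia|auto]. }
  pose proof (stretched_F _ _ _ _ _ _ _ Hole1 ltac:(eassumption) Lk HF) as Ly.
  destruct (HW D2) as (-> & -> & Em & D23 & D5).
  { exists i, i'; auto. }
  { intros u v Hl Hu. fwd. }
  apply (crowded_unique D3 j j'); [|auto]. split; [fwd|].
  destruct D5; [left|right]; fwd.
Qed.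

(** The last front move has to take a piece off the crowded level 5 and carry it across the gap,
    which only the second rear piece can have filled. To pass over (al, be) it has to start from
    (al, be - 1), and the pieces beyond the gap stop it. *)
Lemma forbidden_BBFFBRRFR : forbidden [LB; LB; LF; LF; LB; LR; LR; LF; LR].
Proof.
apply forbidden_BB. intros Y w al be C H0. pose proof H0 as H.
destruct (path_FFB _ _ _ _ _ C H) as (U & D & z & z' & t & t' & e & e' & b & b' & g & g' & S & H1).
pose proof (stretched_hole _ _ _ _ _ _ _ _ _ _ _ _ _ _ _ _ _ H0 S) as Hole.
clear H. pose proof H1 as H. apply path_R in H.
destruct H as (D1 & p & q & m & n & H2 & M1 & Dp & Lp & U3 & Lm & Nm & HM).
pose proof H2 as H. apply path_R in H.
destruct H as (D2 & i & i' & l & l' & H3 & M2 & D2i & Li & U4 & Ll & _ & J2).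
pose proof H3 as H. apply path_F in H.
destruct H as (D3 & y & y' & k & k' & H4 & M3 & Dy & _ & Lk & HF).
destruct (path_unique LR _ _ _ _ H4 (or_intror eq_refl)) as (j & j' & _ & _ & U5).
destruct (stretched_R _ Y U D D D1 w al be z z' t t' e e' b b' g g' p q m n C H0 S)
    as (So & L4 & Nm' & HW); auto.
{ intros u v Hu. apply (path_range _ _ _ _ H1) in Hu. lia. }
{ tauto. }
{ destruct HM as [HM|(_ & _ & _ & HM)]; [left; lia|auto]. }
destruct (HW D1) as (-> & -> & Em & D23 & D5); [eauto|auto|]. clear HW HM Nm'.
pose proof (so_w _ _ _ _ So) as Hw. bb_levels C.
assert (Lg : g + g' = w + 5) by apply (st_g _ _ _ _ _ _ _ _ _ _ _ _ _ _ _ _ S).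
assert (Lt : t + t' = w + 3) by apply (st_t _ _ _ _ _ _ _ _ _ _ _ _ _ _ _ _ S).
assert (Lb : b + b' = 2) by apply (st_b2 _ _ _ _ _ _ _ _ _ _ _ _ _ _ _ _ S).
assert (Le : e + e' = w + 4).
{ pose proof (st_e _ _ _ _ _ _ _ _ _ _ _ _ _ _ _ _ S). lia. }
clear Em.
destruct (U4 m n ltac:(fwd) ltac:(lia)) as [<- <-].
assert (Et : t = al + 1 /\ t' = be + 1).
{ destruct (st_tT _ _ _ _ _ _ _ _ _ _ _ _ _ _ _ _ S); [lia|auto]. }
destruct Et as [-> ->].
assert (Ly : y + y' = 5).
{ apply NNPP; intros N. apply (crowded_unique D3 j j'); [|auto].
  split; [fwd|]. destruct D5; [left|right]; fwd. }
destruct HF as [[HF _]|(_ & _ & J)]; [lia|].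
assert (Ll' : l + l' = w + 3).
{ apply NNPP; intros N. apply (hole_block D2 y y' k k' (w + 2)); [|auto|lia|].
  - intros u v Hu. back Hu; [lia|lia|]. apply Hole in Hu. lia.
  - exists (x - 1). lia. }
assert (DT : D2 al be).
{ pose proof (stretched_lo _ _ _ _ _ _ _ _ _ _ _ _ _ _ _ _ S _ _ (bb_T _ _ _ _ C) ltac:(lia) ltac:(lia)). fwd. }
assert (DT1 : D2 (al + 1) be).
{ pose proof (stretched_lo _ _ _ _ _ _ _ _ _ _ _ _ _ _ _ _ S _ _ (bb_T1 _ _ _ _ C) ltac:(lia) ltac:(lia)). fwd. }
assert (DL : D2 al (be - 1)).
{ pose proof (stretched_lo _ _ _ _ _ _ _ _ _ _ _ _ _ _ _ _ S _ _ (bb_left _ _ _ _ C) ltac:(lia) ltac:(lia)). fwd. }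
assert (D1T : D1 al be).
{ pose proof (stretched_lo _ _ _ _ _ _ _ _ _ _ _ _ _ _ _ _ S _ _ (bb_T _ _ _ _ C) ltac:(lia) ltac:(lia)). fwd. }
assert (W1 : forall u v, D2 u v -> u + v = w + 1 -> u = al /\ v = be).
{ intros u v Hu Hl. back Hu; try lia. st_split S Hu. apply (bb_uT _ _ _ _ C); auto. }
assert (W2 : forall u v, D1 u v -> u + v = w + 2 -> u = al + 1 /\ v = be).
{ intros u v Hu Hl. back Hu; try lia. st_split S Hu. apply (bb_uT1 _ _ _ _ C); auto. }
assert (W4 : forall u v, D1 u v -> u + v = w + 4 -> u = e /\ v = e').
{ intros u v Hu Hl. back Hu; try lia. st_split S Hu.
  pose proof (path_range _ _ _ _ H0 _ _ HD). lia. }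
assert (W3 : forall u v, D2 u v -> u + v = w + 3 -> u = l /\ v = l').
{ intros u v Hu Hl. back Hu; try lia. apply Hole in Hu. lia. }
assert (W5 : forall u v, D2 u v -> u + v = w + 5 -> u = g /\ v = g').
{ intros u v Hu Hl. back Hu; try lia. st_split S Hu.
  pose proof (path_range _ _ _ _ H0 _ _ HD). lia. }
assert (De : D2 e e').
{ assert (De : D e e').
  { apply (st_Z _ _ _ _ _ _ _ _ _ _ _ _ _ _ _ _ S). right. split; [|lia].
    apply (st_U _ _ _ _ _ _ _ _ _ _ _ _ _ _ _ _ S). auto. }
  fwd. }
clear D5 D23 Ll Lm.
destruct (jumps_parity _ _ _ _ _ (st_bJ _ _ _ _ _ _ _ _ _ _ _ _ _ _ _ _ S)) as [[ig Pg] [jg Pg']].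
destruct (stretched_solo _ _ _ _ _ _ _ _ _ _ _ _ _ _ _ _ _ _ _ C H0 S U3)
  as (_ & _ & _ & -> & -> & _).
assert (J2' : jumps (minus D1 m n) m n l l').
{ destruct J2 as [[J2 _]|(_ & _ & _ & J2)]; [lia|auto]. }
clear J2. destruct (jumps_parity _ _ _ _ _ J2') as [[il Pl] [jl Pl']].
(* the piece coming from (m,n) passes next to [T] and stops on the old cell of [t] *)
assert (Pm : exists i, m = al + 1 + 2 * i).
{ destruct (jumps_cross _ _ _ _ _ (w + 1) J2') as (u & v & Hl & [iu Hu] & _ & Hn & HX);
    [lia|exists (x - 1); lia|].
  destruct HX as [[F _]|[F _]]; destruct (W2 _ _ F ltac:(lia)) as [E1 E2].
  - exfalso. replace u with al in * by lia. replace v with be in * by lia.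
    destruct Hn as [Hn|Hn]; [lia|auto].
  - exists (- iu). lia. }
destruct Pm as [im Pm].
pose proof (st_e _ _ _ _ _ _ _ _ _ _ _ _ _ _ _ _ S) as He.
assert (El : l = al + 1 /\ l' = be + 1).
{ assert (R := jumps_sym (minus D1 m n) m n l l' (fun H => proj2 H (conj eq_refl eq_refl)) J2').
  destruct (jumps_first _ _ _ _ _ R) as (u & v & Ht & Hq).
  destruct Hq as [(->&->&[Hq _])|[(->&->&[Hq _])|[(->&->&[Hq _])|(->&->&[Hq _])]]].
  - destruct (W4 _ _ Hq ltac:(lia)). lia.
  - destruct (W2 _ _ Hq ltac:(lia)). lia.
  - destruct (W4 _ _ Hq ltac:(lia)). lia.
  - destruct (W2 _ _ Hq ltac:(lia)). lia. }
destruct El as [-> ->].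
assert (Ey : forall u v, u + v = w -> (exists i, u = y + 2 * i) ->
  (exists j, v = y' + 2 * j) -> ((u = y /\ v = y') \/ ~ D2 u v) ->
  ~ (D2 (u + 1) v /\ ~ D2 (u + 2) v)).
{ intros u v Hl Pu Pv Hn [F1 F2]. destruct (W1 _ _ F1 ltac:(lia)) as [E1 E2].
  apply F2. replace (u + 2) with (al + 1) by lia. replace v with be by lia. auto. }
assert (Ep : y = al /\ y' = be - 1).
{ destruct (jumps_cross _ _ _ _ _ w J) as (u & v & Hl & Pu & Pv & Hn & [HX|[F1 F2]]);
    [lia|exists (x - 2); lia|exfalso; exact (Ey u v Hl Pu Pv Hn HX)|].
  destruct (W1 _ _ F1 ltac:(lia)) as [E1 E2].
  replace u with al in * by lia. replace v with (be - 1) in * by lia.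
  destruct Hn as [Hn|Hn]; [lia|contradiction]. }
destruct Ep as [-> ->].
assert (Dn : forall u v, u + v <> w -> ~ minus D2 al (be - 1) u v -> ~ D2 u v).
{ intros u v Hl Hn Hd. apply Hn. split; [auto|lia]. }
(* After (al, be + 1) the only obstacle is (al + 1, be + 1). In the first case the cell behind it is
   occupied; in the second that cell, (al + 2, be + 1), is a dead end, level w + 5 holding only (al
   + 1, be + 3). *)
destruct He as [[-> ->]|[-> ->]].
- destruct (jumps_exit (fun u v => u + v <= w \/ (u = al /\ v = be + 1))
    _ _ _ _ _ ltac:(cbv beta; intros; lia) J) as (u & v & u' & v' & P1 & P2 & P3 & [iu Pu] & [jv Pv] & Hn);
    cbv beta in *; try lia.
  destruct P3 as [Pt P3]. apply Dn in Pt; [|lia].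
  destruct P1 as [P1|[-> ->]].
  + assert (Hl : u + v = w) by (destruct P3 as [P3|[P3|[P3|P3]]]; lia).
    destruct P3 as [(->&->&[P3 _])|[(->&->&[P3 _])|[(->&->&[P3 _])|(->&->&[P3 _])]]]; try lia.
    * destruct (W1 _ _ P3 ltac:(lia)). lia.
    * destruct (W1 _ _ P3 ltac:(lia)). lia.
  + destruct P3 as [(->&->&[P3 _])|[(->&->&[P3 _])|[(->&->&[P3 _])|(->&->&[P3 _])]]]; try lia.
    * apply Pt. replace (al + 2) with (al + 1 + 1) by lia. auto.
    * destruct (W3 _ _ P3 ltac:(lia)). lia.
- assert (Eg : g = al + 1 /\ g' = be + 3).
  { assert (R := jumps_sym (minus U 1 1) 1 1 g g' (fun H => proj2 H (conj eq_refl eq_refl))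
      (st_bJ _ _ _ _ _ _ _ _ _ _ _ _ _ _ _ _ S)).
    assert (UE : forall u v, U u v -> w + 2 < u + v -> u = al + 1 /\ v = be + 2).
    { intros u v Hu Hl. apply (st_U _ _ _ _ _ _ _ _ _ _ _ _ _ _ _ _ S) in Hu.
      destruct Hu as [Hu|[Hu _]]; [lia|].
      pose proof (path_range _ _ _ _ H0 _ _ Hu). lia. }
    destruct (jumps_first _ _ _ _ _ R) as (u & v & Ht & Hq).
    destruct Hq as [(->&->&[Hq _])|[(->&->&[Hq _])|[(->&->&[Hq _])|(->&->&[Hq _])]]];
     destruct (UE _ _ Hq ltac:(lia)); lia. }
  destruct Eg as [-> ->].
  destruct (jumps_exit (fun u v => u + v <= w \/ (u = al /\ v = be + 1) \/ (u = al + 2 /\ v = be + 1))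
    _ _ _ _ _ ltac:(cbv beta; intros; lia) J) as (u & v & u' & v' & P1 & P2 & P3 & [iu Pu] & [jv Pv] & Hn);
    cbv beta in *; try lia.
  destruct P3 as [Pt P3].
  destruct P1 as [P1|[[-> ->]|[-> ->]]].
  + assert (Hl : u + v = w) by (destruct P3 as [P3|[P3|[P3|P3]]]; lia).
    destruct P3 as [(->&->&[P3 _])|[(->&->&[P3 _])|[(->&->&[P3 _])|(->&->&[P3 _])]]]; try lia.
    * destruct (W1 _ _ P3 ltac:(lia)). lia.
    * destruct (W1 _ _ P3 ltac:(lia)). lia.
  + destruct P3 as [(->&->&[P3 _])|[(->&->&[P3 _])|[(->&->&[P3 _])|(->&->&[P3 _])]]]; try lia.
    destruct (W3 _ _ P3 ltac:(lia)). lia.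
  + destruct P3 as [(->&->&[P3 _])|[(->&->&[P3 _])|[(->&->&[P3 _])|(->&->&[P3 _])]]]; try lia.
    * destruct (W5 _ _ P3 ltac:(lia)). lia.
    * destruct (W5 _ _ P3 ltac:(lia)). lia.
    * destruct (W3 _ _ P3 ltac:(lia)). lia.
Qed.

(* The three pieces at the front block every piece below them. *)
Lemma after_BBB_F_level3 X w al be z z' t t' :
  after_BBB X w al be -> X z z' -> z + z' = 3 -> t + t' = w + 3 + 1 ->
  ((z + z' = w + 3 /\ ((t = z + 1 /\ t' = z') \/ (t = z /\ t' = z' + 1))) \/
   (z + z' <= w + 3 - 1 /\ (exists j, w + 3 + 1 = z + z' + 2 * j) /\
     jumps (minus X z z') z z' t t')) ->
  z = al /\ z' = be - 1 /\ w = 3.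
Proof.
intros C Xz Lz Lt HF. bbb_levels C. destruct HF as [[HF _]|(_ & _ & J)]; [lia|].
destruct (jumps_cross _ _ _ _ _ w J) as (u & v & Hl & _ & _ & Hn & [[F1 F2]|[F1 F2]]);
  [lia|exists (x - 1); lia| |]; destruct (bbb_uT _ _ _ _ C _ _ F1 ltac:(lia)) as [E1 E2].
- exfalso. apply F2. replace (u + 2) with (al + 1) by lia. replace v with be by lia. apply C.
- replace u with al in * by lia. replace v with (be - 1) in * by lia.
  destruct Hn as [Hn|Hn]; [lia|]. exfalso. apply Hn, C.
Qed.

(** * Words starting with BBB *)

(** By parity the second front move takes nothing from level 3. If the first one does, w = 3 and it
    took the only piece of level 3 able to hop over (al, be). Otherwise (2, 1) is alone there and
    has nothing to hop over. *)
Lemma forbidden_BBBFFB : forbidden [LB; LB; LB; LF; LF; LB].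
Proof.
apply forbidden_BBB. intros X w al be C H0. pose proof H0 as H.
apply path_F in H. destruct H as (X1 & z & z' & t & t' & H1 & M1 & Xz & Lz & Lt & HF1).
pose proof H1 as H. apply path_F in H.
destruct H as (X2 & y & y' & e & e' & H2 & M2 & Xy & Ly & Le & HF2).
pose proof H2 as H. apply path_B in H.
destruct H as (X3 & g & g' & k & k' & _ & _ & Xg & Lg & U3 & Lk & J).
bbb_levels C.
assert (Ny : y + y' <> 3).
{ destruct HF2 as [[HF2 _]|(HF2 & [j Hj] & _)]; lia. }
assert (Fu := jumps_first_up _ _ _ _ _ J
  ltac:(intros u v Hu; apply (path_range _ _ _ _ H2) in Hu; lia)).
destruct (Z.eq_dec (z + z') 3) as [E3|N3].
- destruct (after_BBB_F_level3 _ _ _ _ _ _ _ _ C Xz E3 Lt HF1) as (-> & -> & ->).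
  assert (Ng : ~ (g = al /\ g' = be - 1)).
  { intros [-> ->]. back Xg; lia. }
  assert (Xg' : X g g') by (back Xg; auto; lia).
  destruct Fu as [[F1 _]|[F1 _]]; back F1; try lia;
    destruct (bbb_uT _ _ _ _ C _ _ F1 ltac:(lia)) as [E1 E2].
  + apply (bbb_down _ _ _ _ C). replace (al - 1) with g by lia. replace be with g' by lia. auto.
  + lia.
- assert (U3X : unique X 3 g g').
  { intros u v Hu Hl. apply U3; [fwd|auto]. }
  destruct (U3X _ _ (bbb_21 _ _ _ _ C) eq_refl) as [<- <-].
  pose proof (after_BBB_wide _ _ _ _ _ C H0 U3X) as Hw.
  destruct (bbb_K _ _ _ _ C Hw U3X) as (N22 & _).
  destruct Fu as [[F1 _]|[F1 _]]; back F1; try lia.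
  + exact (bbb_31 _ _ _ _ C F1).
  + contradiction.
Qed.

(** If (2, 1) is alone on level 3, the neutral move must bring it an obstacle on level 4 and, for
    the second back move, take (1, 3) away; then the first back move is stopped before (al, be).
    Otherwise the neutral move takes a piece off level 3. For w = 3 both it and the back move would
    start from (al, be - 1); for larger w the back move is stopped before (al, be) again. *)
Lemma forbidden_BBBNBB : forbidden [LB; LB; LB; LN; LB; LB].
Proof.
apply forbidden_BBB. intros X w al be C H0. pose proof H0 as H.
apply path_N in H. destruct H as (V & n & n' & k & k' & H1 & M1 & Xn & Hk & HM).
pose proof H1 as H. apply path_B in H.
destruct H as (V1 & g & g' & q & q' & H2 & M2 & Vg & Lg & U3 & Lq & J).
destruct (path_unique LB _ _ _ _ H2 (or_introl eq_refl)) as (i & i' & _ & _ & U4).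
assert (Rk : 3 <= k + k').
{ apply (path_range _ _ _ _ H1). apply M1. auto. }
bbb_levels C.
assert (Fu := jumps_first_up _ _ _ _ _ J
  ltac:(intros u v Hu; apply (path_range _ _ _ _ H1) in Hu; lia)).
destruct (classic (unique X 3 2 1)) as [U3X|NU].
- pose proof (after_BBB_wide _ _ _ _ _ C H0 U3X) as Hw.
  destruct (bbb_K _ _ _ _ C Hw U3X) as (N22 & X13 & _).
  assert (N31 := bbb_31 _ _ _ _ C).
  assert (En : n = 2 /\ n' = 1 -> k = 2 /\ k' = 1 \/ k + k' = 4).
  { intros [-> ->]. unfold adjacent in HM. destruct HM as [HM|(_ & _ & Jn)]; [lia|].
    destruct (jumps_first_up _ _ _ _ _ Jn) as [[F _]|[F _]]; [|contradiction|contradiction].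
    intros u v Hu; apply (path_range _ _ _ _ H0) in Hu; lia. }
  assert (Eg : g = 2 /\ g' = 1 /\ ~ (n = 2 /\ n' = 1 /\ k + k' = 4)).
  { assert (V21 : V 2 1 \/ (n = 2 /\ n' = 1 /\ k + k' = 4)).
    { destruct (classic (n = 2 /\ n' = 1)) as [E|N].
      - destruct (En E); [left; apply M1; left; lia|right; lia].
      - left. pose proof (bbb_21 _ _ _ _ C). apply M1. right. split; [auto|lia]. }
    destruct V21 as [V21|E].
    - destruct (U3 _ _ V21 eq_refl) as [<- <-]. split; [auto|split; [auto|]].
      intros (-> & -> & E). back V21; lia.
    - exfalso. back Vg; [lia|]. apply U3X in Vg; lia. }
  destruct Eg as (-> & -> & Nn).
  assert (Fk : ~ X k k' /\ k + k' = 4).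
  { destruct Fu as [[F _]|[F _]]; back F; try contradiction; destruct F as [<- <-]; auto. }
  destruct Fk as [Nk Lk].
  assert (V1k : V1 k k').
  { apply M2. right. split; [apply M1; auto|lia]. }
  assert (E13 : n = 1 /\ n' = 3).
  { apply NNPP; intros N. assert (V113 : V1 1 3) by fwd.
    destruct (U4 _ _ V113 eq_refl), (U4 _ _ V1k Lk). subst. auto. }
  destruct E13 as [-> ->].
  destruct (jumps_cross _ _ _ _ _ w J) as (u & v & Hl & _ & _ & Hn & [[F1 F2]|[F1 F2]]);
  [lia|exists (x - 1); lia| |]; back F1; try lia;
  destruct (bbb_uT _ _ _ _ C _ _ F1 ltac:(lia)) as [E1 E2].
  + apply F2. replace (u + 2) with (al + 1) by lia. replace v with be by lia.
    pose proof (bbb_T1 _ _ _ _ C). fwd.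
  + replace u with al in * by lia. replace v with (be - 1) in * by lia.
    destruct Hn as [Hn|Hn]; [lia|]. apply Hn. pose proof (bbb_left _ _ _ _ C). fwd.
- assert (E : n + n' = 3 /\ ~ X k k' /\ k + k' <> 3).
  { assert (P : exists a b, X a b /\ a + b = 3 /\ ~ (a = 2 /\ b = 1)).
    { apply NNPP; intros N. apply NU. intros u v Hu Hl. apply NNPP; intros N'.
      apply N. eauto. }
    destruct P as (a & b & Xa & La & Na). pose proof (bbb_21 _ _ _ _ C) as X21.
    assert (Nk : ~ X k k').
    { intros Xk. destruct (Hk Xk) as [-> ->].
      assert (XV : forall u v, X u v -> V u v).
      { intros u v Hu. apply M1. destruct (classic (u = n /\ v = n')); tauto. }
      destruct (U3 _ _ (XV _ _ Xa) La), (U3 _ _ (XV _ _ X21) eq_refl). lia. }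
    assert (Xp : forall a b, X a b -> a + b = 3 -> ~ (a = n /\ b = n') -> V a b).
    { intros. apply M1. auto. }
    assert (L3 : n + n' = 3).
    { apply NNPP; intros N. assert (V21 : V 2 1) by (apply Xp; auto; lia). assert (Vab : V a b) by (apply Xp; auto; lia).
      destruct (U3 _ _ V21 eq_refl), (U3 _ _ Vab La). lia. }
    split; [auto|split; [auto|]]. intros Lk.
    assert (Vk : V k k') by (apply M1; auto). destruct (U3 _ _ Vk Lk) as [-> ->].
    destruct (classic (n = 2 /\ n' = 1)) as [[-> ->]|N].
    - assert (V a b) by (apply Xp; auto). destruct (U3 a b); auto; subst; auto.
    - assert (V 2 1) by (apply Xp; auto; lia). destruct (U3 2 1); auto; subst; auto. }
  destruct E as (Ln & Nk & Lk).
  assert (Xg : X g g') by (back Vg; auto; lia).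
  assert (Ng : ~ (g = n /\ g' = n')) by (intros [-> ->]; back Vg; [lia|auto]).
  destruct (Z_lt_le_dec w 5) as [Hw|Hw].
  + assert (w = 3) as -> by lia.
    assert (V1T : V1 al be) by (pose proof (bbb_T _ _ _ _ C); fwd).
    assert (Lk' : k + k' <> 4).
    { intros E. assert (V1k : V1 k k') by (apply M2; right; split; [apply M1; auto|lia]).
      destruct (U4 _ _ V1k E), (U4 _ _ V1T ltac:(lia)). subst. pose proof (bbb_T _ _ _ _ C); auto. }
    destruct HM as [HM|(_ & _ & Jn)]; [unfold adjacent in HM; lia|].
    assert (P : forall u v, X u v -> u + v = 3 -> X (u + 1) v \/ X u (v + 1) -> u = al /\ v = be - 1).
    { intros u v Hu Hl [F|F]; destruct (bbb_uT _ _ _ _ C _ _ F ltac:(lia)) as [E1 E2]; [|lia].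
      exfalso. apply (bbb_down _ _ _ _ C). replace (al - 1) with u by lia.
      replace be with v by lia. auto. }
    assert (Fn := jumps_first_up _ _ _ _ _ Jn
      ltac:(intros u v Hu; apply (path_range _ _ _ _ H0) in Hu; lia)).
    assert (Pn : n = al /\ n' = be - 1) by (apply P; auto; tauto).
    assert (Pg : g = al /\ g' = be - 1).
    { apply P; auto. destruct Fu as [[F _]|[F _]]; back F; auto; lia. }
    lia.
  + assert (Lk' : k + k' <> w + 1).
    { unfold adjacent in HM. destruct HM as [HM|([ik Pk] & [jk Pk'] & _)]; lia. }
    destruct (jumps_cross _ _ _ _ _ w J) as (u & v & Hl & _ & _ & Hn & [[F1 F2]|[F1 F2]]);
    [lia|exists (x - 1); lia| |]; back F1; try lia;
    destruct (bbb_uT _ _ _ _ C _ _ F1 ltac:(lia)) as [E1 E2].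
    * apply F2. replace (u + 2) with (al + 1) by lia. replace v with be by lia.
      pose proof (bbb_T1 _ _ _ _ C). fwd.
    * replace u with al in * by lia. replace v with (be - 1) in * by lia.
      destruct Hn as [Hn|Hn]; [lia|]. apply Hn. pose proof (bbb_left _ _ _ _ C). fwd.
Qed.

(** (z, z') is the piece of an earlier front move, if any. The rear piece can only shift: either it
    is (2, 1), without obstacle at (3, 1) or (2, 2), or w = 3 and the one piece able to hop over
    (al, be) went to the front. *)
Lemma after_BBB_R w' X w al be z z' V p q m n :
  after_BBB X w al be -> path w' X 3 (w + 3) ->
  (z + z' = 3 -> z = al /\ z' = be - 1 /\ w = 3) ->
  (forall u v, V u v -> u + v <= w + 3 -> X u v) ->
  (forall u v, X u v -> u + v = 3 -> V u v \/ (u = z /\ v = z')) ->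
  (z + z' = 3 -> ~ V z z') ->
  V p q -> p + q = 3 -> unique V 3 p q -> (forall u v, V u v -> 3 <= u + v) ->
  ((m + n = 3 + 1 /\ ((m = p + 1 /\ n = q) \/ (m = p /\ n = q + 1))) \/
   ((exists i, m = p + 2 * i) /\ (exists j, n = q + 2 * j) /\
    3 + 2 <= m + n /\ jumps (minus V p q) p q m n)) ->
  m + n = 4 /\
  ((5 <= w /\ unique X 3 2 1 /\ p = 2 /\ q = 1 /\ z + z' <> 3 /\ ~ (m = 1 /\ n = 3)) \/
   (w = 3 /\ z = al /\ z' = be - 1 /\ ~ (m = al /\ n = be))).
Proof.
intros C H Pz Vup Vlo NVz Vp Lp U3 V3 HM. bbb_levels C.
assert (Fu : jumps (minus V p q) p q m n -> X (p + 1) q \/ X p (q + 1)).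
{ intros J. destruct (jumps_first_up _ _ _ _ _ J) as [[F _]|[F _]].
  - intros u v Hu; apply V3 in Hu; lia.
  - left; apply Vup; [auto|lia].
  - right; apply Vup; [auto|lia]. }
destruct (Z.eq_dec (z + z') 3) as [E3|N3].
- destruct (Pz E3) as (-> & -> & ->).
  assert (P : ~ (p + 1 = al /\ q = be) /\ ~ (p = al /\ q + 1 = be)).
  { split; intros [E1 E2].
    - apply (bbb_down _ _ _ _ C). replace (al - 1) with p by lia. replace be with q by lia.
      apply Vup; [auto|lia].
    - apply NVz; [auto|]. replace al with p by lia. replace (be - 1) with q by lia. auto. }
  assert (Em : m + n = 3 + 1 /\ ((m = p + 1 /\ n = q) \/ (m = p /\ n = q + 1))).
  { destruct HM as [HM|(_ & _ & _ & J)]; [auto|exfalso].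
    destruct (Fu J) as [F|F]; destruct (bbb_uT _ _ _ _ C _ _ F ltac:(lia)); lia. }
  split; [lia|right]. repeat split; auto; lia.
- assert (U3X : unique X 3 2 1).
  { assert (UX : unique X 3 p q).
    { intros u v Hu Hl. apply U3; auto. destruct (Vlo u v Hu Hl); [auto|lia]. }
    destruct (UX _ _ (bbb_21 _ _ _ _ C) eq_refl) as [<- <-]. auto. }
  destruct (U3X p q (Vup _ _ Vp ltac:(lia)) Lp) as [-> ->].
  pose proof (after_BBB_wide _ _ _ _ _ C H U3X) as Hw.
  destruct (bbb_K _ _ _ _ C Hw U3X) as (N22 & _).
  assert (Em : m + n = 3 + 1 /\ ((m = 2 + 1 /\ n = 1) \/ (m = 2 /\ n = 1 + 1))).
  { destruct HM as [HM|(_ & _ & _ & J)]; [auto|exfalso].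
    destruct (Fu J) as [F|F]; [exact (bbb_31 _ _ _ _ C F)|contradiction]. }
  split; [lia|left]. split; [auto|split; [auto|]]. lia.
Qed.

(* A second rear move or a back move needs level 4 to be thinned out first. *)
Lemma after_BBB_level4 w' X w al be z z' V p q m n V' i i' :
  after_BBB X w al be -> path w' X 3 (w + 3) ->
  (z + z' = 3 -> z = al /\ z' = be - 1 /\ w = 3) ->
  (forall u v, V u v -> u + v <= w + 3 -> X u v) ->
  (forall u v, X u v -> u + v = 3 -> V u v \/ (u = z /\ v = z')) ->
  (z + z' = 3 -> ~ V z z') ->
  V p q -> p + q = 3 -> unique V 3 p q -> (forall u v, V u v -> 3 <= u + v) ->
  ((m + n = 3 + 1 /\ ((m = p + 1 /\ n = q) \/ (m = p /\ n = q + 1))) \/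
   ((exists i, m = p + 2 * i) /\ (exists j, n = q + 2 * j) /\
    3 + 2 <= m + n /\ jumps (minus V p q) p q m n)) ->
  (m + n = 4 -> V' m n) -> (forall u v, X u v -> u + v = 4 -> V' u v) ->
  ~ unique V' 4 i i'.
Proof.
intros C H Pz Vup Vlo NVz Vp Lp U3 V3 HM Hm HX U4. bbb_levels C.
destruct (after_BBB_R _ _ _ _ _ _ _ _ _ _ _ _ C H Pz Vup Vlo NVz Vp Lp U3 V3 HM) as [Lm Hc].
destruct (U4 _ _ (Hm Lm) Lm) as [-> ->].
destruct Hc as [(Hw & U3X & _ & _ & _ & N)|(-> & _ & _ & N)].
- destruct (bbb_K _ _ _ _ C Hw U3X) as (_ & X13 & _).
  destruct (U4 1 3 (HX _ _ X13 eq_refl) eq_refl). lia.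
- destruct (U4 al be (HX _ _ (bbb_T _ _ _ _ C) ltac:(lia)) ltac:(lia)). lia.
Qed.

(** Level 4 holds the shifted rear piece and (1, 3), or (al, be) if w = 3; one of the two must be
    the second front piece. For w at least 5, (1, 3) has to leave by a jump over (2, 3), while
    another piece of level 5 has to be alone there. For w = 3 the front takes (al, be), and (m, n)
    could only hop over (al + 1, be), onto the occupied (al + 1, be + 1). *)
Lemma after_BBB_FFRR w' X w al be z z' t t' y y' e e' V U V4 V5 p q m n g g' h h' i i' :
  after_BBB X w al be -> path w' X 3 (w + 3) ->
  (z + z' = w + 3 \/ exists j, z + z' = 2 * j + 1) ->
  t + t' = w + 4 ->
  (z + z' = 3 -> z = al /\ z' = be - 1 /\ w = 3) ->
  (* first rear move, in [V] *)
  (forall u v, V u v -> u + v <= w + 3 -> X u v) ->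
  (forall u v, X u v -> u + v = 3 -> V u v \/ (u = z /\ v = z')) ->
  (z + z' = 3 -> ~ V z z') ->
  V p q -> p + q = 3 -> unique V 3 p q -> (forall u v, V u v -> 3 <= u + v) ->
  ((m + n = 3 + 1 /\ ((m = p + 1 /\ n = q) \/ (m = p /\ n = q + 1))) \/
   ((exists i, m = p + 2 * i) /\ (exists j, n = q + 2 * j) /\
    3 + 2 <= m + n /\ jumps (minus V p q) p q m n)) ->
  (* second front move, in [U] *)
  (forall u v, U u v -> u + v <= w + 3 -> X u v \/ (u = m /\ v = n)) ->
  (forall u v, X u v -> 4 <= u + v -> U u v \/ (u = z /\ v = z')) ->
  e + e' = w + 5 ->
  (y + y' = w + 4 \/ ((exists j, y + y' = 2 * j) /\ jumps (minus U y y') y y' e e')) ->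
  (* second rear move, in [V4] *)
  (forall u v, V4 u v -> u + v <= w + 3 -> X u v \/ (u = m /\ v = n)) ->
  (forall u v, X u v -> 4 <= u + v -> V4 u v \/ (u = z /\ v = z') \/ (u = y /\ v = y')) ->
  V4 m n \/ (y = m /\ y' = n) ->
  (forall u v, V4 u v -> 4 <= u + v) ->
  V4 g g' -> g + g' = 4 -> unique V4 4 g g' -> ~ V4 h h' ->
  (h + h' = 5 \/ jumps (minus V4 g g') g g' h h') -> 5 <= h + h' ->
  moved V4 V5 g g' h h' -> ~ unique V5 5 i i'.
Proof.
intros C H Qz Lt Pz Vup Vlo NVz Vp Lp U3 V3 HM Uup Ulo Le HF V4up V4lo V4m V44 Vg Lg U4 Nh HR Lh M U5.
destruct (after_BBB_R _ _ _ _ _ _ _ _ _ _ _ _ C H Pz Vup Vlo NVz Vp Lp U3 V3 HM) as [Lm Hc].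
clear HM Vup Vlo NVz V3. bbb_levels C.
assert (Ny5 : y + y' <> 5).
{ destruct HF as [HF|[[j HF] _]]; lia. }
assert (XU : forall u v, X u v -> 4 <= u + v -> ~ (u = z /\ v = z') -> U u v).
{ intros u v Hu Hl N. destruct (Ulo u v Hu Hl) as [|E]; [auto|destruct (N E)]. }
assert (UT1 : forall u v, U u v -> u + v = w + 2 -> u = al + 1 /\ v = be).
{ intros u v Hu Hl. destruct (Uup u v Hu ltac:(lia)) as [Hx|E]; [apply (bbb_uT1 _ _ _ _ C); auto|lia]. }
(* an even piece can only pass through (al + 1, be + 1) *)
assert (Pass : y + y' = 4 -> ~ (y = al /\ y' = be) -> z = al + 1 /\ z' = be + 1).
{ intros Ly Ny. destruct HF as [HF|[_ J]]; [lia|].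
  destruct (jumps_cross _ _ _ _ _ (w + 1) J) as (u & v & Hl & _ & _ & Hn & HX);
    [lia|exists (x - 1); lia|].
  assert (E : (u = al /\ v = be) \/ (u = al + 1 /\ v = be - 1 /\ ~ U (al + 1) (be + 1))).
  { destruct HX as [[F1 F2]|[F1 F2]]; destruct (UT1 _ _ F1 ltac:(lia)) as [E1 E2]; [left; lia|right].
    replace u with (al + 1) in * by lia. replace v with (be - 1) in * by lia.
    replace (be - 1 + 2) with (be + 1) in F2 by lia. auto. }
  destruct E as [[-> ->]|(-> & -> & E)].
  - exfalso. destruct Hn as [Hn|Hn]; [lia|]. apply Hn, XU; [apply C|lia|].
    intros [<- <-]. destruct Qz as [Qz|[j Qz]]; lia.
  - apply NNPP; intros N. apply E, XU; [apply C|lia|lia]. }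
destruct Hc as [(Hw & U3X & -> & -> & Nz3 & Nm)|(-> & -> & -> & Nm)].
- destruct (bbb_K _ _ _ _ C Hw U3X) as (N22 & X13 & N14 & _ & K5).
  assert (V413 : V4 1 3 \/ (y = 1 /\ y' = 3)).
  { destruct (V4lo _ _ X13 ltac:(lia)) as [|[E|E]]; [auto| |lia].
    destruct Qz as [Qz|[j Qz]]; lia. }
  assert (Ly : y + y' = 4).
  { destruct V413 as [V413|]; [|lia]. destruct V4m as [V4m|]; [|lia].
    destruct (U4 _ _ V413 eq_refl), (U4 _ _ V4m Lm). lia. }
  destruct (Pass Ly ltac:(lia)) as [-> ->].
  assert (X5 : forall u v, X u v -> u + v = 5 -> V4 u v).
  { intros u v Hu Hl. destruct (V4lo u v Hu ltac:(lia)) as [|[E|E]]; [auto|lia|lia]. }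
  assert (V45 : forall u v, V4 u v -> u + v = 5 -> V5 u v).
  { intros u v Hu Hl. apply M. right. split; [auto|lia]. }
  assert (Y5 : exists a b, V4 a b /\ a + b = 5 /\ ~ (a = 2 /\ b = 3)).
  { destruct K5 as [K5|K5]; [exists 4, 1|exists 3, 2]; (split; [apply X5; auto|lia]). }
  destruct Y5 as (a & b & Vab & Lab & Nab).
  destruct (U5 _ _ (V45 _ _ Vab Lab) Lab) as [-> ->].
  assert (X23 : forall W k k', (forall u v, W u v -> u + v <= w + 3 -> X u v \/ (u = m /\ v = n)) ->
    ~ jumps (minus W 1 3) 1 3 k k').
  { intros W k k' Wup J. destruct (jumps_first _ _ _ _ _ J) as (u & v & Ht & Hh).
    assert (X23 : ~ X 2 3).
    { intros X23. destruct (U5 2 3 (V45 _ _ (X5 _ _ X23 eq_refl) eq_refl) eq_refl). lia. }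
    destruct Hh as [(->&->&[Hh _])|[(->&->&[Hh _])|[(->&->&[Hh _])|(->&->&[Hh _])]]];
    cbn in Hh; (destruct (Wup _ _ Hh ltac:(lia)) as [Hx|Hx]; [|lia]);
    try contradiction; apply U3X in Hx; lia. }
  destruct V413 as [V413|[-> ->]].
  + destruct (U4 _ _ V413 eq_refl) as [<- <-]. destruct HR as [HR|HR].
    * assert (V5h : V5 h h') by (apply M; auto). destruct (U5 _ _ V5h HR) as [-> ->]. auto.
    * exact (X23 _ _ _ V4up HR).
  + destruct HF as [HF|[_ HF]]; [lia|]. exact (X23 _ _ _ Uup HF).
- assert (V4T : V4 al be \/ (y = al /\ y' = be)).
  { destruct (V4lo _ _ (bbb_T _ _ _ _ C) ltac:(lia)) as [|[E|E]]; [auto|lia|lia]. }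
  assert (Ey : y = al /\ y' = be).
  { destruct V4T as [V4T|]; [|auto]. destruct V4m as [V4m|Em].
    - destruct (U4 _ _ V4T ltac:(lia)), (U4 _ _ V4m Lm). lia.
    - destruct (Pass ltac:(lia) ltac:(lia)). lia. }
  destruct Ey as [-> ->]. destruct V4m as [V4m|]; [|lia].
  destruct (U4 _ _ V4m Lm) as [<- <-].
  assert (V4T1 : V4 (al + 1) be).
  { destruct (V4lo _ _ (bbb_T1 _ _ _ _ C) ltac:(lia)) as [|[E|E]]; [auto|lia|lia]. }
  assert (V5T1 : V5 (al + 1) be) by (apply M; right; split; [auto|lia]).
  destruct (U5 _ _ V5T1 ltac:(lia)) as [<- <-].
  destruct HR as [HR|J].
  + assert (V5h : V5 h h') by (apply M; auto). destruct (U5 _ _ V5h HR) as [-> ->]. auto.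
  + assert (E5 : forall u v, V4 u v -> u + v = 5 -> u = al + 1 /\ v = be).
    { intros u v Hu Hl. apply U5; [|auto]. apply M. right. split; [auto|lia]. }
    destruct (jumps_first_up _ _ _ _ _ J) as [[F1 F2]|[F1 F2]].
    * intros u v Hu; apply V44 in Hu; lia.
    * destruct (E5 _ _ F1 ltac:(lia)). lia.
    * destruct (E5 _ _ F1 ltac:(lia)) as [E1 E2]. apply F2.
      replace m with (al + 1) by lia. replace (n + 2) with (be + 1) by lia.
      destruct (V4lo _ _ (bbb_T2 _ _ _ _ C) ltac:(lia)) as [|[E|E]]; [auto|lia|lia].
Qed.

Lemma forbidden_BBBFRRF : forbidden [LB; LB; LB; LF; LR; LR].
Proof.
apply forbidden_BBB. intros X w al be C H0. pose proof H0 as H.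
apply path_F in H. destruct H as (X1 & z & z' & t & t' & H1 & M1 & Xz & Lz & Lt & HF1).
pose proof H1 as H. apply path_R in H.
destruct H as (X2 & p & q & m & n & H2 & M2 & X1p & Lp & U3 & Lm & Nm & HM).
destruct (path_unique LR _ _ _ _ H2 (or_intror eq_refl)) as (i & i' & _ & _ & U4).
bbb_levels C. revert U4. eapply (after_BBB_level4 _ X w al be z z' X1 p q m n); eauto.
- intros Lz3. exact (after_BBB_F_level3 _ _ _ _ _ _ _ _ C Xz Lz3 Lt HF1).
- intros u v Hu Hl. back Hu; auto; lia.
- intros u v Hu Hl. destruct (classic (u = z /\ v = z')); [auto|left; fwd].
- intros Lz3 Hz. back Hz; [lia|auto].
- intros u v Hu; apply (path_range _ _ _ _ H1) in Hu; lia.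
- intros _. fwd.
- intros u v Hu Hl. destruct HF1 as [[HF1 _]|(HF1 & [j Hj] & _)]; fwd.
Qed.

Lemma forbidden_BBBRR : forbidden [LB; LB; LB; LR; LR].
Proof.
apply forbidden_BBB. intros X w al be C H0. pose proof H0 as H.
apply path_R in H.
destruct H as (X2 & p & q & m & n & H2 & M2 & X1p & Lp & U3 & Lm & Nm & HM).
destruct (path_unique LR _ _ _ _ H2 (or_intror eq_refl)) as (i & i' & _ & _ & U4).
(* (0, 0) lies below all pieces and stands for a front move that has not happened. *)
bbb_levels C. revert U4. eapply (after_BBB_level4 _ X w al be 0 0 X p q m n); eauto; try lia.
- intros u v Hu; apply (path_range _ _ _ _ H0) in Hu; lia.
- intros _. fwd.
- intros u v Hu Hl. fwd.
Qed.

Lemma forbidden_BBBRFR : forbidden [LB; LB; LB; LR; LF; LR].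
Proof.
apply forbidden_BBB. intros X w al be C H0. pose proof H0 as H.
apply path_R in H.
destruct H as (X1 & p & q & m & n & H1 & M1 & X1p & Lp & U3 & Lm & Nm & HM).
pose proof H1 as H. apply path_F in H.
destruct H as (X2 & z & z' & t & t' & H2 & M2 & Xz & Lz & Lt & HF1).
destruct (path_unique LR _ _ _ _ H2 (or_intror eq_refl)) as (i & i' & _ & _ & U4).
bbb_levels C. revert U4. eapply (after_BBB_level4 _ X w al be 0 0 X p q m n); eauto; try lia.
- intros u v Hu; apply (path_range _ _ _ _ H0) in Hu; lia.
- intros Lm4. destruct HF1 as [[HF1 _]|(HF1 & [j Hj] & _)]; fwd.
- intros u v Hu Hl. destruct HF1 as [[HF1 _]|(HF1 & [j Hj] & _)]; fwd.
Qed.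
Lemma forbidden_BBBFFRRB : forbidden [LB; LB; LB; LF; LF; LR; LR; LB].
Proof.
apply forbidden_BBB. intros X w al be C H0. pose proof H0 as H.
apply path_F in H. destruct H as (X1 & z & z' & t & t' & H1 & M1 & Xz & Lz & Lt & HF1).
pose proof H1 as H. apply path_F in H.
destruct H as (X2 & y & y' & e & e' & H2 & M2 & X1y & Ly & Le & HF2).
pose proof H2 as H. apply path_R in H.
destruct H as (X3 & p & q & m & n & H3 & M3 & X2p & Lp & U3 & Lm & Nm & HM).
pose proof H3 as H. apply path_R in H.
destruct H as (X4 & g & g' & h & h' & H4 & M4 & X3g & Lg & U4 & Lh & Nh & HR).
destruct (path_unique LB _ _ _ _ H4 (or_introl eq_refl)) as (i & i' & _ & _ & U5).
bbb_levels C. revert U5.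
refine (after_BBB_FFRR _ X w al be z z' t t' y y' e e' X2 X1 X3 X4 p q m n g g' h h' i i' C H0
  _ _ _ _ _ _ _ Lp U3 _ HM _ _ _ _ _ _ _ _ X3g _ _ Nh _ _ M4); try lia.
- destruct HF1 as [[? _]|(_ & [j Hj] & _)]; [left; lia|right; exists (x + 2 - j); lia].
- intros Lz3. exact (after_BBB_F_level3 _ _ _ _ _ _ _ _ C Xz Lz3 Lt HF1).
- clear HM HR HF1 HF2. intros u v Hu Hl. back Hu; auto; lia.
- intros u v Hu Hl. destruct (classic (u = z /\ v = z')); [auto|left].
  destruct HF2 as [[HF2 _]|(HF2 & [j Hj] & _)]; fwd.
- intros Lz3 Hz. back Hz; try lia; auto.
- auto.
- intros u v Hu; apply (path_range _ _ _ _ H2) in Hu; lia.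
- clear HM HR HF1 HF2. intros u v Hu Hl. back Hu; auto; lia.
- clear HM HR HF1 HF2. intros u v Hu Hl. destruct (classic (u = z /\ v = z')); [auto|left; fwd].
- destruct HF2 as [[HF2 _]|(HF2 & [j Hj] & J)]; [left; lia|right].
  split; [exists (x + 3 - j); lia|auto].
- clear HM HR HF1 HF2. intros u v Hu Hl. back Hu; auto; lia.
- clear HM HR HF1 HF2. intros u v Hu Hl. destruct (classic (u = z /\ v = z')); [auto|].
  destruct (classic (u = y /\ v = y')); [auto|left; fwd].
- left; fwd.
- intros u v Hu; apply (path_range _ _ _ _ H3) in Hu; lia.
- exact U4.
- destruct HR as [HR|(_ & _ & _ & HR)]; [left; lia|auto].
Qed.

Lemma forbidden_BBBFRFRB : forbidden [LB; LB; LB; LF; LR; LF; LR; LB].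
Proof.
apply forbidden_BBB. intros X w al be C H0. pose proof H0 as H.
apply path_F in H. destruct H as (X1 & z & z' & t & t' & H1 & M1 & Xz & Lz & Lt & HF1).
pose proof H1 as H. apply path_R in H.
destruct H as (X2 & p & q & m & n & H2 & M2 & X1p & Lp & U3 & Lm & Nm & HM).
pose proof H2 as H. apply path_F in H.
destruct H as (X3 & y & y' & e & e' & H3 & M3 & X2y & Ly & Le & HF2).
pose proof H3 as H. apply path_R in H.
destruct H as (X4 & g & g' & h & h' & H4 & M4 & X3g & Lg & U4 & Lh & Nh & HR).
destruct (path_unique LB _ _ _ _ H4 (or_introl eq_refl)) as (i & i' & _ & _ & U5).
bbb_levels C. revert U5.
refine (after_BBB_FFRR _ X w al be z z' t t' y y' e e' X1 X2 X3 X4 p q m n g g' h h' i i' C H0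
  _ _ _ _ _ _ _ Lp U3 _ HM _ _ _ _ _ _ _ _ X3g _ _ Nh _ _ M4); try lia.
- destruct HF1 as [[? _]|(_ & [j Hj] & _)]; [left; lia|right; exists (x + 2 - j); lia].
- intros Lz3. exact (after_BBB_F_level3 _ _ _ _ _ _ _ _ C Xz Lz3 Lt HF1).
- clear HM HR HF1 HF2. intros u v Hu Hl. back Hu; auto; lia.
- clear HM HR HF1 HF2. intros u v Hu Hl. destruct (classic (u = z /\ v = z')); [auto|left; fwd].
- intros Lz3 Hz. back Hz; try lia; auto.
- auto.
- intros u v Hu; apply (path_range _ _ _ _ H1) in Hu; lia.
- clear HM HR HF1 HF2. intros u v Hu Hl. back Hu; auto; lia.
- clear HM HR HF1 HF2. intros u v Hu Hl. destruct (classic (u = z /\ v = z')); [auto|left; fwd].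
- destruct HF2 as [[HF2 _]|(HF2 & [j Hj] & J)]; [left; lia|right].
  split; [exists (x + 3 - j); lia|auto].
- clear HM HR HF1 HF2. intros u v Hu Hl. back Hu; auto; lia.
- clear HM HR HF1 HF2. intros u v Hu Hl. destruct (classic (u = z /\ v = z')); [auto|].
  destruct (classic (u = y /\ v = y')); [auto|left; fwd].
- destruct (classic (m = y /\ n = y')); [right; lia|left; fwd].
- intros u v Hu; apply (path_range _ _ _ _ H3) in Hu; lia.
- exact U4.
- destruct HR as [HR|(_ & _ & _ & HR)]; [left; lia|auto].
Qed.

Lemma forbidden_BBBRFFRB : forbidden [LB; LB; LB; LR; LF; LF; LR; LB].
Proof.
apply forbidden_BBB. intros X w al be C H0. pose proof H0 as H.
apply path_R in H.
destruct H as (X1 & p & q & m & n & H1 & M1 & Xp & Lp & U3 & Lm & Nm & HM).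
pose proof H1 as H. apply path_F in H.
destruct H as (X2 & z & z' & t & t' & H2 & M2 & X1z & Lz & Lt & HF1).
pose proof H2 as H. apply path_F in H.
destruct H as (X3 & y & y' & e & e' & H3 & M3 & X2y & Ly & Le & HF2).
pose proof H3 as H. apply path_R in H.
destruct H as (X4 & g & g' & h & h' & H4 & M4 & X3g & Lg & U4 & Lh & Nh & HR).
destruct (path_unique LB _ _ _ _ H4 (or_introl eq_refl)) as (i & i' & _ & _ & U5).
bbb_levels C.
assert (Lm4 : m + n = 4).
{ refine (proj1 (after_BBB_R _ X w al be 0 0 X p q m n C H0 _ _ _ _ Xp Lp U3 _ HM)); auto; try lia.
  intros u v Hu; apply (path_range _ _ _ _ H0) in Hu; lia. }
assert (Qz : z + z' = w + 3 \/ exists j, z + z' = 2 * j + 1).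
{ destruct HF1 as [[? _]|(_ & [j Hj] & _)]; [left; lia|right; exists (x + 2 - j); lia]. }
assert (Nmz : ~ (m = z /\ n = z')) by (destruct Qz as [|[j ?]]; lia).
revert U5.
refine (after_BBB_FFRR _ X w al be z z' t t' y y' e e' X X2 X3 X4 p q m n g g' h h' i i' C H0
  Qz _ _ _ _ _ Xp Lp U3 _ HM _ _ _ _ _ _ _ _ X3g _ _ Nh _ _ M4); try lia; auto.
- intros u v Hu; apply (path_range _ _ _ _ H0) in Hu; lia.
- clear HM HR HF1 HF2. intros u v Hu Hl. back Hu; auto; lia.
- clear HM HR HF1 HF2. intros u v Hu Hl. destruct (classic (u = z /\ v = z')); [auto|left; fwd].
- destruct HF2 as [[HF2 _]|(HF2 & [j Hj] & J)]; [left; lia|right].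
  split; [exists (x + 3 - j); lia|auto].
- clear HM HR HF1 HF2. intros u v Hu Hl. back Hu; auto; lia.
- clear HM HR HF1 HF2. intros u v Hu Hl. destruct (classic (u = z /\ v = z')); [auto|].
  destruct (classic (u = y /\ v = y')); [auto|left; fwd].
- destruct (classic (m = y /\ n = y')); [right; lia|left; fwd].
- intros u v Hu; apply (path_range _ _ _ _ H3) in Hu; lia.
- destruct HR as [HR|(_ & _ & _ & HR)]; [left; lia|auto].
Qed.

(** * The forbidden words *)

Local Notation B := LB (only parsing). Local Notation F := LF (only parsing).
Local Notation R := LR (only parsing). Local Notation N := LN (only parsing).

(** One word from each pair under [forbidden_mirror]. That these words suffice is not argued but
    computed, in [potential_feasible]. *)
Definition half_words : list (list letter) :=
  [[B;B;B;B]; [B;B;R;R;B]; [B;B;R;R;R]; [B;B;R;F;B]; [B;B;F;R;B];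
   [B;B;F;R;R;R;B]; [B;B;R;F;R;R;B]; [B;B;R;R;F;R;B];
   [B;B;F;F;B;F;F;B]; [B;B;F;F;B;R;R;B]; [B;B;F;F;B;R;R;R];
   [B;B;F;F;B;F;R;R;R]; [B;B;F;F;B;R;F;R;R]; [B;B;F;F;B;R;R;F;R];
   [B;B;F;F;B;N;B];
   [B;B;F;F;B;F;R;B;R]; [B;B;F;F;B;F;R;B;F;R]; [B;B;F;F;B;F;R;B;F;F;B];
   [B;B;F;F;B;F;R;B;N;B];
   [B;B;F;F;B;R;F;B;R]; [B;B;F;F;B;R;F;B;F;R]; [B;B;F;F;B;R;F;B;F;F;B];
   [B;B;F;F;B;R;F;B;N;B];
   [B;B;B;F;F;B]; [B;B;B;N;B;B]; [B;B;B;R;R]; [B;B;B;R;F;R]; [B;B;B;F;R;R];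
   [B;B;B;F;F;R;R;B]; [B;B;B;F;R;F;R;B]; [B;B;B;R;F;F;R;B]].

Definition words : list (list letter) :=
  half_words ++ map (fun w => rev (map flip w)) half_words.

Lemma words_forbidden w : In w words -> forbidden w.
Proof.
assert (H : forall w, In w half_words -> forbidden w).
{ clear. intros w Hw. cbn in Hw.
  destruct Hw as [<-|Hw]; [exact forbidden_BBBB|].
  destruct Hw as [<-|Hw]; [exact (forbidden_BBRR B (or_introl eq_refl))|].
  destruct Hw as [<-|Hw]; [exact (forbidden_BBRR R (or_intror eq_refl))|].
  destruct Hw as [<-|Hw]; [exact forbidden_BBRFB|].
  destruct Hw as [<-|Hw]; [exact forbidden_BBFRB|].
  destruct Hw as [<-|Hw]; [exact forbidden_BBFRRRB|].
  destruct Hw as [<-|Hw]; [exact forbidden_BBRFRRB|].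
  destruct Hw as [<-|Hw]; [exact forbidden_BBRRFRB|].
  destruct Hw as [<-|Hw]; [exact forbidden_BBFFBFFB|].
  destruct Hw as [<-|Hw]; [exact (forbidden_BBFFBRR B (or_introl eq_refl))|].
  destruct Hw as [<-|Hw]; [exact (forbidden_BBFFBRR R (or_intror eq_refl))|].
  destruct Hw as [<-|Hw]; [exact forbidden_BBFFBFRRR|].
  destruct Hw as [<-|Hw]; [exact forbidden_BBFFBRFRR|].
  destruct Hw as [<-|Hw]; [exact forbidden_BBFFBRRFR|].
  destruct Hw as [<-|Hw]; [exact forbidden_BBFFBNB|].
  do 4 (destruct Hw as [<-|Hw];
    [apply (forbidden_crowded F R _ (or_introl (conj eq_refl eq_refl))); cbn; tauto|]).
  do 4 (destruct Hw as [<-|Hw];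
    [apply (forbidden_crowded R F _ (or_intror (conj eq_refl eq_refl))); cbn; tauto|]).
  destruct Hw as [<-|Hw]; [exact forbidden_BBBFFB|].
  destruct Hw as [<-|Hw]; [exact forbidden_BBBNBB|].
  destruct Hw as [<-|Hw]; [exact forbidden_BBBRR|].
  destruct Hw as [<-|Hw]; [exact forbidden_BBBRFR|].
  destruct Hw as [<-|Hw]; [exact forbidden_BBBFRRF|].
  destruct Hw as [<-|Hw]; [exact forbidden_BBBFFRRB|].
  destruct Hw as [<-|Hw]; [exact forbidden_BBBFRFRB|].
  destruct Hw as [<-|[]]; exact forbidden_BBBRFFRB. }
intros Hw. apply in_app_or in Hw. destruct Hw as [Hw|Hw]; [auto|].
apply in_map_iff in Hw. destruct Hw as (w' & <- & Hw). apply forbidden_mirror; auto.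
Qed.

(* The most recent letter comes first. *)
Fixpoint history (s : list letter) (X : config) (r f : Z) : Prop :=
  spans X r f /\ five_pieces X /\
  match s with
  | [] => True
  | x :: s' => exists X', (exists a b c d, moves X' X a b c d) /\
                 history s' X' (r - rear_gain x) (f - front_gain x)
  end.

Lemma history_spans s X r f : history s X r f -> spans X r f.
Proof. destruct s; intros (H & _); exact H. Qed.
Lemma history_five_pieces s X r f : history s X r f -> five_pieces X.
Proof. destruct s; intros (_ & H & _); exact H. Qed.

Lemma history_path s : forall X r f w, history s X r f -> path w X r f ->
  exists Y r' f', path (rev s ++ w) Y r' f'.
Proof.
induction s as [|x s IH]; intros X r f w H P; [cbn; eauto|].
destruct H as (HX & bX & X' & M & H). cbn. rewrite <- app_assoc.
apply (IH X' (r - rear_gain x) (f - front_gain x)); auto. cbn [app].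
split; [exact (history_spans _ _ _ _ H)|]. split; [exact (history_five_pieces _ _ _ _ H)|].
exists X. split; [auto|].
replace (r - rear_gain x + rear_gain x) with r by lia. replace (f - front_gain x + front_gain x) with f by lia. auto.
Qed.

Lemma history_prefix s : forall s' X r f, history (s ++ s') X r f -> history s X r f.
Proof.
induction s as [|x s IH]; intros s' X r f H; cbn in *.
- split; [exact (history_spans _ _ _ _ H)|]. split; [exact (history_five_pieces _ _ _ _ H)|auto].
- destruct H as (H1 & H2 & X' & M & H). split; [auto|split; [auto|]]. eauto.
Qed.

(** * A potential on histories avoiding the forbidden words *)

Definition letter_eqb (x y : letter) : bool :=
  match x, y with LB, LB | LF, LF | LR, LR | LN, LN => true | _, _ => false end.

Lemma letter_eqb_eq x y : letter_eqb x y = true -> x = y.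
Proof. destruct x, y; auto; discriminate. Qed.

Fixpoint prefixb (s t : list letter) : bool :=
  match s, t with
  | [], _ => true
  | x :: s', y :: t' => letter_eqb x y && prefixb s' t'
  | _, _ => false
  end.

Lemma prefixb_app s : forall t, prefixb s t = true -> exists u, t = s ++ u.
Proof.
induction s as [|x s IH]; intros t H; [exists t; auto|].
destruct t as [|y t]; [discriminate|]. cbn in H. apply andb_prop in H. destruct H as [H1 H2].
apply letter_eqb_eq in H1. destruct (IH _ H2) as [u ->]. exists u; subst; auto.
Qed.

Definition dead (t : list letter) : bool := existsb (fun w => prefixb w t) (map (@rev letter) words).

Lemma dead_history t X r f : dead t = true -> ~ history t X r f.
Proof.
intros H Ht. apply existsb_exists in H. destruct H as (w & Hw & Hp).
apply in_map_iff in Hw. destruct Hw as (w' & <- & Hw).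
destruct (prefixb_app _ _ Hp) as [u ->]. apply history_prefix in Ht.
destruct (history_path _ X r f [] Ht) as (Y & r' & f' & P).
{ split; [exact (history_spans _ _ _ _ Ht)|split; [exact (history_five_pieces _ _ _ _ Ht)|auto]]. }
rewrite rev_involutive, app_nil_r in P. exact (words_forbidden _ Hw _ _ _ P).
Qed.

(* [4 - 3 (rear_gain x + front_gain x)] *)
Definition weight (x : letter) : Z := match x with LB => -2 | LF | LR => 1 | LN => 4 end.
Definition changes (x : letter) : bool := match x with LF | LR => true | _ => false end.

Definition table := list (list letter * (Z * Z)).

(* The longest recorded prefix; the two values are for even and odd width. *)
Fixpoint lookup (T : table) (best : list letter * (Z * Z)) (t : list letter) :=
  match T with
  | [] => best
  | (s, v) :: T' =>
      lookup T' (if prefixb s t && (length (fst best) <=? length s)%nat then (s, v) else best) t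
  end.

Definition value (v : Z * Z) (odd : bool) : Z := if odd then snd v else fst v.

Fixpoint tails (s : list letter) : list (list letter) :=
  match s with [] => [] | x :: s' => s' :: tails s' end.

Fixpoint mem (s : list letter) (l : list (list letter)) : bool :=
  match l with
  | [] => false
  | t :: l' => (prefixb s t && prefixb t s) || mem s l'
  end.

Fixpoint undup (l : list (list letter)) : list (list letter) :=
  match l with [] => [] | s :: l' => if mem s l' then undup l' else s :: undup l' end.

(** The reversed proper prefixes of the forbidden words, the empty one included: the states of their
    Aho-Corasick automaton, whose transitions [lookup] computes. *)
Definition keys : list (list letter) :=
  filter (fun s => negb (dead s)) (undup (flat_map (fun w => tails (rev w)) words)).

(* One round of the Bellman-Ford algorithm for the least weight of a history. *)
Definition relax (T : table) : table :=
  fold_left (fun T' (u : list letter * (Z * Z)) =>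
    let (s, v) := u in
    fold_left (fun T'' x =>
      if dead (x :: s) then T'' else
      let k := fst (lookup T ([], (0, 0)) (x :: s)) in
      map (fun e : list letter * (Z * Z) =>
        if mem (fst e) [k] then
          let (a, b) := snd e in
          (fst e, (match x with
                   (* A back move requires odd width and keeps it, so it never leads to even
                      width. *)
                   | LB => a
                   | _ => Z.min a (value v (changes x) + weight x)
                   end, Z.min b (value v (negb (changes x)) + weight x)))
        else e) T'') [LB; LF; LR; LN] T') T T.

Fixpoint rounds (n : nat) (T : table) : table :=
  match n with O => T | S n' => rounds n' (relax T) end.

(** The starting values and the number of rounds need no justification, since [feasible] checks the
    result. *)
Definition potential : table :=
  Eval vm_compute in rounds 20 (map (fun s => (s, (0, 0))) keys).

Definition feasible (T : table) : bool :=
  existsb (fun u => mem [] [fst u]) T &&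
  forallb (fun u : list letter * (Z * Z) =>
    let (s, v) := u in
    forallb (fun odd => (-6 <=? value v odd) && (value v odd <=? 0) &&
      forallb (fun x =>
        match x with LB => negb odd | _ => false end || dead (x :: s) ||
        (value (snd (lookup T ([], (0, 0)) (x :: s))) (xorb odd (changes x))
           <=? value v odd + weight x)) [LB; LF; LR; LN])
    [false; true]) T.

Lemma potential_feasible : feasible potential = true.
Proof. vm_compute. reflexivity. Qed.

Lemma lookup_in T t : forall best, In (lookup T best t) T \/ lookup T best t = best.
Proof.
induction T as [|[s v] T IH]; intros best; cbn; [auto|].
destruct (IH (if prefixb s t && (length (fst best) <=? length s)%nat then (s, v) else best)) as [H|H]; auto.
rewrite H. destruct (_ && _); auto.
Qed.

Lemma lookup_prefix T t : forall best, prefixb (fst best) t = true ->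
  prefixb (fst (lookup T best t)) t = true.
Proof.
induction T as [|[s v] T IH]; intros best Hb; cbn; [auto|].
apply IH. destruct (prefixb s t) eqn:E; cbn; auto.
destruct (_ <=? _)%nat; auto.
Qed.

(** * From the potential to a bound for all trajectories *)

(** A hop lands at most one level above the piece hopped over, which is not the mover. *)
Lemma moves_front X Y r f r' f' a b c d :
  spans X r f -> spans Y r' f' -> moves X Y a b c d -> f' <= f + 1.
Proof.
intros (X1 & _) (_ & _ & (u & v & Yu & Lu)) (Ha & HY & HM).
apply HY in Yu. destruct Yu as [[-> ->]|[Xu _]]; [|apply X1 in Xu; lia].
pose proof (X1 _ _ Ha). destruct HM as [[HM _]|HM]; [unfold adjacent in HM; lia|].
assert (G : forall a' b' c' d', jumps (minus X a b) a' b' c' d' -> c' + d' <= f + 1).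
{ clear - X1. intros a' b' c' d' J. induction J as [a' b' c' d' [_ J]|]; auto.
  destruct J as [(->&->&[J _])|[(->&->&[J _])|[(->&->&[J _])|(->&->&[J _])]]];
   apply X1 in J; lia. }
apply G in HM. lia.
Qed.

Lemma moves_rear X Y r f r' f' a b c d :
  spans X r f -> spans Y r' f' -> moves X Y a b c d -> r' <= r + 1.
Proof.
intros SX SY M. apply moves_opposite in M.
pose proof (moves_front _ _ _ _ _ _ _ _ _ _ (spans_opposite _ _ _ SY) (spans_opposite _ _ _ SX) M).
lia.
Qed.

(** Excludes a gain at one end with a loss at the other. Moves outside the four letters then have
    total gain at most -1, hence weight at least 7. *)
Lemma moves_gain X Y r f r' f' a b c d :
  five_pieces X -> spans X r f -> spans Y r' f' -> moves X Y a b c d ->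
  (f' = f + 1 -> r <= r') /\ (r' = r + 1 -> f <= f').
Proof.
intros Hb (X1 & (xr & yr & X2 & X2') & (xf & yf & X3 & X3'))
  (Y1 & (ur & vr & Y2 & Y2') & (uf & vf & Y3 & Y3')) (Ha & HY & HM). split; intros E.
- apply HY in Y3. apply HY in Y2.
  assert (c + d = f + 1) by (destruct Y3 as [[-> ->]|[Y3 _]]; [lia|apply X1 in Y3; lia]).
  pose proof (X1 _ _ Ha). destruct Y2 as [[-> ->]|[Y2 _]]; [lia|apply X1 in Y2; lia].
- assert (Hr : unique X r a b).
  { intros u v Hx Hl. apply NNPP; intro Hn.
    assert (Hy : Y u v) by (apply HY; auto). apply Y1 in Hy; lia. }
  destruct (classic (xf = a /\ yf = b)) as [[-> ->]|Nf].
  + exfalso. pose proof (Hr _ _ X2 X2').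
    destruct (Hb a b a b a b a b) as (u & v & Xu & Nu & _). apply Nu, Hr; auto.
    apply X1 in Xu. lia.
  + assert (Hy : Y xf yf) by (apply HY; auto). apply Y1 in Hy. lia.
Qed.

(** The invariant is a recorded prefix of the history whose potential is at most the accumulated
    weight. The table is kept abstract, so that only [potential_feasible] computes with the actual
    one. *)
Lemma weight_bound_of (T : table) (X : nat -> config) (r f : nat -> Z) :
  feasible T = true -> (forall i, spans (X i) (r i) (f i)) -> five_pieces (X O) ->
  (forall i, exists a b c d, moves (X i) (X (S i)) a b c d) ->
  forall n, -6 <= 4 * Z.of_nat n - 3 * (r n - r O) - 3 * (f n - f O).
Proof.
intros Hf HS Hb0 HM.
assert (Hb : forall i, five_pieces (X i)).
{ induction i; auto. destruct (HM i) as (a & b & c & d & M). eapply moves_five_pieces; eauto. }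
unfold feasible in Hf.
apply andb_prop in Hf. destruct Hf as [Hnil Hf]. rewrite forallb_forall in Hf.
assert (Hv : forall s v odd, In (s, v) T -> -6 <= value v odd <= 0 /\
  (forall x, (x = LB -> odd = true) -> dead (x :: s) = false ->
    value (snd (lookup T ([], (0, 0)) (x :: s))) (xorb odd (changes x)) <=
      value v odd + weight x)).
{ intros s v odd Hs. apply Hf in Hs. cbv beta iota in Hs. rewrite forallb_forall in Hs.
  specialize (Hs odd ltac:(destruct odd; cbn; auto)).
  apply andb_prop in Hs. destruct Hs as [Hs H3].
  apply andb_prop in Hs. destruct Hs as [H1 H2]. split; [lia|].
  intros x Hx Hd. rewrite forallb_forall in H3.
  specialize (H3 x ltac:(destruct x; cbn; auto)). rewrite Hd in H3.
  destruct x; try rewrite (Hx eq_refl) in *; cbn [negb orb] in H3; lia. }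
clear Hf.
assert (Hn : exists v0, In ([], v0) T).
{ apply existsb_exists in Hnil. destruct Hnil as ([[|x s] v0] & Hin & E); [eauto|].
  cbn in E. discriminate. }
destruct Hn as [v0 Hn]. clear Hnil.
assert (Main : forall n, exists s v, In (s, v) T /\ history s (X n) (r n) (f n) /\
   value v (Z.odd (f n - r n)) <= 4 * Z.of_nat n - 3 * (r n - r O) - 3 * (f n - f O)).
{ induction n as [|n (s & v & Hs & Hh & Hle)].
  - exists [], v0. split; [auto|]. split; [split; [auto|split; [auto|cbn; auto]]|].
    destruct (Hv _ _ (Z.odd (f O - r O)) Hn) as [Hb1 _]. cbn [Z.of_nat]. lia.
  - destruct (HM n) as (a & b & c & d & M).
    pose proof (moves_front _ _ _ _ _ _ _ _ _ _ (HS n) (HS (S n)) M) as Gf.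
    pose proof (moves_rear _ _ _ _ _ _ _ _ _ _ (HS n) (HS (S n)) M) as Gr.
    destruct (moves_gain _ _ _ _ _ _ _ _ _ _ (Hb n) (HS n) (HS (S n)) M) as [G1 G2].
    destruct (Hv s v (Z.odd (f n - r n)) Hs) as [Hb1 Hstep].
    assert (Hl : (exists x, r (S n) = r n + rear_gain x /\ f (S n) = f n + front_gain x) \/
      (r (S n) - r n) + (f (S n) - f n) <= -1).
    { destruct (Z_le_gt_dec ((r (S n) - r n) + (f (S n) - f n)) (-1)); [auto|left].
      destruct (Z.eq_dec (r (S n)) (r n + 1)); destruct (Z.eq_dec (f (S n)) (f n + 1));
      [exists LB|exists LR|exists LF|exists LN]; cbn -[Z.add]; lia. }
    destruct Hl as [[x [Er Ef]]|Hl].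
    + assert (Hx : history (x :: s) (X (S n)) (r (S n)) (f (S n))).
      { split; [auto|split; [auto|]]. exists (X n). split; [eauto|].
        replace (r (S n) - rear_gain x) with (r n) by lia.
        replace (f (S n) - front_gain x) with (f n) by lia. auto. }
      assert (Hd : dead (x :: s) = false).
      { destruct (dead (x :: s)) eqn:E; auto. destruct (dead_history _ _ _ _ E Hx). }
      assert (Hodd : x = LB -> Z.odd (f n - r n) = true).
      { intros ->. cbn [rear_gain front_gain] in *.
        destruct (back_inv (X n) (X (S n)) (r n) (f n) a b c d (Hb n) (HS n)) as (E1 & _ & E2 & J); auto.
        { rewrite <- Er, <- Ef. auto. }
        destruct (jumps_parity _ _ _ _ _ J) as [[i Hi] [j Hj]].
        replace (f n - r n) with (1 + 2 * (i + j - 1)) by lia.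
        rewrite Z.odd_add_mul_2. auto. }
      specialize (Hstep x Hodd Hd).
      assert (Eo : xorb (Z.odd (f n - r n)) (changes x) = Z.odd (f (S n) - r (S n))).
      { replace (f (S n) - r (S n)) with ((f n - r n) + (front_gain x - rear_gain x)) by lia.
        rewrite Z.odd_add. destruct x; auto. }
      rewrite Eo in Hstep.
      assert (Ew : weight x = 4 - 3 * rear_gain x - 3 * front_gain x) by (destruct x; auto).
      destruct (lookup_in T (x :: s) ([], (0, 0))) as [H|H].
      * pose proof (lookup_prefix T (x :: s) ([], (0, 0)) eq_refl) as Hp.
        destruct (lookup T ([], (0, 0)) (x :: s)) as [s' v'].
        exists s', v'. split; [auto|split].
        -- destruct (prefixb_app _ _ Hp) as [u Hu]. cbn [fst] in Hu.
           rewrite Hu in Hx. exact (history_prefix _ _ _ _ _ Hx).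
        -- cbn [snd] in Hstep. lia.
      (* [lookup] returned its default, of value 0; the empty prefix has value at most 0. *)
      * rewrite H in Hstep. exists [], v0. split; [auto|].
        split; [split; [auto|split; [auto|cbn; auto]]|].
        destruct (Hv _ _ (Z.odd (f (S n) - r (S n))) Hn) as [Hb2 _].
        destruct (Z.odd (f (S n) - r (S n))); cbn [value fst snd] in *; lia.
    (* The old value is at least -6 and the weight at least 7, so the history may restart from the
       empty prefix, of value at most 0. *)
    + exists [], v0. split; [auto|]. split; [split; [auto|split; [auto|cbn; auto]]|].
      destruct (Hv _ _ (Z.odd (f (S n) - r (S n))) Hn) as [Hb2 _]. lia. }
intros n. destruct (Main n) as (s & v & Hs & _ & Hle).
destruct (Hv s v (Z.odd (f n - r n)) Hs) as [Hb1 _]. lia.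
Qed.

Theorem weight_bound (X : nat -> config) (r f : nat -> Z) :
  (forall i, spans (X i) (r i) (f i)) -> five_pieces (X O) ->
  (forall i, exists a b c d, moves (X i) (X (S i)) a b c d) ->
  forall n, -6 <= 4 * Z.of_nat n - 3 * (r n - r O) - 3 * (f n - f O).
Proof. exact (weight_bound_of potential X r f potential_feasible). Qed.

End Levels.

(* From finite sets of points to predicates on cells *)
Require Import Defs.
From mathcomp Require Import all_boot all_order all_algebra finmap.
From mathcomp Require Import zify ssrZ lra.
Import Order.TTheory GRing.Theory Num.Theory.
Delimit Scope Z_scope with BZ.
Local Open Scope fset_scope.
Local Open Scope ring_scope.

(* [b] and [b'] tell which coordinates are reversed, so that the displacement
   under study has nonnegative coordinates. *)
Definition signed (b : bool) (n : int) : int := if b then - n else n.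
Definition xcoord (b : bool) (x : point 2) : Z := Z_of_int (signed b (x 0 0)).
Definition ycoord (b : bool) (x : point 2) : Z := Z_of_int (signed b (x 0 1)).
Definition cell (b b' : bool) (u v : Z) : point 2 :=
  \row_i (if i == 0 then signed b (int_of_Z u) else signed b' (int_of_Z v)).
Definition cells (b b' : bool) (X : placement 2) : config :=
  fun u v => cell b b' u v \in X.

Lemma ord2P (i : 'I_2) : i = 0 \/ i = 1.
Proof. by case: i => [[|[|//]] Hi]; [left|right]; apply: val_inj. Qed.

Lemma xcoordD b (x y : point 2) : xcoord b (x + y) = (xcoord b x + xcoord b y)%BZ.
Proof. rewrite /xcoord mxE /signed; case: b => /=; lia. Qed.
Lemma ycoordD b (x y : point 2) : ycoord b (x + y) = (ycoord b x + ycoord b y)%BZ.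
Proof. rewrite /ycoord mxE /signed; case: b => /=; lia. Qed.

Lemma xcoord_cell b b' u v : xcoord b (cell b b' u v) = u.
Proof. rewrite /xcoord mxE /= /signed; case: b => /=; lia. Qed.
Lemma ycoord_cell b b' u v : ycoord b' (cell b b' u v) = v.
Proof. rewrite /ycoord mxE /= /signed; case: b' => /=; lia. Qed.

Lemma cellK b b' (x : point 2) : cell b b' (xcoord b x) (ycoord b' x) = x.
Proof.
apply/rowP => i; rewrite mxE /xcoord /ycoord /signed.
by case: (ord2P i) => -> /=; [case: b|case: b'] => /=; lia.
Qed.

Lemma cell_eq b b' u v (x : point 2) :
  (cell b b' u v = x) <-> (u = xcoord b x /\ v = ycoord b' x).
Proof.
split=> [<-|[-> ->]]; last exact: cellK.
by rewrite xcoord_cell ycoord_cell.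
Qed.

Lemma cells_point b b' X (x : point 2) : cells b b' X (xcoord b x) (ycoord b' x) = (x \in X) :> Prop.
Proof. by rewrite /cells cellK. Qed.

Lemma unit_coord b b' (e : point 2) : unit_vector e ->
  let dx := xcoord b e in let dy := ycoord b' e in
  ((dx = 1 /\ dy = 0) \/ (dx = -1 /\ dy = 0) \/ (dx = 0 /\ dy = 1) \/ (dx = 0 /\ dy = -1))%BZ.
Proof.
move=> [i He] /=; rewrite /xcoord /ycoord /signed.
have {He}: (e 0 0 = 1 /\ e 0 1 = 0) \/ (e 0 0 = -1 /\ e 0 1 = 0) \/
           (e 0 0 = 0 /\ e 0 1 = 1) \/ (e 0 0 = 0 /\ e 0 1 = -1).
  by case: He => ->; case: (ord2P i) => ->; rewrite !mxE /=; intuition.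
by case: b; case: b' => /=; lia.
Qed.

Lemma hop_cells b b' B l l' : Defs.hop B l l' ->
  zhop (cells b b' B) (xcoord b l) (ycoord b' l) (xcoord b l') (ycoord b' l').
Proof.
move=> [e [/(unit_coord b b') /= He Hle -> Hl']].
move: Hl' Hle; rewrite mulr2n addrA => Hl' Hle.
split; first by rewrite cells_point; apply/negP.
have Hm : cells b b' B (xcoord b l + xcoord b e)%BZ (ycoord b' l + ycoord b' e)%BZ.
  by rewrite -xcoordD -ycoordD cells_point.
rewrite !xcoordD !ycoordD.
move: He Hm; case=> [[-> ->]|[[-> ->]|[[-> ->]|[-> ->]]]]; rewrite ?Z.add_0_r => Hm.
- left; split; [lia|split; [lia|exact: Hm]].
- right; left; split; [lia|split; [lia|exact: Hm]].
- right; right; left; split; [lia|split; [lia|exact: Hm]].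
- right; right; right; split; [lia|split; [lia|exact: Hm]].
Qed.

Lemma jumps_trans B a b c d u v : jumps B a b c d -> jumps B c d u v -> jumps B a b u v.
Proof. by move=> J; elim: J u v => *; [apply: jumps_cons; eauto|apply: jumps_cons; eauto]. Qed.

Lemma jump_cells b b' X l l' : jump X l l' ->
  jumps (minus (cells b b' X) (xcoord b l) (ycoord b' l))
        (xcoord b l) (ycoord b' l) (xcoord b l') (ycoord b' l').
Proof.
move=> H; apply: (@jumps_ext (cells b b' (X `\ l))).
  move=> u v; rewrite /cells /minus in_fsetD1 -cell_eq; split.
    by move=> /andP[/eqP ? ?]; split.
  by move=> [? /eqP ?]; apply/andP; split.
move: H; rewrite /jump; move: (X `\ l) => B; elim=> [x y Hh|x y z _ J1 _ J2]; first exact/jumps_one/hop_cells.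
exact: jumps_trans J1 J2.
Qed.

Lemma legal_move_cells b b' X Y : legal_move X Y ->
  exists a c d e, moves (cells b b' X) (cells b b' Y) a c d e.
Proof.
move=> [l [l' [Xl Hm ->]]].
exists (xcoord b l), (ycoord b' l), (xcoord b l'), (ycoord b' l').
split; first by rewrite cells_point.
split.
  move=> u v; rewrite /cells in_fset1U in_fsetD1 -!cell_eq; split.
    by case/orP=> [/eqP ?|/andP[/eqP ? ?]]; [left|right].
  by case=> [?|[? /eqP ?]]; apply/orP; [left; apply/eqP|right; apply/andP].
case: Hm => [[e [/(unit_coord b b') /= He -> Hl']]|/jump_cells]; last by right.
left; split; last by rewrite cells_point; apply/negP.
rewrite /adjacent xcoordD ycoordD; lia.
Qed.

Lemma foldr_Zmax (z : Z) (s : seq Z) :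
  (foldr Z.max z s \in z :: s) /\ forall y, y \in z :: s -> (y <= foldr Z.max z s)%BZ.
Proof.
elim: s => [|x s [IH1 IH2]] /=.
  by split=> [|y]; rewrite inE // => /eqP ->; lia.
split.
  case: (Z.max_spec x (foldr Z.max z s)) => -[_ ->]; rewrite !inE ?eqxx ?orbT //.
  by move: IH1; rewrite inE => /orP[->|->]; rewrite ?orbT.
move=> y; rewrite !inE => /or3P[/eqP ->|/eqP ->|ys].
- by have := IH2 z (mem_head _ _); lia.
- by lia.
- by have := IH2 y; rewrite inE ys orbT => /(_ isT); lia.
Qed.

Definition level b b' (x : point 2) : Z := (xcoord b x + ycoord b' x)%BZ.
(** The fold is seeded with a level of the placement, since 0 may exceed all of them. The rear is
    obtained by reversing both axes. *)
Definition front b b' (X : placement 2) : Z :=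
  let s := [seq level b b' x | x <- X] in foldr Z.max (head Z0 s) s.
Definition rear b b' (X : placement 2) : Z := Z.opp (front (~~ b) (~~ b') X).

Lemma front_spec b b' (X : placement 2) : X != fset0 ->
  (exists2 x, x \in X & level b b' x = front b b' X) /\
  forall x, x \in X -> (level b b' x <= front b b' X)%BZ.
Proof.
move=> X0; rewrite /front; set s := [seq _ | _ <- _].
have [H1 H2] := foldr_Zmax (head Z0 s) s.
have hs : head Z0 s \in s.
  have /fset0Pn[x Xx] := X0.
  have : level b b' x \in s by apply/mapP; exists x.
  by case: (s) => //= y s' _; rewrite mem_head.
have H1' : foldr Z.max (head Z0 s) s \in s.
  by move: H1; rewrite inE => /orP[/eqP ->|].
split.
  by case/mapP: H1' => x Xx E; exists x.
by move=> x Xx; apply: H2; rewrite inE; apply/orP; right; apply/mapP; exists x.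
Qed.

Lemma level_opp b b' x : level (~~ b) (~~ b') x = Z.opp (level b b' x).
Proof. rewrite /level /xcoord /ycoord /signed; case: b; case: b' => /=; lia. Qed.

Lemma cells_spans b b' X : X != fset0 -> spans (cells b b' X) (rear b b' X) (front b b' X).
Proof.
move=> X0; have [[x Xx Ex] Hx] := front_spec b b' X X0.
have [[y Xy Ey] Hy] := front_spec (~~ b) (~~ b') X X0.
rewrite level_opp in Ey; rewrite /rear; split; last split.
- move=> u v Huv; have := Hx _ Huv; have := Hy _ Huv; rewrite level_opp /level.
  rewrite xcoord_cell ycoord_cell; lia.
- exists (xcoord b y), (ycoord b' y); rewrite cells_point; split=> //.
  by move: Ey; rewrite /level; lia.
- by exists (xcoord b x), (ycoord b' x); rewrite cells_point; split.
Qed.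

Lemma cells_five_pieces b b' (X : placement 2) : (5 <= #|` X|)%N -> five_pieces (cells b b' X).
Proof.
move=> X5 a1 b1 a2 b2 a3 b3 a4 b4.
pose s := [:: cell b b' a1 b1; cell b b' a2 b2; cell b b' a3 b3; cell b b' a4 b4].
have /fsubsetPn[x Xx Nx] : ~~ (X `<=` [fset y in s]).
  apply/negP => /fsubset_leq_card; rewrite leqNgt => /negP; apply.
  apply: leq_trans X5; rewrite ltnS card_fseq.
  exact: (size_undup s).
exists (xcoord b x), (ycoord b' x); rewrite cells_point; split=> //.
move: Nx; rewrite !inE !negb_or andbT => /and4P[/eqP N1 /eqP N2 /eqP N3 /eqP N4].
have K c d : xcoord b x = c /\ ycoord b' x = d -> x = cell b b' c d.
  by case=> <- <-; rewrite cellK.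
by split; [|split; [|split]] => /K.
Qed.

Lemma cells_translate b b' (X : placement 2) (a : point 2) u v :
  cells b b' [fset x + a | x in X] u v <->
  cells b b' X (u - xcoord b a)%BZ (v - ycoord b' a)%BZ.
Proof.
have E : cell b b' (u - xcoord b a)%BZ (v - ycoord b' a)%BZ = cell b b' u v - a.
  apply/cell_eq; rewrite xcoordD ycoordD xcoord_cell ycoord_cell.
  by rewrite /xcoord /ycoord !mxE /signed; case: (b); case: (b') => /=; lia.
rewrite /cells E; split.
  by case/imfsetP => x /= Xx ->; rewrite addrK.
by move=> Hx; apply/imfsetP; exists (cell b b' u v - a); rewrite ?subrK.
Qed.

(** * Periodic repetition of a trajectory *)

Lemma moves_ext X Y Y' a b c d :
  (forall u v, Y' u v <-> Y u v) -> moves X Y a b c d -> moves X Y' a b c d.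
Proof. by move=> E [H1 [H2 H3]]; split=> //; split=> // u v; rewrite E H2. Qed.

Lemma spans_translate p q X r f :
  spans X r f -> spans (translate p q X) (r - p - q)%BZ (f - p - q)%BZ.
Proof.
move=> [H1 [[a [b [H2 H2']]] [c [d [H3 H3']]]]]; rewrite /translate; split; last split.
- by move=> u v /H1; lia.
- by exists (a - p)%BZ, (b - q)%BZ; rewrite !Z.sub_add; split=> //; lia.
- by exists (c - p)%BZ, (d - q)%BZ; rewrite !Z.sub_add; split=> //; lia.
Qed.

(* The trajectory is repeated periodically, so that the constant in [weight_bound]
   becomes negligible. *)
Lemma translation_bound (m : nat) (X : nat -> placement 2) (a : point 2) :
  trajectory m X -> (5 <= #|` X 0%N|)%N -> X m = [fset x + a | x in X 0%N] ->
  (`|a 0 0| + `|a 0 1|) *+ 3 <= (m * 2)%N%:Z.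
Proof.
move=> [m0 HX] X5 Xm.
(* Reversing the axes on which [a] is negative makes [A1 + A2] equal to |a|_1. *)
pose b := a 0 0 < 0; pose b' := a 0 1 < 0.
pose A1 := xcoord b a; pose A2 := ycoord b' a.
have EA : (`|a 0 0| + `|a 0 1|) = int_of_Z (A1 + A2)%BZ.
  rewrite /A1 /A2 /xcoord /ycoord /signed /b /b'.
  by move: (a 0 0) (a 0 1) => x y; case: (ltP x 0); case: (ltP y 0) => /=; lia.
have Xn0 : forall j, (j <= m)%N -> X j != fset0.
  case=> [_|j /HX [l [l' [_ _ ->]]]].
    by apply: contraTneq X5 => ->; rewrite cardfs0.
  by apply/fset0Pn; exists l'; rewrite in_fset1U eqxx.
pose sh (k : nat) : config -> config :=
  translate (- (Z.of_nat k * A1))%BZ (- (Z.of_nat k * A2))%BZ.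
pose Y i := sh (i %/ m)%N (cells b b' (X (i %% m)%N)).
pose r i := (rear b b' (X (i %% m)%N) + Z.of_nat (i %/ m) * (A1 + A2))%BZ.
pose f i := (front b b' (X (i %% m)%N) + Z.of_nat (i %/ m) * (A1 + A2))%BZ.
have SY i : spans (Y i) (r i) (f i).
  have /(cells_spans b b') S := Xn0 (i %% m)%N (ltnW (ltn_pmod i m0)).
  move: (spans_translate (- (Z.of_nat (i %/ m) * A1))%BZ (- (Z.of_nat (i %/ m) * A2))%BZ _ _ _ S).
  by rewrite /r /f; congr spans; lia.
have bY : five_pieces (Y 0%N).
  have := cells_five_pieces b b' _ X5; rewrite /Y /sh mod0n div0n /translate => H.
  move=> a1 b1 a2 b2 a3 b3 a4 b4.
  have [u [v [H1 H2]]] := H a1 b1 a2 b2 a3 b3 a4 b4; exists u, v; split=> //.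
  by move: H1; congr cells; lia.
have MY i : exists p q u v, moves (Y i) (Y i.+1) p q u v.
  have jm := ltn_pmod i m0.
  have [p [q [u [v M]]]] := legal_move_cells b b' _ _ (HX _ jm).
  have M' := moves_translate (- (Z.of_nat (i %/ m) * A1))%BZ (- (Z.of_nat (i %/ m) * A2))%BZ
    _ _ _ _ _ _ M.
  do 4 eexists; apply: moves_ext M' => {p q u v M} u v.
  rewrite /Y /sh.
  have Ei : i.+1 = ((i %/ m) * m + (i %% m).+1)%N by rewrite addnS -divn_eq.
  case: (ltnP (i %% m).+1 m) => jm1.
    have -> : (i.+1 %% m = (i %% m).+1)%N by rewrite Ei modnMDl modn_small.
    have -> : (i.+1 %/ m = i %/ m)%N by rewrite Ei divnMDl // (divn_small jm1) addn0.
    by [].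
  (* At the end of a period the next placement is [X m], a translate of [X 0], so it is the start of
     the next translated copy. *)
  have jm2 : (i %% m).+1 = m by apply/eqP; rewrite eqn_leq jm1 jm.
  have -> : (i.+1 %% m = 0)%N by rewrite Ei jm2 modnMDl modnn.
  have -> : (i.+1 %/ m = (i %/ m).+1)%N by rewrite Ei jm2 divnMDl // divnn m0 addn1.
  rewrite jm2 Xm /translate cells_translate -/A1 -/A2.
  have -> : (u + - (Z.of_nat (i %/ m) * A1) - A1 = u + - (Z.of_nat (i %/ m).+1 * A1))%BZ by lia.
  have -> : (v + - (Z.of_nat (i %/ m) * A2) - A2 = v + - (Z.of_nat (i %/ m).+1 * A2))%BZ by lia.
  by [].
(* Seven periods: -6 <= 7 (4m - 6|a|_1) forces the integer 4m - 6|a|_1 to be nonnegative. *)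
have := weight_bound Y r f SY bY MY (7 * m)%N.
rewrite /r /f mod0n div0n modnMl (mulnK _ m0) EA => H.
rewrite -mulr_natr. lia.
Qed.

(** * Centroids and the speed bound *)

Lemma card_translate (n : nat) (X : placement n) (a : point n) :
  #|` [fset x + a | x in X]| = #|` X|.
Proof. by apply: card_imfset => x y /addIr. Qed.

Lemma centroid_translate (n : nat) (X : placement n) (a : point n) :
  X != fset0 -> centroid [fset x + a | x in X] = centroid X + map_mx intr a.
Proof.
move=> X0; rewrite /centroid card_translate big_imfset /=; last by move=> x y _ _ /addIr.
under eq_bigr do rewrite map_mxD /=.
rewrite big_split /= scalerDr; congr (_ + _).
rewrite big_const_seq count_predT -/(#|` X|) iter_addr_0.
rewrite -scaler_nat scalerA mulVf ?scale1r // pnatr_eq0 -lt0n.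
by rewrite cardfs_gt0.
Qed.

Theorem theorem6p5 (p : nat) (C : placement 2 -> Prop) :
  is_configuration p C -> (5 <= p)%N -> speed_at_most C (2%:R / 3%:R).
Proof.
move=> [p0 [P [cP HC]]] p5 m X T /HC [a0 E0] /HC [a1 E1].
have X5 : (5 <= #|` X 0%N|)%N by rewrite -E0 card_translate cP.
have Em : X m = [fset x + (a1 - a0) | x in X 0%N].
  have E x : x + a0 + (a1 - a0) = x + a1 by rewrite -addrA (addrCA a0) subrr addr0.
  rewrite -E1 -E0; apply/fsetP => y; apply/imfsetP/imfsetP => -[x /= Hx ->].
    by exists (x + a0); rewrite ?E //; apply/imfsetP; exists x.
  by case/imfsetP: Hx => z /= Hz ->; exists z; rewrite ?E.
have := translation_bound m X _ T X5 Em.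
have X0 : X 0%N != fset0 by apply: contraTneq X5 => ->; rewrite cardfs0.
case: T => m0 _; move: (a1 - a0) Em => a Em Ha.
(* Only the translation vector survives in the difference of the centroids, so the displacement is
   |a|_1. *)
rewrite /trajectory_speed /displacement Em !big_ord_recl big_ord0 addr0.
rewrite centroid_translate // ![(centroid _ + _) _ _]mxE.
rewrite !opprD !addrA !subrr !sub0r !normrN !mxE.
have -> : lift ord0 ord0 = 1 :> 'I_2 by apply: val_inj.
rewrite -!intr_norm -intrD ler_pdivrMr ?ltr0n //.
move: Ha; rewrite -(ler_int rat) rmorphMn /= -pmulrn natrM.
by set t := (_ + _)%:~R; lra.
Qed.
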